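(* Let $Q\subset\mathbb{R}^d$ be open, let $(\Omega,\mathscr{M},\mu)$ be a probability space carrying a $d$-dimensional dynamical system $T$, let $\Phi$ be an $N$-function of class $\Delta_2\cap\nabla_2$ and let $A$ be an $H$-supralgebra on $\mathbb{R}^d_y$. Let $E$ be a fundamental sequence. Then any bounded sequence $(u_\varepsilon)_{\varepsilon\in E}$ in $L^\Phi(Q\times\Omega)$ admits a subsequence which is weakly stochastically $\Sigma$-convergent in $L^\Phi(Q\times\Omega)$ (to some $u_0\in L^\Phi(Q\times\Omega;\mathcal{X}_A^\Phi)$).
   Context: **N-functions and Orlicz spaces.** An $N$-function is a continuous convex $\Phi:[0,\infty)\to[0,\infty)$ with $\Phi(t)>0$ for $t>0$, $\Phi(t)/t\to0$ as $t\to0$, $\Phi(t)/t\to\infty$ as $t\to\infty$. Its conjugate is $\widetilde\Phi(t)=\sup_{s\ge0}(st-\Phi(s))$. $\Phi\in\Delta_2$ if there are $t_0>0,k>2$ with $\Phi(2t)\le k\Phi(t)$ for $t\ge t_0$. $\Phi\in\nabla_2$ if there are $t_0>0,c>2$ with $\Phi(t)\le\frac1{2c}\Phi(ct)$ for $t\ge t_0$ (equivalently $\widetilde\Phi\in\Delta_2$). For a measure space $(X,m)$, $L^\Phi(X)$ is the space of (classes of) measurable scalar functions $u$ with $\int_X\Phi(|u|/\delta)\,dm<\infty$ for some $\delta>0$, with the Luxemburg norm $\inf\{\delta>0:\int_X\Phi(|u|/\delta)dm\le1\}$. $Q\times\Omega$ carries $dx\,d\mu$. **Dynamical system.** $T=\{T(x):\Omega\to\Omega,\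 x\in\mathbb{R}^d\}$ is a family of invertible bimeasurable maps with $T(0)=\mathrm{id}$, $T(x_1+x_2)=T(x_1)\circ T(x_2)$, $\mu(T(x)F)=\mu(F)$ for $F\in\mathscr{M}$, and $\{(x,\omega):T(x)\omega\in F\}$ measurable for the product of the Lebesgue $\sigma$-algebra and $\mathscr{M}$. Put $(U(x)f)(\omega)=f(T(x)\omega)$. $\mathcal{C}^\infty(\Omega)$ is the space of $f\in L^\infty(\Omega)$ having stochastic derivatives of all orders in $L^\infty(\Omega)$, where the $i$-th stochastic derivative is $D_if=\lim_{t\to0}t^{-1}(U(te_i)f-f)$ (limit in $L^\infty(\Omega)$). **$H$-supralgebras.** $\mathcal{B}(\mathbb{R}^d)$ is the algebra of bounded continuous complex functions on $\mathbb{R}^d$ with the sup norm. $u\in\mathcal{B}(\mathbb{R}^d)$ has a mean value $M(u)\in\mathbb{C}$ if $u(\cdot/t)\to M(u)$ in $L^\infty(\mathbb{R}^d)$-weak$*$ as $t\to0^+$; then $M(u)=\lim_{r\to\infty}|B_r|^{-1}\int_{B_r}u\,dy$. An $H$-supralgebra $A$ on $\mathbb{R}^d$ is a closed subalgebra of $\mathcal{B}(\mathbb{R}^d)$ containing the constants, closed under complex conjugation, all of whose elements have a mean value. $\Delta(A)$ is its (compact) spectrum, $\mathcal{G}:A\to\mathcal{C}(\Delta(A))$ the Gelfand transformation (an isometric $*$-isomorphism), and $\beta$ the Radon probability measure on $\Delta(A)$ with $M(u)=\int_{\Delta(A)}\mathcal{G}(u)\,d\beta$ for $u\in A$. **Spaces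 associated with $A$.** $\Xi^\Phi$ is the Banach space of $u\in L^\Phi_{\rm loc}(\mathbb{R}^d_y)$ with $\sup_{0<\varepsilon\le1}\|u(\cdot/\varepsilon)\|_{L^\Phi(B_d)}<\infty$ ($B_d$ the open unit ball; this sup is the norm), $\mathfrak{X}_A^\Phi$ is the closure of $A$ in $\Xi^\Phi$, with the seminorm $\|u\|_{\Phi,A}=\inf\{\delta>0:M(\Phi(|u|/\delta))\le1\}$. $\mathcal{G}$ extends continuously to $\mathcal{G}:\mathfrak{X}_A^\Phi\to L^\Phi(\Delta(A))=L^\Phi(\Delta(A),\beta)$; $\mathcal{X}_A^\Phi=\mathfrak{X}_A^\Phi/\ker\mathcal{G}$, with canonical map $\varrho:\mathfrak{X}_A^\Phi\to\mathcal{X}_A^\Phi$ and norm $\|\varrho u\|=\|u\|_{\Phi,A}$. $\mathcal{G}_1(\varrho u)=\mathcal{G}(u)$ defines an isometric isomorphism $\mathcal{G}_1:\mathcal{X}_A^\Phi\to L^\Phi(\Delta(A))$. The formal integral is $\pounds_A\int u\,dy=M(u)=\int_{\Delta(A)}\mathcal{G}_1(u)\,d\beta$. $L^\Phi(Q\times\Omega;\mathcal{X}_A^\Phi)$ is identified, via $\mathcal{G}_1$, with $L^\Phi(Q\times\Omega\times\Delta(A))$ (measure $dx\,d\mu\,d\beta$, Luxemburg norm). **Scales and convergence.** $\varepsilon_1,\varepsilon_2$ are positive functions of $\varepsilon>0$ with $\varepsilon_1,\varepsilon_2,\varepsilon_2/\varepsilon_1\to0$ as $\varepsilon\to0$, such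 that $x\mapsto x/\varepsilon_1$ and $x\mapsto x/\varepsilon_2$ define two actions of the multiplicative group $\mathbb{R}_+^*$ on $\mathbb{R}^d$. A fundamental sequence is a sequence $E=(\varepsilon_n)_{n\ge0}$ with $0<\varepsilon_n\le1$, $\varepsilon_n\to0$. For $f$ on $Q\times\Omega\times\mathbb{R}^d_y$ put $f^\varepsilon(x,\omega)=f(x,T(x/\varepsilon_1)\omega,x/\varepsilon_2)$. A bounded sequence $(u_\varepsilon)$ in $L^\Phi(Q\times\Omega)$ is weakly stochastically $\Sigma$-convergent to $u_0\in L^\Phi(Q\times\Omega;\mathcal{X}_A^\Phi)$ if, as $\varepsilon\to0$, $$\iint_{Q\times\Omega}u_\varepsilon f^\varepsilon\,dx\,d\mu\to\iint_{Q\times\Omega}\pounds_A\int u_0(x,\omega,y)f(x,\omega,y)\,dy\,dx\,d\mu$$ for every $f\in\mathcal{C}_0^\infty(Q)\otimes\mathcal{C}^\infty(\Omega)\otimes A$ (finite sums of products). *)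

(* Defs.v *)
From HB Require Import structures.
From mathcomp Require Import all_boot all_order all_algebra.
From mathcomp Require Import complex.
From mathcomp Require Import all_classical all_reals all_analysis.
From mathcomp Require Import ess_sup_inf.

Set Implicit Arguments.
Unset Strict Implicit.
Unset Printing Implicit Defensive.

Import Order.TTheory GRing.Theory Num.Theory.
Import numFieldNormedType.Exports.

Local Open Scope classical_set_scope.
Local Open Scope ring_scope.

(* [R[i]] with the sort projection in front, so that the topology which
   MathComp-Analysis puts on every [numClosedFieldType] is found. *)
Definition cplx (R : realType) : numClosedFieldType := R[i].

Definition cabs (R : realType) (z : cplx R) : R := ComplexField.Normc.normc z.
Definition cre (R : realType) (z : cplx R) : R := complex.Re z.
Definition cim (R : realType) (z : cplx R) : R := complex.Im z.
Definition cofr (R : realType) (a : R) : cplx R := a%:C%C.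

(* Lebesgue outer measure on R^d, from countable covers by half-open boxes;
   [None] stands for the empty set, so that finite covers are allowed (and the
   empty set has measure zero also when d = 0). *)
Section lebesgue.
Context (d : nat) (R : realType).

Definition box (c : option ('rV[R]_d * 'rV[R]_d)) : set 'rV[R]_d :=
  if c is Some (a, b)
  then [set x | forall i : 'I_d, a ord0 i < x ord0 i <= b ord0 i]
  else set0.

Definition box_volume (c : option ('rV[R]_d * 'rV[R]_d)) : \bar R :=
  if c is Some (a, b)
  then (\prod_(i < d) Num.max 0 (b ord0 i - a ord0 i))%:E
  else 0%E.

Definition lebesgue_outer (X : set 'rV[R]_d) : \bar R :=
  ereal_inf [set (\sum_(0 <= k <oo) box_volume (F k))%E
            | F in [set F : nat -> option ('rV[R]_d * 'rV[R]_d) |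
                     X `<=` \bigcup_k box (F k)]].

Local Open Scope ereal_scope.

Lemma box_volume_ge0 c : 0 <= box_volume c.
Proof.
case: c => [[a b]|] //=; rewrite lee_fin; apply: prodr_ge0 => i _.
by rewrite le_max lexx.
Qed.

Lemma lebesgue_outer_ge0 X : 0 <= lebesgue_outer X.
Proof.
apply: le_ereal_inf_tmp => _ [F _ <-].
by apply: nneseries_ge0 => n _ _; exact: box_volume_ge0.
Qed.

Lemma lebesgue_outer0 : lebesgue_outer set0 = 0.
Proof.
apply/eqP; rewrite eq_le lebesgue_outer_ge0 andbT.
apply: ereal_inf_lbound; exists (fun=> None) => //.
by apply: eseries0.
Qed.

Lemma le_lebesgue_outer : {homo lebesgue_outer : A B / A `<=` B >-> A <= B}.
Proof.
move=> A B AB; apply/ereal_inf_le_tmp => _ [F BF <-].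
by exists F => //; exact: subset_trans AB BF.
Qed.

Lemma lebesgue_outer_sigma_subadditive : sigma_subadditive lebesgue_outer.
Proof.
move=> A; have [[i ioo]|] := pselect (exists i, lebesgue_outer (A i) = +oo).
  rewrite (eseries_pinfty _ _ ioo) ?leey// => n _.
  by rewrite -ltNye (lt_le_trans _ (lebesgue_outer_ge0 _)).
rewrite -forallNE => Aoo.
suff add2e (e : {posnum R}) : lebesgue_outer (\bigcup_n A n) <=
    \sum_(i <oo) lebesgue_outer (A i) + e%:num%:E.
  by apply/lee_addgt0Pr => _/posnumP[].
rewrite (le_trans _ (epsilon_trick _ _ _))//; last first.
  by move=> n; exact: lebesgue_outer_ge0.
pose P n (B : nat -> option ('rV[R]_d * 'rV[R]_d)) :=
  A n `<=` \bigcup_k box (B k) /\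
  \sum_(0 <= k <oo) box_volume (B k) <=
    lebesgue_outer (A n) + (e%:num / (2 ^ n.+1)%:R)%:E.
have [G PG] : {G : nat -> nat -> option ('rV[R]_d * 'rV[R]_d)
                 & forall n, P n (G n)}.
  apply: (@choice _ _ P) => n.
  have fA : lebesgue_outer (A n) \is a fin_num.
    by rewrite ge0_fin_numE ?lebesgue_outer_ge0// ltey; apply/eqP/Aoo.
  have en1 : (0 < e%:num / (2 ^ n.+1)%:R)%R by [].
  have [_ [B AB <-] xS] := lb_ereal_inf_adherent en1 fA.
  by exists B; split => //; exact/ltW.
have G0 x : 0 <= (box_volume \o uncurry G) x by exact: box_volume_ge0.
apply: (@le_trans _ _ (\esum_(x in [set: nat * nat])
                         (box_volume \o uncurry G) x)).
  have /card_esym/ppcard_eqP[f] := card_nat2.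
  apply: ereal_inf_lbound; exists (uncurry G \o f).
    move=> t [n _] /(PG n).1 [k _ Gt]; exists (f^-1%FUN (n, k)) => //=.
    by rewrite invK ?inE.
  rewrite nneseries_esumT => [|n]; last exact: G0.
  rewrite (reindex_esum [set: nat] [set: nat * nat] f)//.
rewrite (_ : [set: nat * nat] = [set: nat] `*`` (fun=> [set: nat])); last first.
  by apply/seteqP; split.
rewrite (eq_esum (b := fun x => box_volume (G x.1 x.2))); last by case.
rewrite -(esum_esum (a := fun i j => box_volume (G i j))); last first.
  by move=> i j _ _; exact: box_volume_ge0.
rewrite -nneseries_esumT; last first.
  by move=> n; apply: esum_ge0 => m _; exact: box_volume_ge0.
apply: lee_nneseries => [n _ _|n _].
  by apply: esum_ge0 => m _; exact: box_volume_ge0.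
rewrite -(nneseries_esumT (a := fun m => box_volume (G n m))).
  exact: (PG n).2.
by move=> m; exact: box_volume_ge0.
Qed.

HB.instance Definition _ := isOuterMeasure.Build R 'rV[R]_d lebesgue_outer
  lebesgue_outer0 lebesgue_outer_ge0 le_lebesgue_outer
  lebesgue_outer_sigma_subadditive.

End lebesgue.

Definition lebesgue_outer_measure (d : nat) (R : realType) :
  {outer_measure set 'rV[R]_d -> \bar R} := @lebesgue_outer d R.

(* R^d with the Lebesgue sigma-algebra, i.e. the Caratheodory-measurable sets. *)
Notation lebesgueType d R :=
  (caratheodory_type (OuterMeasure.sort (lebesgue_outer_measure d R))).

Definition lebesgue_Rd (d : nat) (R : realType) :
    {measure set (lebesgueType d R) -> \bar R} :=
  OuterMeasure.sort (lebesgue_outer_measure d R).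

Section complex_integration.
Context (R : realType) (dT : measure_display) (X : measurableType dT).
Context (m : {measure set X -> \bar R}) (D : set X).

Definition cmeasurable_fun (f : X -> cplx R) : Prop :=
  measurable_fun D (fun x => cre (f x)) /\ measurable_fun D (fun x => cim (f x)).

Definition cintegrable (f : X -> cplx R) : Prop :=
  m.-integrable D (fun x => (cre (f x))%:E) /\
  m.-integrable D (fun x => (cim (f x))%:E).

Definition cintegral (f : X -> cplx R) : cplx R :=
  Complex (\int[m]_(x in D) cre (f x)) (\int[m]_(x in D) cim (f x)).

End complex_integration.

Section orlicz.
Context (R : realType).

Record N_function (Phi : R -> R) : Prop := {
  N_function_ge0 : forall t, 0 <= t -> 0 <= Phi t ;
  N_function_continuous : {within `[0, +oo[, continuous Phi} ;
  N_function_convex : convex_function (`[0, +oo[%classic : set R) Phi ;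
  N_function_gt0 : forall t, 0 < t -> 0 < Phi t ;
  N_function_at0 : Phi t / t @[t --> 0^'+] --> (0 : R) ;
  N_function_atoo : Phi t / t @[t --> +oo] --> +oo }.

Definition Delta2 (Phi : R -> R) : Prop :=
  exists t0 k : R, [/\ 0 < t0, 2 < k &
    forall t, t0 <= t -> Phi (2 * t) <= k * Phi t].

Definition Nabla2 (Phi : R -> R) : Prop :=
  exists t0 c : R, [/\ 0 < t0, 2 < c &
    forall t, t0 <= t -> Phi t <= (2 * c)^-1 * Phi (c * t)].

Context (dT : measure_display) (X : measurableType dT).
Context (m : {measure set X -> \bar R}) (D : set X) (Phi : R -> R).

Definition modular (u : X -> cplx R) (delta : R) : \bar R :=
  (\int[m]_(x in D) (Phi (cabs (u x) / delta))%:E)%E.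

Definition orlicz (u : X -> cplx R) : Prop :=
  cmeasurable_fun D u /\ exists2 delta : R, 0 < delta & (modular u delta < +oo)%E.

Definition luxemburg (u : X -> cplx R) : \bar R :=
  ereal_inf [set delta%:E | delta in
    [set delta : R | 0 < delta /\ (modular u delta <= 1)%E]].

Definition orlicz_bounded (u : nat -> X -> cplx R) : Prop :=
  (forall n, orlicz (u n)) /\
  exists C : R, forall n, (luxemburg (u n) <= C%:E)%E.

End orlicz.

Record dynamical_system (R : realType) (d : nat) (dO : measure_display)
    (Omega : measurableType dO) (mu : probability Omega R)
    (T : 'rV[R]_d -> Omega -> Omega) : Prop := {
  ds_bijective : forall x, bijective (T x) ;
  ds_measurable_preimage : forall x F, measurable F -> measurable (T x @^-1` F) ;
  ds_measurable_image : forall x F, measurable F -> measurable (T x @` F) ;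
  ds_0 : forall w, T 0 w = w ;
  ds_add : forall x1 x2 w, T (x1 + x2) w = T x1 (T x2 w) ;
  ds_invariant : forall x F, measurable F -> mu (T x @` F) = mu F ;
  ds_joint : forall F, measurable F ->
    measurable [set p : lebesgueType d R * Omega | F (T p.1 p.2)] }.

Section test_functions.
Context (R : realType) (d : nat).

Fixpoint iter_partial (s : seq 'I_d) (f : 'rV[R]_d -> R) : 'rV[R]_d -> R :=
  if s is i :: s' then fun x => 'D_(delta_mx ord0 i) (iter_partial s' f) x
  else f.

Definition smooth (f : 'rV[R]_d -> R) : Prop := forall s : seq 'I_d,
  continuous (iter_partial s f) /\
  forall x i, derivable (iter_partial s f) x (delta_mx ord0 i).

Definition C0oo (Q : set 'rV[R]_d) (phi : 'rV[R]_d -> cplx R) : Prop :=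
  [/\ smooth (fun x => cre (phi x)), smooth (fun x => cim (phi x)) &
      exists K : set 'rV[R]_d, [/\ compact K, K `<=` Q &
        forall x, ~ K x -> phi x = 0]].

Context (dO : measure_display) (Omega : measurableType dO).
Context (mu : probability Omega R) (T : 'rV[R]_d -> Omega -> Omega).

Definition Loo (f : Omega -> cplx R) : Prop :=
  cmeasurable_fun setT f /\ (ess_sup mu (fun w => (cabs (f w))%:E) < +oo)%E.

Definition stoch_derivative (i : 'I_d) (f g : Omega -> cplx R) : Prop :=
  ess_sup mu (fun w => (cabs (
    cofr t^-1 * (f (T (t *: delta_mx ord0 i) w) - f w) - g w))%:E)
  @[t --> (0 : R)^'] --> 0%E.

(* [F s] is the iterated stochastic derivative of f along the indices of s. *)
Definition Coo_Omega (f : Omega -> cplx R) : Prop :=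
  exists F : seq 'I_d -> Omega -> cplx R,
    [/\ F [::] = f, forall s, Loo (F s) &
        forall i s, stoch_derivative i (F s) (F (i :: s))].

End test_functions.

Section supralgebra.
Context (R : realType) (d : nat).

Definition bounded_continuous (u : 'rV[R]_d -> cplx R) : Prop :=
  continuous u /\ exists C : R, forall y, cabs (u y) <= C.

(* u(./t) -> m in L^oo weak-* (against all of L^1) as t -> 0+ *)
Definition has_mean_value (u : 'rV[R]_d -> cplx R) (m : cplx R) : Prop :=
  forall g : 'rV[R]_d -> cplx R, cintegrable (lebesgue_Rd d R) setT g ->
    cintegral (lebesgue_Rd d R) setT (fun x => u (t^-1 *: x) * g x)
      @[t --> (0 : R)^'+] --> m * cintegral (lebesgue_Rd d R) setT g.

Record H_supralgebra := {
  supralg_set : set ('rV[R]_d -> cplx R) ;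
  supralg_bounded_continuous : supralg_set `<=` bounded_continuous ;
  supralg_cst : forall c, supralg_set (fun=> c) ;
  supralg_add : forall u v, supralg_set u -> supralg_set v ->
    supralg_set (fun y => u y + v y) ;
  supralg_mul : forall u v, supralg_set u -> supralg_set v ->
    supralg_set (fun y => u y * v y) ;
  supralg_conj : forall u, supralg_set u -> supralg_set (fun y => (u y)^*) ;
  supralg_closed : forall u, bounded_continuous u ->
    (forall e : R, 0 < e ->
       exists2 v, supralg_set v & forall y, cabs (u y - v y) <= e) ->
    supralg_set u ;
  supralg_mean : forall u, supralg_set u -> exists m, has_mean_value u m }.

Definition supralg_elt (A : H_supralgebra) : Type := set_type (supralg_set A).

Definition supralg_fun (A : H_supralgebra) (u : supralg_elt A) :
  'rV[R]_d -> cplx R := \val u.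

Variable A : H_supralgebra.

Record character (chi : supralg_elt A -> cplx R) : Prop := {
  character_add : forall u v w : supralg_elt A,
    supralg_fun w = (fun y => supralg_fun u y + supralg_fun v y) ->
    chi w = chi u + chi v ;
  character_scale : forall (c : cplx R) (u w : supralg_elt A),
    supralg_fun w = (fun y => c * supralg_fun u y) -> chi w = c * chi u ;
  character_mul : forall u v w : supralg_elt A,
    supralg_fun w = (fun y => supralg_fun u y * supralg_fun v y) ->
    chi w = chi u * chi v ;
  character_neq0 : exists u, chi u != 0 }.

Definition eval_at (y : 'rV[R]_d) (u : supralg_elt A) : cplx R :=
  supralg_fun u y.

Lemma character_eval_at y : character (eval_at y).
Proof.
split=> [u v w|c u w|u v w|]; rewrite /eval_at; try by move=> ->.
exists (exist _ (fun=> 1) (mem_set (supralg_cst A 1))).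
by rewrite /supralg_fun /= oner_neq0.
Qed.

Definition characters : set {ptws supralg_elt A -> cplx R} :=
  [set chi | character chi].

(* Delta(A), with the Gelfand topology (pointwise convergence on A). *)
Definition spectrum : Type := set_type characters.

HB.instance Definition _ := Topological.copy spectrum (set_type characters).
HB.instance Definition _ := isPointed.Build spectrum
  (exist _ (eval_at 0) (mem_set (character_eval_at 0))).

Definition gelfand (u : supralg_elt A) (chi : spectrum) : cplx R :=
  (\val chi) u.

Definition spectrum_borel := g_sigma_algebraType (@open spectrum).

HB.instance Definition _ := Measurable.on spectrum_borel.

Definition radon (beta : probability spectrum_borel R) : Prop :=
  forall B : set spectrum_borel, measurable B ->
    beta B = ereal_sup [set beta K | K in
      [set K : set spectrum_borel | @compact spectrum K /\ K `<=` B]].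

Definition represents_mean (beta : probability spectrum_borel R) : Prop :=
  forall u : supralg_elt A,
    has_mean_value (supralg_fun u) (cintegral beta setT (gelfand u)).

End supralgebra.

(* epsilon1, epsilon2 as functions of epsilon > 0; the action condition says
   that (epsilon, x) |-> x / e epsilon is an action of the multiplicative group
   of positive reals on R^d. *)
Definition dilation_action (R : realType) (d : nat) (e : R -> R) : Prop :=
  (forall x : 'rV[R]_d, (e 1)^-1 *: x = x) /\
  forall (s t : R) (x : 'rV[R]_d), 0 < s -> 0 < t ->
    (e (s * t))^-1 *: x = (e s)^-1 *: ((e t)^-1 *: x).

Record scales (R : realType) (d : nat) (eps1 eps2 : R -> R) : Prop := {
  scales_gt0 : forall t, 0 < t -> 0 < eps1 t /\ 0 < eps2 t ;
  scales_cvg1 : eps1 t @[t --> 0^'+] --> (0 : R) ;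
  scales_cvg2 : eps2 t @[t --> 0^'+] --> (0 : R) ;
  scales_separated : eps2 t / eps1 t @[t --> 0^'+] --> (0 : R) ;
  scales_action1 : dilation_action d eps1 ;
  scales_action2 : dilation_action d eps2 }.

Definition fundamental_sequence (R : realType) (E : nat -> R) : Prop :=
  (forall n, 0 < E n <= 1) /\ E n @[n --> \oo] --> (0 : R).

Section sigma_convergence.
Context (R : realType) (d : nat) (Q : set 'rV[R]_d).
Context (dO : measure_display) (Omega : measurableType dO).
Context (mu : probability Omega R) (T : 'rV[R]_d -> Omega -> Omega).
Context (Phi : R -> R) (A : H_supralgebra R d).
Context (beta : probability (spectrum_borel A) R) (eps1 eps2 : R -> R).

(* The elements of C_0^oo(Q) (x) C^oo(Omega) (x) A, seen as A-valued functions
   on Q x Omega, so that the Gelfand transform applies to each value. *)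
Definition test_function (f : 'rV[R]_d -> Omega -> supralg_elt A) : Prop :=
  exists (n : nat) (phi : 'I_n -> 'rV[R]_d -> cplx R)
         (psi : 'I_n -> Omega -> cplx R) (g : 'I_n -> supralg_elt A),
    [/\ forall i, C0oo Q (phi i), forall i, Coo_Omega mu T (psi i) &
        forall x w y, supralg_fun (f x w) y =
          \sum_(i < n) phi i x * psi i w * supralg_fun (g i) y].

Definition oscillate (f : 'rV[R]_d -> Omega -> supralg_elt A) (e : R)
    (z : lebesgueType d R * Omega) : cplx R :=
  supralg_fun (f z.1 (T ((eps1 e)^-1 *: z.1) z.2)) ((eps2 e)^-1 *: z.1).

Definition QOmega : set (lebesgueType d R * Omega) := Q `*` setT.

Definition measure_QOmega :
    {measure set (lebesgueType d R * Omega) -> \bar R} :=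
  (lebesgue_Rd d R \x mu)%E.

(* L^Phi(Q x Omega; X_A^Phi) is identified with L^Phi(Q x Omega x Delta(A))
   through the isometric isomorphism G_1: the limit u0 below stands for
   G_1 o u_0, and the formal integral of u_0 f is the integral of
   (G_1 u_0) (G f) over Delta(A). *)
Definition QOmegaDelta : set (lebesgueType d R * Omega * spectrum_borel A) :=
  QOmega `*` setT.

Definition measure_QOmegaDelta :
    {measure set (lebesgueType d R * Omega * spectrum_borel A) -> \bar R} :=
  (measure_QOmega \x beta)%E.

Definition weakly_sigma_cvg (E : nat -> R)
    (u : nat -> lebesgueType d R * Omega -> cplx R)
    (u0 : lebesgueType d R * Omega * spectrum_borel A -> cplx R) : Prop :=
  [/\ orlicz_bounded measure_QOmega QOmega Phi u,
      orlicz measure_QOmegaDelta QOmegaDelta Phi u0 &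
      forall f, test_function f ->
        cintegral measure_QOmega QOmega
          (fun z => u n z * oscillate f (E n) z) @[n --> \oo] -->
        cintegral measure_QOmegaDelta QOmegaDelta
          (fun z => u0 z * gelfand (f z.1.1 z.1.2) z.2)].

End sigma_convergence.

Arguments QOmega {R d} Q {dO} Omega _.
Arguments measure_QOmega {R} d {dO Omega} mu.

(* Main.v *)
(* Split u into the positive and negative parts of its real and imaginary
   parts, and R^d into the rings i <= |x| < i + 1, so that only a nonnegative
   sequence b_n on a set of finite measure with \int Phi(2 b_n) <= 1 remains.

   On such a set the test functions (x, w) |-> F_n(x, w) oscillating at the
   scales e1 and e2, paired with their limits G on Q x Omega x Delta(A), form
   an algebra on which \int F_n -> \int G: invariance of mu integrates the
   stochastic factor out first, and the mean value property handles the rest.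
   No separability of A or L^Phi is needed. For 0 <= v_n <= 1 choose an
   infinite set S of indices minimising inf_F limsup_(n in S) ||v_n - F_n||_2;
   the parallelogram law makes the limits G of near-minimisers Cauchy in L^2,
   and first-order optimality shows that their limit theta is the weak limit
   of v_n along S against every test pair.

   A general b_n is cut into dyadic layers min(b, tau) + sum_j v^j, each of
   which is bounded. The weak limits add up to w, Phi being superlinear makes
   the tails uniformly small, and convexity of Phi controls \int Phi(w) by
   \int Phi(2 b_n): this factor 2 replaces any use of the Delta_2 and nabla_2
   conditions. Diagonal extraction handles layers, rings and the four parts. *)

Require Import Defs.
From HB Require Import structures.
From mathcomp Require Import all_boot all_order all_algebra.
From mathcomp Require Import complex.
From mathcomp Require Import all_classical all_reals all_analysis.
From mathcomp Require Import measurable_realfun ess_sup_inf.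
From mathcomp Require Import ring lra.

Set Implicit Arguments.
Unset Strict Implicit.
Unset Printing Implicit Defensive.

Import Order.TTheory GRing.Theory Num.Theory.
Import numFieldNormedType.Exports.

Local Open Scope classical_set_scope.
Local Open Scope ring_scope.

(** * Infinite sets of indices *)

(** Since neither [A] nor the space of test functions is assumed separable, a diagonal over
    countably many test functions would not do: one extraction must serve all of them. The minimised
    quantity decreases along infinite subsets, and on a set where no further subset lowers it, a
    lower bound that a limsup gives only for infinitely many indices holds for almost all of them.
    Perturbing a near-minimiser by a small multiple of any test function then makes the residual
    asymptotically orthogonal to that function, whichever it is.

    Oscillating functions and their limits live on different spaces and communicate only through
    means; closure of the pairs under products is what transports squares, hence the [L^2] geometry.
    The limits must also keep the range [[0, 1]], because the bound on each layer is what later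
    controls [Phi] of their sum. Near-minimisers are therefore truncated, and truncation is not
    polynomial: this forces the passage to uniform closures. *)

(* A subsequence is an infinite set S of indices, and convergence along it is
   convergence for the filter [within S \oo]. *)
Definition unbounded (S : set nat) := forall N, exists2 n, (N <= n)%N & S n.

(** Inclusion up to finitely many indices: a diagonal set lies in each stage of its extraction only
    in this sense, so inherited properties are stated for it. *)
Definition almost_sub (S' S : set nat) := \forall n \near \oo, S' n -> S n.

Lemma subset_almost_sub (S' S : set nat) : S' `<=` S -> almost_sub S' S.
Proof. by move=> S'S; apply: nearW. Qed.

Lemma almost_sub_trans S2 S1 S3 :
  almost_sub S1 S2 -> almost_sub S2 S3 -> almost_sub S1 S3.
Proof.
move=> [N _ N12] [M _ M23]; exists (maxn N M) => // n /=; rewrite geq_max.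
by move=> /andP[/N12 n12 /M23 n23] /n12.
Qed.

Lemma unbounded_proper S : unbounded S -> ProperFilter (within S \oo).
Proof.
move=> uS; apply: Build_ProperFilter_ex => P [N _ NP].
by have [n Nn Sn] := uS N; exists n; exact: NP.
Qed.

Lemma within_almost_sub S' S : almost_sub S' S ->
  within S' \oo `=>` within S \oo.
Proof.
move=> [N _ NS] P [M _ MP]; exists (maxn N M) => // n /=; rewrite geq_max.
by move=> /andP[/NS nS /MP nP] /nS.
Qed.

(** This is how minimality of an index set becomes an estimate for almost all of its indices:
    exceptional indices cannot form an infinite subset. *)
Lemma unboundedPn (S : set nat) (P : nat -> Prop) :
  ~ unbounded (S `&` P) -> \forall n \near within S \oo, ~ P n.
Proof.
move=> /existsNP[N NP]; exists N => // n /= Nn Sn Pn.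
by apply: NP; exists n.
Qed.

Lemma unbounded_setI (S' S : set nat) : almost_sub S' S -> unbounded S' ->
  unbounded (S' `&` S).
Proof.
move=> [N _ NS] uS M; have [n + Sn] := uS (maxn N M).
by rewrite geq_max => /andP[Nn Mn]; exists n => //; split => //; exact: NS.
Qed.

Lemma diagonal_extraction (P : nat -> set nat -> Prop) :
  (forall k S' S, almost_sub S' S -> P k S -> P k S') ->
  (forall k S, unbounded S -> exists S', [/\ S' `<=` S, unbounded S' & P k S']) ->
  forall S, unbounded S ->
  exists S', [/\ S' `<=` S, unbounded S' & forall k, P k S'].
Proof.
move=> Pher Pex S uS.
have [nx nxP] : {nx : nat -> set nat -> set nat & forall k S, unbounded S ->
    [/\ nx k S `<=` S, unbounded (nx k S) & P k (nx k S)]}.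
  have /choice[nx nxP] : forall kS : nat * set nat, exists S', unbounded kS.2 ->
     [/\ S' `<=` kS.2, unbounded S' & P kS.1 S'].
    move=> [k S0]; have [uS0|nS0] := pselect (unbounded S0); last by exists S0.
    by have [S' S'P] := Pex k S0 uS0; exists S'.
  by exists (fun k S => nx (k, S)) => k S0 uS0; exact: nxP (k, S0) uS0.
pose T := fix T k := if k is k'.+1 then nx k (T k') else nx 0%N S.
have uT k : unbounded (T k) 
  by elim: k => [|k IH] /=; [have [] := nxP 0%N _ uS|have [] := nxP k.+1 _ IH].
have PT k : P k (T k).
  by case: k => [|k] /=; [have [] := nxP 0%N _ uS|have [] := nxP k.+1 _ (uT k)].
have TS k : T k.+1 `<=` T k by have [] := nxP k.+1 _ (uT k).
have Tle j k : (j <= k)%N -> T k `<=` T j.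
  elim: k => [|k IH]; first by rewrite leqn0 => /eqP->.
  by rewrite leq_eqVlt => /predU1P[->//|/IH jk]; exact: subset_trans jk.
have T0S k : T k `<=` S.
  apply: subset_trans (Tle 0%N k (leq0n k)) _.
  by have [] := nxP 0%N _ uS.
have /choice[x xP] : forall k, exists n, (k <= n)%N /\ T k n.
  by move=> k; have [n] := uT k k; exists n.
exists [set n | exists k, n = x k]; split.
- by move=> _ [k ->]; apply: T0S (xP k).2.
- by move=> N; exists (x N); [have [] := xP N|exists N].
move=> k; apply: (Pher _ _ (T k)); last exact: PT.
(* This threshold exceeds [x j] for every [j < k], so a later member is some [x j] with [j >= k],
   which lies in [T j] and hence in [T k]. *)
exists (\sum_(j < k) (x j).+1)%N => // n /= kn [j nj]; subst n.
have [jk|kj] := ltnP j k; last exact: Tle kj _ (xP j).2.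
move: kn; rewrite (bigD1 (Ordinal jk))//= => kn.
by have := leq_trans (leq_addr _ _) kn; rewrite ltnn.
Qed.

(** Stage [k] passes to a subset whose value is within [1 / (k + 1)] of the infimum over all
    infinite subsets; on the diagonal set the possible further drop is below each of these numbers,
    hence zero. *)
Lemma exhaustion (R : realType) (e : set nat -> R) :
  (forall S, unbounded S -> 0 <= e S) ->
  (forall S' S, unbounded S' -> almost_sub S' S -> e S' <= e S) ->
  forall S, unbounded S -> exists S', [/\ S' `<=` S, unbounded S' &
    forall S'', unbounded S'' -> almost_sub S'' S' -> e S'' = e S'].
Proof.
move=> e0 emono S uS.
pose P k S' := forall S'', unbounded S'' -> almost_sub S'' S' ->
  unbounded S' -> e S' - k.+1%:R^-1 <= e S''.
have [|k S0 uS0|S' [S'S uS' PS']] := @diagonal_extraction P _ _ S uS.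
- move=> k S1 S0 S10 PS0 S2 uS2 S21 uS1.
  have uS0 : unbounded S0.
    by move=> N; have [n Nn []] := unbounded_setI S10 uS1 N; exists n.
  apply: le_trans (PS0 _ uS2 (almost_sub_trans S21 S10) uS0).
  by rewrite lerB//; exact: emono.
- pose A := [set e S' | S' in [set S' | unbounded S' /\ S' `<=` S0]].
  have iA : has_inf A.
    split; first by exists (e S0); apply: imageP; split.
    by exists 0 => _ [S1 [uS1 _] <-]; exact: e0.
  have [_ [S1 [uS1 S10] <-] eS1] := @inf_adherent _ A k.+1%:R^-1 ltac:(by rewrite invr_gt0) iA.
  exists S1; split => // S2 uS2 S21 _.
  rewrite lerBlDr (le_trans (ltW eS1))// lerD2r.
  (* The infimum runs over genuine subsets of [S0], whereas [S2] is only almost contained in [S1];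
     intersecting discards the finitely many strays. *)
  apply: (@le_trans _ _ (e (S2 `&` S1))).
    apply: ge_inf; first by case: iA.
    exists (S2 `&` S1) => //; split; first exact: unbounded_setI.
    by move=> n [_ /S10].
  by apply: emono; [exact: unbounded_setI|exact: subset_almost_sub].
exists S'; split => // S2 uS2 S21; apply/eqP; rewrite eq_le emono//=.
apply/ler_addgt0Pr => _/posnumP[r].
have [k _ kr] := @near_infty_natSinv_lt R r.
have := PS' k _ uS2 S21 uS'; rewrite lerBlDr => /le_trans; apply.
by rewrite lerD2l ltW//; apply: kr => /=.
Qed.

Lemma cvg_within_infty {T : topologicalType} (f : nat -> T) (l : T) S :
  f @ \oo --> l -> f @ within S \oo --> l.
Proof. by move=> fl; apply: cvg_within_filter. Qed.

Lemma cvg_almost_sub {T : topologicalType} (f : nat -> T) (l : T) S' S :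
  almost_sub S' S -> f @ within S \oo --> l -> f @ within S' \oo --> l.
Proof. by move=> S'S fl U /fl; exact: within_almost_sub. Qed.

Lemma cvg_ext {I : Type} {T : topologicalType} (F : set_system I) (f g : I -> T) (a b : T) :
  f =1 g -> a = b -> f @ F --> a -> g @ F --> b.
Proof. by move=> /funext-> ->. Qed.

(** * Algebras of functions with a mean *)

Section bounded_on.
Context {R : realType} {dX : measure_display} {X : measurableType dX}.
Variables (m : {measure set X -> \bar R}) (D : set X).

(** Vanishing off [D] is built in so that every integral runs over the whole space; when [D] has
    finite measure such functions are integrable, and they are stable under sums and products. *)
Definition bounded_on (f : X -> R) : Prop :=
  [/\ measurable_fun setT f, exists B : R, forall x, `|f x| <= B &
      forall x, ~ D x -> f x = 0].

Lemma bounded_onD f g : bounded_on f -> bounded_on g ->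
  bounded_on (fun x => f x + g x).
Proof.
move=> [mf [B fB] f0] [mg [C gC] g0]; split.
- exact: measurable_funD.
- by exists (B + C) => x; rewrite (le_trans (ler_normD _ _))// lerD.
- by move=> x Dx; rewrite f0// g0// addr0.
Qed.

Lemma bounded_onM f g : bounded_on f -> bounded_on g ->
  bounded_on (fun x => f x * g x).
Proof.
move=> [mf [B fB] f0] [mg [C gC] g0]; split.
- exact: measurable_funM.
- by exists (B * C) => x; rewrite normrM ler_pM.
- by move=> x Dx; rewrite f0// mul0r.
Qed.

Lemma bounded_onZ c f : bounded_on f -> bounded_on (fun x => c * f x).
Proof.
move=> [mf [B fB] f0]; split.
- by apply: measurable_funM => //; exact: measurable_cst.
- by exists (`|c| * B) => x; rewrite normrM ler_wpM2l.
- by move=> x Dx; rewrite f0// mulr0.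
Qed.

Lemma bounded_onN f : bounded_on f -> bounded_on (fun x => - f x).
Proof. by move=> /(bounded_onZ (-1)); under eq_fun do rewrite mulN1r. Qed.

Lemma bounded_onB f g : bounded_on f -> bounded_on g ->
  bounded_on (fun x => f x - g x).
Proof. by move=> bf bg; apply: bounded_onD => //; exact: bounded_onN. Qed.

Lemma bounded_on_sqr f : bounded_on f -> bounded_on (fun x => f x ^+ 2).
Proof. by move=> bf; under eq_fun do rewrite expr2; exact: bounded_onM. Qed.

Lemma bounded_on_norm f : bounded_on f -> bounded_on (fun x => `|f x|).
Proof.
move=> [mf [B fB] f0]; split.
- exact: measurableT_comp.
- by exists B => x; rewrite normr_id.
- by move=> x Dx; rewrite f0// normr0.
Qed.

Hypothesis mD : measurable D.

Lemma bounded_on_indic : bounded_on (\1_D : X -> R).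
Proof.
split; first exact: measurable_indic.
  by exists 1 => x; rewrite indicE; case: (x \in D); rewrite ?normr1 ?normr0.
by move=> x Dx; rewrite indicE memNset.
Qed.

Lemma bounded_on0 : bounded_on (fun=> 0).
Proof.
have := bounded_onZ 0 bounded_on_indic.
by under eq_fun do rewrite mul0r.
Qed.

Lemma bounded_on_sum {I : Type} (r : seq I) (f : I -> X -> R) :
  (forall i, bounded_on (f i)) -> bounded_on (fun x => \sum_(i <- r) f i x).
Proof.
move=> bf; elim: r => [|i r IH].
  by under eq_fun do rewrite big_nil; exact: bounded_on0.
by under eq_fun do rewrite big_cons; exact: bounded_onD.
Qed.

Hypothesis Dfin : (m D < +oo)%E.

Lemma bounded_on_integrable f : bounded_on f -> m.-integrable setT (EFin \o f).
Proof.
move=> [mf [B fB] f0].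
have <- : (EFin \o f) \_ D = EFin \o f.
  apply/funext => x; rewrite patchE; case: ifPn => //.
  by rewrite notin_setE /= => /f0 ->.
apply/(integrable_mkcond (EFin \o f) mD).
apply: measurable_bounded_integrable => //; first exact: measurable_funTS.
exists B; split; first exact: num_real.
by move=> y By x Dx /=; exact: le_trans (fB x) (ltW By).
Qed.

Lemma bounded_on_intD f g : bounded_on f -> bounded_on g ->
  \int[m]_x (f x + g x) = \int[m]_x f x + \int[m]_x g x.
Proof. by move=> bf bg; rewrite RintegralD//; exact: bounded_on_integrable. Qed.

Lemma bounded_on_intB f g : bounded_on f -> bounded_on g ->
  \int[m]_x (f x - g x) = \int[m]_x f x - \int[m]_x g x.
Proof. by move=> bf bg; rewrite RintegralB//; exact: bounded_on_integrable. Qed.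

Lemma bounded_on_intZ c f : bounded_on f ->
  \int[m]_x (c * f x) = c * \int[m]_x f x.
Proof. by move=> bf; rewrite RintegralZl//; exact: bounded_on_integrable. Qed.

Lemma bounded_on_int_sum {I : Type} (r : seq I) (f : I -> X -> R) :
  (forall i, bounded_on (f i)) ->
  \int[m]_x (\sum_(i <- r) f i x) = \sum_(i <- r) \int[m]_x f i x.
Proof.
move=> bf; elim: r => [|i r IH].
  rewrite big_nil; under eq_Rintegral do rewrite big_nil.
  by rewrite Rintegral_cst// mul0r.
rewrite big_cons -IH -bounded_on_intD//; last exact: bounded_on_sum.
by apply: eq_Rintegral => x _; rewrite big_cons.
Qed.

Lemma le_bounded_on_int f g : bounded_on f -> bounded_on g ->
  (forall x, f x <= g x) -> \int[m]_x f x <= \int[m]_x g x.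
Proof.
move=> bf bg fg; apply: le_Rintegral => //; exact: bounded_on_integrable.
Qed.

Lemma bounded_on_int_indic : \int[m]_x (\1_D : X -> R) x = fine (m D).
Proof. by rewrite /Rintegral integral_indic// setIT. Qed.

Lemma bounded_on_int_le B f : bounded_on f -> (forall x, `|f x| <= B) ->
  `|\int[m]_x f x| <= B * fine (m D).
Proof.
move=> bf fB; rewrite (le_trans (le_normr_Rintegral _ _))//.
  exact: bounded_on_integrable.
rewrite -bounded_on_int_indic -bounded_on_intZ; last exact: bounded_on_indic.
apply: le_bounded_on_int; first exact: bounded_on_norm.
  exact/bounded_onZ/bounded_on_indic.
move=> x; rewrite indicE; have [_|] := boolP (x \in D); first by rewrite mulr1.
by rewrite notin_setE mulr0 => Dx; have [_ _ ->] := bf; rewrite ?normr0.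
Qed.

Lemma bounded_on_int_norm f g B : bounded_on f -> bounded_on g ->
  (forall x, `|g x| <= B) ->
  `|\int[m]_x (f x * g x)| <= B * \int[m]_x `|f x|.
Proof.
move=> bf bg gB; rewrite (le_trans (le_normr_Rintegral _ _))//.
  exact/bounded_on_integrable/bounded_onM.
rewrite -bounded_on_intZ; last exact: bounded_on_norm.
apply: le_bounded_on_int; first exact/bounded_on_norm/bounded_onM.
  exact/bounded_onZ/bounded_on_norm.
by move=> x; rewrite normrM mulrC ler_wpM2r.
Qed.

End bounded_on.

Section mean_algebra.
Context {R : realType} {dX dY : measure_display}.
Context {X : measurableType dX} {Y : measurableType dY}.
Variables (m : {measure set X -> \bar R}) (m' : {measure set Y -> \bar R}).
Variables (D : set X) (D' : set Y).

(* F is an oscillating test function and G its limit; after Gelfand transform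
   the product of oscillating functions corresponds to the product of limits. *)
Record mean_algebra (V : (nat -> X -> R) -> (Y -> R) -> Prop) : Prop := {
  mean_algebra_src : forall F G, V F G -> forall n, bounded_on D (F n) ;
  mean_algebra_ubound : forall F G, V F G ->
    exists2 B : R, 0 < B & forall n x, `|F n x| <= B ;
  mean_algebra_tgt : forall F G, V F G -> bounded_on D' G ;
  mean_algebra_mean : forall F G, V F G ->
    (fun n => \int[m]_x F n x) @ \oo --> \int[m']_y G y ;
  mean_algebra_unit : V (fun=> \1_D) \1_D' ;
  mean_algebraD : forall F G F' G', V F G -> V F' G' ->
    V (fun n x => F n x + F' n x) (fun y => G y + G' y) ;
  mean_algebraZ : forall c F G, V F G ->
    V (fun n x => c * F n x) (fun y => c * G y) ;
  mean_algebraM : forall F G F' G', V F G -> V F' G' ->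
    V (fun n x => F n x * F' n x) (fun y => G y * G' y) }.

Lemma mean_algebraB V F G F' G' : mean_algebra V -> V F G -> V F' G' ->
  V (fun n x => F n x - F' n x) (fun y => G y - G' y).
Proof.
move=> mV VF /(mean_algebraZ mV (-1)) VF'.
have := mean_algebraD mV VF VF'.
under eq_fun do under eq_fun do rewrite mulN1r.
by under [X in V _ X -> _]eq_fun do rewrite mulN1r.
Qed.

Variable V : (nat -> X -> R) -> (Y -> R) -> Prop.

(** Truncation is not polynomial and may leave [V]. A single pair has to approximate [F], uniformly
    in [n], and [G] simultaneously, so that means still correspond in the limit. *)
Definition uniform_closure (F : nat -> X -> R) (G : Y -> R) : Prop :=
  [/\ forall n, bounded_on D (F n), bounded_on D' G &
      forall e : R, 0 < e -> exists F' G', [/\ V F' G',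
        forall n x, `|F n x - F' n x| <= e & forall y, `|G y - G' y| <= e]].

Hypotheses (mD : measurable D) (mD' : measurable D').
Hypotheses (Dfin : (m D < +oo)%E) (Dfin' : (m' D' < +oo)%E).
Hypothesis mV : mean_algebra V.

Lemma subset_uniform_closure F G : V F G -> uniform_closure F G.
Proof.
move=> VF; split; [exact: mean_algebra_src VF|exact: mean_algebra_tgt VF|].
move=> e e0; exists F, G; split => //.
  by move=> n x; rewrite subrr normr0 ltW.
by move=> y; rewrite subrr normr0 ltW.
Qed.

Lemma uniform_closure_closed F G :
  (forall n, bounded_on D (F n)) -> bounded_on D' G ->
  (forall e : R, 0 < e -> exists F' G', [/\ uniform_closure F' G',
     forall n x, `|F n x - F' n x| <= e & forall y, `|G y - G' y| <= e]) ->
  uniform_closure F G.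
Proof.
move=> bF bG FG; split => // e e0.
have e20 : 0 < e / 2 by rewrite divr_gt0.
have [F' [G' [[_ _ /(_ _ e20)[F'' [G'' [VF FF' GG']]] FF GG]]]] := FG _ e20.
exists F'', G''; split => // [n x|y].
  rewrite (_ : _ - _ = (F n x - F' n x) + (F' n x - F'' n x)); last by ring.
  by rewrite (le_trans (ler_normD _ _))// [leRHS]splitr lerD.
rewrite (_ : _ - _ = (G y - G' y) + (G' y - G'' y)); last by ring.
by rewrite (le_trans (ler_normD _ _))// [leRHS]splitr lerD.
Qed.

Lemma uniform_closure_ubound F G : uniform_closure F G ->
  exists2 B : R, 0 < B & (forall n x, `|F n x| <= B) /\ (forall y, `|G y| <= B).
Proof.
move=> [_ [_ [C GC] _] /(_ 1 ltr01)[F' [G' [VF FF' _]]]].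
have [B B0 FB] := mean_algebra_ubound mV VF.
exists (B + 1 + `|C|); first by rewrite ltr_wpDr// addr_gt0.
split => [n x|y]; last first.
  by rewrite (le_trans (GC y))// (le_trans (ler_norm C))// lerDr addr_ge0// ltW.
rewrite (_ : F n x = F' n x + (F n x - F' n x)); last by ring.
by rewrite (le_trans (ler_normD _ _))// ler_wpDr// lerD.
Qed.

Lemma product_error (a b a' b' B e : R) : 0 < B -> 0 < e -> e <= 1 ->
  `|a| <= B -> `|b| <= B -> `|a - a'| <= e -> `|b - b'| <= e ->
  `|a * b - a' * b'| <= (2 * B + 1) * e.
Proof.
move=> B0 e0 e1 aB bB aa bb.
rewrite (_ : _ - _ = a * (b - b') + b' * (a - a')); last by ring.
have b'B : `|b'| <= B + 1.
  rewrite (_ : b' = b - (b - b')); last by ring.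
  by rewrite (le_trans (ler_normB _ _))// lerD// (le_trans bb).
rewrite (le_trans (ler_normD _ _))// !normrM.
apply: (@le_trans _ _ (B * e + (B + 1) * e)); last by rewrite le_eqVlt; apply/orP; left; apply/eqP; ring.
by rewrite lerD// ler_pM.
Qed.

Lemma uniform_closureM F G F' G' :
  uniform_closure F G -> uniform_closure F' G' ->
  uniform_closure (fun n x => F n x * F' n x) (fun y => G y * G' y).
Proof.
move=> cF cF'; have [B1 B10 [FB1 GB1]] := uniform_closure_ubound cF.
have [B2 B20 [FB2 GB2]] := uniform_closure_ubound cF'.
move: cF cF' => [bF bG cF] [bF' bG' cF'].
split => [n||e e0]; [exact: bounded_onM|exact: bounded_onM|].
pose B := B1 + B2; have B0 : 0 < B by rewrite addr_gt0.
have B1B : B1 <= B by rewrite lerDl ltW.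
have B2B : B2 <= B by rewrite lerDr ltW.
pose e' := Num.min 1 (e / (2 * B + 1)).
have K0 : 0 < 2 * B + 1 by rewrite addr_gt0// mulr_gt0.
have e'0 : 0 < e' by rewrite lt_min ltr01 divr_gt0.
have e'1 : e' <= 1 by rewrite ge_min lexx.
have e'e : (2 * B + 1) * e' <= e.
  by rewrite mulrC -ler_pdivlMr// ge_min lexx orbT.
have [F1 [G1 [VF1 FF1 GG1]]] := cF _ e'0.
have [F2 [G2 [VF2 FF2 GG2]]] := cF' _ e'0.
exists (fun n x => F1 n x * F2 n x), (fun y => G1 y * G2 y); split.
- exact: mean_algebraM.
- move=> n x; apply: le_trans e'e; apply: product_error => //.
  exact: le_trans B1B. exact: le_trans B2B.
- move=> y; apply: le_trans e'e; apply: product_error => //.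
  exact: le_trans B1B. exact: le_trans B2B.
Qed.

Lemma uniform_closureD F G F' G' :
  uniform_closure F G -> uniform_closure F' G' ->
  uniform_closure (fun n x => F n x + F' n x) (fun y => G y + G' y).
Proof.
move=> [bF bG cF] [bF' bG' cF'].
split => [n||e e0]; [exact: bounded_onD|exact: bounded_onD|].
have e20 : 0 < e / 2 by rewrite divr_gt0.
have [F1 [G1 [VF1 FF1 GG1]]] := cF _ e20.
have [F2 [G2 [VF2 FF2 GG2]]] := cF' _ e20.
exists (fun n x => F1 n x + F2 n x), (fun y => G1 y + G2 y); split.
- exact: mean_algebraD.
- move=> n x; rewrite opprD addrACA (le_trans (ler_normD _ _))//.
  by rewrite [leRHS]splitr lerD.
- move=> y; rewrite opprD addrACA (le_trans (ler_normD _ _))//.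
  by rewrite [leRHS]splitr lerD.
Qed.

Lemma uniform_closureZ c F G : uniform_closure F G ->
  uniform_closure (fun n x => c * F n x) (fun y => c * G y).
Proof.
move=> [bF bG cF]; split => [n||e e0]; [exact: bounded_onZ|exact: bounded_onZ|].
have c0 : 0 < `|c| + 1 by rewrite ltr_wpDl.
have e20 : 0 < e / (`|c| + 1) by rewrite divr_gt0.
have cc : `|c| <= `|c| + 1 by rewrite lerDl.
have [F1 [G1 [VF1 FF1 GG1]]] := cF _ e20.
exists (fun n x => c * F1 n x), (fun y => c * G1 y); split.
- exact: mean_algebraZ.
- move=> n x; rewrite -mulrBr normrM.
  apply: (@le_trans _ _ ((`|c| + 1) * (e / (`|c| + 1)))); first by rewrite ler_pM.
  by rewrite mulrC divfK// gt_eqF.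
- move=> y; rewrite -mulrBr normrM.
  apply: (@le_trans _ _ ((`|c| + 1) * (e / (`|c| + 1)))); first by rewrite ler_pM.
  by rewrite mulrC divfK// gt_eqF.
Qed.

Lemma uniform_closure_mean F G : uniform_closure F G ->
  (fun n => \int[m]_x F n x) @ \oo --> \int[m']_y G y.
Proof.
move=> [bF bG cF]; apply/cvgrPdist_le => e e0.
(* Either measure is at most [M], so a uniform error [e / 3 / M] costs at most [e / 3] in each
   integral; the [+ 1] keeps [M] positive. *)
pose M := fine (m D) + fine (m' D') + 1.
have M0 : 0 < M by rewrite ltr_wpDl// addr_ge0// fine_ge0.
have e30 : 0 < e / 3 / M by rewrite !divr_gt0.
have [F' [G' [VF FF' GG']]] := cF _ e30.
have /cvgrPdist_le /(_ (e / 3)) := mean_algebra_mean mV VF.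
have e3 : 0 < e / 3 by rewrite divr_gt0.
move=> /(_ e3); apply: filterS => n FGe.
have bF' : bounded_on D (F' n) := mean_algebra_src mV VF n.
have bG' : bounded_on D' G' := mean_algebra_tgt mV VF.
rewrite (_ : _ - _ = (\int[m']_y G y - \int[m']_y G' y) +
   (\int[m']_y G' y - \int[m]_x F' n x) -
   (\int[m]_x F n x - \int[m]_x F' n x)); last by ring.
rewrite -(bounded_on_intB mD' Dfin')// -(bounded_on_intB mD Dfin)//.
rewrite (le_trans (ler_normB _ _))// (_ : e = e / 3 + e / 3 + e / 3); last by field.
rewrite lerD//; first rewrite (le_trans (ler_normD _ _))// lerD//.
- apply: le_trans (bounded_on_int_le mD' Dfin' _ (B := e / 3 / M) _) _ => //.
    exact: bounded_onB.
  rewrite mulrAC ler_pdivrMr// ler_wpM2l// ?(ltW e3)//.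
  by rewrite /M addrAC lerDr addr_ge0// fine_ge0.
- apply: le_trans (bounded_on_int_le mD Dfin _ (B := e / 3 / M) _) _ => //.
    exact: bounded_onB.
  rewrite mulrAC ler_pdivrMr// ler_wpM2l// ?(ltW e3)//.
  by rewrite /M -addrA lerDl addr_ge0// fine_ge0.
Qed.

Lemma uniform_closure_mean_algebra : mean_algebra uniform_closure.
Proof.
split.
- by move=> F G [].
- by move=> F G /uniform_closure_ubound[B B0 []]; exists B.
- by move=> F G [].
- exact: uniform_closure_mean.
- exact: subset_uniform_closure (mean_algebra_unit mV).
- exact: uniform_closureD.
- exact: uniform_closureZ.
- exact: uniform_closureM.
Qed.

(* Polynomials in [s] increasing to [`|s|] on [-1, 1]. *)
Fixpoint abs_poly (k : nat) (s : R) : R :=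
  if k is k'.+1 then abs_poly k' s + 2^-1 * (s * s - abs_poly k' s * abs_poly k' s)
  else 0 * s.

(** One iteration multiplies the error [r - q], where [r] is the absolute value of [s], by
    [1 - (r + q) / 2 <= 1 - r / 2]. This is not uniformly contracting near [s = 0]; the third bound
    is the invariant that nevertheless yields an error at most [2 / k] for all [s]. *)
Lemma abs_polyP k s : `|s| <= 1 ->
  [/\ 0 <= abs_poly k s, abs_poly k s <= `|s| &
      (`|s| - abs_poly k s) * (2 + k%:R * `|s|) <= 2 * `|s|].
Proof.
move=> s1; elim: k => [|k [q0 qs dq]] /=.
  by rewrite mul0r mul0r addr0 subr0 mulrC; split.
have -> : s * s = `|s| * `|s| by rewrite -normrM ger0_norm// -expr2 sqr_ge0.
have s0 : 0 <= `|s| := normr_ge0 s.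
move: (abs_poly k s) (`|s|) q0 qs dq s0 s1 => q r q0 qr dq r0 r1.
have k0 : 0 <= k%:R :> R by [].
split; [nra|nra|].
have d' : (r - (q + 2^-1 * (r * r - q * q))) <= (r - q) * (1 - r / 2) by nra.
have rk : 0 <= 2 + k.+1%:R * r by rewrite addr_ge0// mulr_ge0.
apply: le_trans (ler_wpM2r rk d') _.
apply: le_trans dq; rewrite -mulrA ler_wpM2l// ?subr_ge0//.
rewrite -natr1 -subr_ge0.
rewrite (_ : _ - _ = (k%:R + 1) * (r * r) / 2); last by field.
by rewrite divr_ge0// mulr_ge0// ?addr_ge0// mulr_ge0.
Qed.

Lemma abs_poly_error k s : `|s| <= 1 -> `| `|s| - abs_poly k.+1 s| <= 2 / k.+1%:R.
Proof.
move=> /(abs_polyP k.+1)[q0 qs dq].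
rewrite ger0_norm ?subr_ge0// ler_pdivlMr//.
have [->|sn0] := eqVneq `|s| 0.
  by rewrite sub0r mulNr (le_trans _ (ler0n R 2))// oppr_le0 mulr_ge0.
have s0 : 0 < `|s| by rewrite lt_neqAle eq_sym sn0 normr_ge0.
rewrite -(ler_pM2r s0) -mulrA (le_trans _ dq)//.
by rewrite ler_wpM2l ?subr_ge0// lerDr.
Qed.

Lemma uniform_closure_abs_poly k F G : uniform_closure F G ->
  uniform_closure (fun n x => abs_poly k (F n x)) (fun y => abs_poly k (G y)).
Proof.
(* The base case of [abs_poly] is [0 * s], so that it is literally a scalar multiple of the given
   pair. *)
move=> cF; elim: k => [|k IH] /=; first exact: uniform_closureZ.
apply: uniform_closureD => //; apply: uniform_closureZ.
apply: (mean_algebraB uniform_closure_mean_algebra); exact: uniform_closureM.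
Qed.

Lemma uniform_closure_norm F G : uniform_closure F G ->
  uniform_closure (fun n x => `|F n x|) (fun y => `|G y|).
Proof.
move=> cF; have [B B0 [FB GB]] := uniform_closure_ubound cF.
apply: uniform_closure_closed.
- by move=> n; apply: bounded_on_norm; case: cF.
- by apply: bounded_on_norm; case: cF.
move=> e e0.
have [k _ kr] := near_infty_natSinv_lt (PosNum (divr_gt0 e0 (mulr_gt0 (ltr0Sn R 1) B0))).
have {kr} ke : B * (2 / k.+1%:R) <= e.
  have /ltW := kr k (leqnn k); rewrite /= ler_pdivlMr ?mulr_gt0//.
  by congr (_ <= _); ring.
have errB (r : R) : `|r| <= B -> `| `|r| - B * abs_poly k.+1 (B^-1 * r)| <= e.
  move=> rB; apply: le_trans ke.
  have {1}-> : r = B * (B^-1 * r) by rewrite mulrA divff ?mul1r// gt_eqF.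
  rewrite normrM (gtr0_norm B0) -mulrBr normrM (gtr0_norm B0) ler_pM2l//.
  by apply: abs_poly_error; rewrite normrM normfV (gtr0_norm B0) ler_pdivrMl// mulr1.
exists (fun n x => B * abs_poly k.+1 (B^-1 * F n x)),
  (fun y => B * abs_poly k.+1 (B^-1 * G y)); split.
- exact/uniform_closureZ/uniform_closure_abs_poly/uniform_closureZ.
- by move=> n x; apply: errB.
- by move=> y; apply: errB.
Qed.

Definition clamp (s : R) : R := Num.max 0 (Num.min s 1).

(** Maximum and minimum are expressed by absolute values. The constant [1] does not vanish off [D],
    so the unit [\1_D] takes its place; off [D] both formulas give [0]. *)
Lemma uniform_closure_clamp F G : uniform_closure F G ->
  uniform_closure (fun n x => clamp (F n x)) (fun y => clamp (G y)).
Proof.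
have clampE (Z : Type) (E : set Z) (f : Z -> R) z : (~ E z -> f z = 0) ->
    clamp (f z) = 2^-1 * (2^-1 * (f z + \1_E z - `|f z - \1_E z|) +
      `|2^-1 * (f z + \1_E z - `|f z - \1_E z|)|).
  rewrite indicE /clamp; have [_ _|] := boolP (z \in E); last first.
    rewrite notin_setE => Ez /(_ Ez) ->.
    by rewrite !subr0 !normr0 addr0 subr0 mulr0 normr0 addr0 mulr0 minEle ler01 maxxx.
  rewrite maxr_absE minr_absE add0r sub0r normrN [RHS]mulrC.
  by rewrite ![2^-1 * (_ - _)]mulrC.
move=> cF; have [bF bG _] := cF.
pose c1 := subset_uniform_closure (mean_algebra_unit mV).
pose mc := uniform_closure_mean_algebra.
have cm : uniform_closure
   (fun n x => 2^-1 * (F n x + \1_D x - `|F n x - \1_D x|))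
   (fun y => 2^-1 * (G y + \1_D' y - `|G y - \1_D' y|)).
  apply: uniform_closureZ; apply: (mean_algebraB mc).
    exact: uniform_closureD.
  by apply: uniform_closure_norm; apply: (mean_algebraB mc).
have := uniform_closureZ 2^-1 (uniform_closureD cm (uniform_closure_norm cm)).
congr uniform_closure.
- apply/funext => n; apply/funext => x; rewrite -clampE// => Dx.
  by have [_ _ ->] := bF n.
- apply/funext => y; rewrite -clampE// => Dx.
  by have [_ _ ->] := bG.
Qed.

End mean_algebra.

(** * Weak limits by minimising the distance to test functions *)

Section int_combination.
Context {R : realType} {dX : measure_display} {X : measurableType dX}.
Variables (m : {measure set X -> \bar R}) (D : set X).
Hypotheses (mD : measurable D) (Dfin : (m D < +oo)%E).

Lemma bounded_on_int3 c1 c2 c3 f g h : bounded_on D f -> bounded_on D g ->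
  bounded_on D h ->
  \int[m]_x (c1 * f x + c2 * g x + c3 * h x) =
  c1 * \int[m]_x f x + c2 * \int[m]_x g x + c3 * \int[m]_x h x.
Proof.
move=> bf bg bh.
rewrite (bounded_on_intD mD Dfin); last 2 first.
- by apply: bounded_onD; exact: bounded_onZ.
- exact: bounded_onZ.
rewrite (bounded_on_intD mD Dfin); [|exact: bounded_onZ..].
by rewrite !(bounded_on_intZ mD Dfin).
Qed.

End int_combination.

(** Quantitative first-order optimality: [d0 - 2 * t * c + t ^+ 2 * N] is a squared distance after a
    step [t]. Neither [t = s] nor [t = - s] can go below [d - s ^+ 2], while [d0] is within [s ^+ 2]
    of [d]; this limits the slope [c]. *)
Lemma two_sided_bound (R : realFieldType) (d d0 c N K s : R) : 0 < s -> 0 <= K ->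
  N <= K -> d0 <= d + s ^+ 2 ->
  d - s ^+ 2 <= d0 - 2 * s * c + s ^+ 2 * N ->
  d - s ^+ 2 <= d0 - 2 * - s * c + (- s) ^+ 2 * N -> `|c| <= s * (1 + K).
Proof.
move=> s0 K0 NK d0d h1 h2; rewrite -(ler_pM2l s0) -{1}(gtr0_norm s0) -normrM ler_norml.
have s20 := ltW (exprn_gt0 2 s0); have := mulr_ge0 s20 K0.
have := ler_wpM2l s20 NK; rewrite sqrrN in h2.
have -> : s * (s * (1 + K)) = s ^+ 2 + s ^+ 2 * K by ring.
by move=> h3 h4; apply/andP; split; lra.
Qed.

Section fast_L2_cauchy.
Context {R : realType} {dY : measure_display} {Y : measurableType dY}.
Variables (m : {measure set Y -> \bar R}) (D : set Y).
Hypotheses (mD : measurable D) (Dfin : (m D < +oo)%E).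
Variable G : nat -> Y -> R.
Hypothesis bG : forall k, bounded_on D (G k).
Hypothesis G01 : forall k y, 0 <= G k y <= 1.
Hypothesis gapG : forall k,
  \int[m]_y ((G k y - G k.+1 y) ^+ 2) <= 8 * (2^-1 ^+ k) ^+ 2.

Let C : R := fine (m D) + 8.

Let C0 : 0 <= C. Proof. by rewrite addr_ge0// fine_ge0. Qed.

Let bh k : bounded_on D (fun y => G k y - G k.+1 y).
Proof. exact: bounded_onB. Qed.

Let int_norm_gap k : \int[m]_y `|G k y - G k.+1 y| <= C * 2^-1 ^+ k.
Proof.
have s0 : 0 < (2^-1 : R) ^+ k by rewrite exprn_gt0.
set s := 2^-1 ^+ k in s0 *.
(* With [h] the gap, [h <= s + h ^+ 2 / s] trades the squared bound [8 * s ^+ 2] for the [L^1] bound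
   [(m D + 8) * s]; this is the origin of [C]. *)
apply: (@le_trans _ _ (\int[m]_y (s * \1_D y + s^-1 * (G k y - G k.+1 y) ^+ 2))).
  apply: (le_bounded_on_int mD Dfin); first exact: bounded_on_norm.
    apply: bounded_onD; apply: bounded_onZ; first exact: bounded_on_indic.
    exact: bounded_on_sqr.
  move=> y; rewrite indicE; have [_|] := boolP (y \in D); last first.
    rewrite notin_setE => Dy; have [_ _ -> //] := bh k.
    by rewrite normr0 expr0n/= !mulr0 addr0.
  rewrite -real_normK ?num_real// mulr1; move: (`|_|) => h.
  rewrite -(ler_pM2r s0) mulrDl mulrAC mulVf ?gt_eqF// mul1r.
  by have := sqr_ge0 (s - h); have := sqr_ge0 s; have := sqr_ge0 h; nra.
rewrite (bounded_on_intD mD Dfin); last 2 first.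
  exact/bounded_onZ/bounded_on_indic.
  exact/bounded_onZ/bounded_on_sqr.
rewrite !(bounded_on_intZ mD Dfin); [|exact: bounded_on_sqr|exact: bounded_on_indic].
rewrite bounded_on_int_indic// mulrDl mulrC lerD2l.
by rewrite ler_pdivrMl// mulrCA -expr2 gapG.
Qed.

Let tail J y : \bar R :=
  (\sum_(0 <= j <oo) `|G (J + j)%N y - G (J + j).+1 y|%:E)%E.

Let int_tail J : (\int[m]_y tail J y <= (2 * C * 2^-1 ^+ J)%:E)%E.
Proof.
rewrite /tail integral_nneseries//; last first.
  by move=> n; apply/measurable_EFinP; have [] := bounded_on_norm (bh (J + n)).
(* The bound [C / 2 ^ (J + j)] is written as [2 * C * 2^-1 ^+ J / 2 ^ j.+1], the shape that
   [epsilon_trick] sums to [2 * C * 2^-1 ^+ J]. *)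
apply: (@le_trans _ _ (\sum_(0 <= j <oo) (0 + (2 * C * 2^-1 ^+ J / (2 ^ j.+1)%:R)%:E))%E).
  apply: lee_nneseries => [j _ _|j _]; first by apply: integral_ge0 => y _; rewrite lee_fin.
  rewrite add0e -[leLHS]fineK; last first.
    apply: integrable_fin_num => //.
    exact: (bounded_on_integrable mD Dfin (bounded_on_norm (bh (J + j)))).
  rewrite lee_fin (le_trans (int_norm_gap _))// natrX exprS exprD !exprVn.
  rewrite le_eqVlt; apply/orP; left; apply/eqP.
  by field; rewrite !expf_neq0.
apply: le_trans (epsilon_trick _ _ _) _ => //.
  by rewrite mulr_ge0 ?mulr_ge0 ?exprn_ge0.
by rewrite eseries0// add0e.
Qed.

Let limsup y : \bar R := limn_esup (fun k => (G k y)%:E).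

Let limsup_bound (a b : \bar R) J y :
  (forall k, (J <= k)%N -> (a <= (G k y)%:E <= b)%E) -> (a <= limsup y <= b)%E.
Proof.
move=> ab; rewrite /limsup limn_esup_lim; apply/andP; split.
  apply: lime_ge; first exact: is_cvg_esups.
  exists J => // k /= Jk.
  apply: (@le_trans _ _ (G k y)%:E); first by have /andP[] := ab _ Jk.
  by apply: ereal_sup_ubound; exists k => /=.
apply: lime_le; first exact: is_cvg_esups.
exists J => // k /= Jk; apply: ge_ereal_sup => _ [n /= kn <-].
by have /andP[] := ab _ (leq_trans Jk kn).
Qed.

Let limsup01 y : (0 <= limsup y <= 1)%E.
Proof. by apply: (@limsup_bound _ _ 0%N) => k _; rewrite !lee_fin. Qed.

Let limsup_fin y : limsup y \is a fin_num.
Proof.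
have /andP[l0 l1] := limsup01 y; rewrite ge0_fin_numE//.
by rewrite (le_lt_trans l1)// ltry.
Qed.

Let limsup_tail J y : (`|limsup y - (G J y)%:E| <= tail J y)%E.
Proof.
have part i : (`|G (J + i)%N y - G J y|%:E <= tail J y)%E.
  apply: le_trans (nneseries_lim_ge i _); last by [].
  rewrite sumEFin lee_fin; elim: i => [|i IH].
    by rewrite addn0 subrr normr0 big_geq.
  rewrite big_nat_recr//= addnS distrC.
  rewrite (_ : _ - _ = (G J y - G (J + i)%N y) + (G (J + i)%N y - G (J + i).+1 y)); last by ring.
  by rewrite (le_trans (ler_normD _ _))// lerD2r distrC.
have [->|tfin] := eqVneq (tail J y) +oo%E; first exact: leey.
have t0 : (0 <= tail J y)%E by apply: nneseries_ge0.
have tE : tail J y \is a fin_num by rewrite ge0_fin_numE// lt_neqAle tfin leey.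
have /andP[] : ((G J y - fine (tail J y))%:E <= limsup y <= (G J y + fine (tail J y))%:E)%E.
  apply: (@limsup_bound _ _ J) => k Jk; rewrite !lee_fin -ler_distl.
  by have := part (k - J)%N; rewrite subnKC// -{1}(fineK tE) lee_fin.
rewrite -(fineK (limsup_fin y)) !lee_fin -{3}(fineK tE) => l1 l2.
by rewrite -EFinB abse_EFin lee_fin ler_distl l1 l2.
Qed.

(** The limit is the pointwise limsup: it is defined everywhere, measurable and automatically in
    [[0, 1]]. It differs from [G J] by at most the tail of the absolute increments, whose integral
    is summed term by term. *)
Lemma fast_L2_cauchy_cvg : exists theta : Y -> R, [/\ bounded_on D theta,
  forall y, 0 <= theta y <= 1 &
  forall J, \int[m]_y `|theta y - G J y| <= 2 * C * 2^-1 ^+ J].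
Proof.
have th01 y : 0 <= fine (limsup y) <= 1.
  by have := limsup01 y; rewrite -(fineK (limsup_fin y)) !lee_fin.
have bth : bounded_on D (fun y => fine (limsup y)).
  split.
  - apply: measurableT_comp => //; apply: measurable_fun_limn_esup => k.
    by apply/measurable_EFinP; have [] := bG k.
  - by exists 1 => y; have /andP[t0 t1] := th01 y; rewrite ger0_norm.
  - move=> y Dy; suff /andP[l0 l1] : (0 <= limsup y <= 0)%E by rewrite (le_anti (introT andP (conj l1 l0))).
    by apply: (@limsup_bound _ _ 0%N) => k _; have [_ _ ->] := bG k; rewrite ?lexx.
exists (fun y => fine (limsup y)); split => // J.
rewrite -lee_fin; apply: le_trans (int_tail J).
have bn := bounded_on_norm (bounded_onB bth (bG J)).
rewrite fineK; last first.
  by apply: integrable_fin_num => //; exact: (bounded_on_integrable mD Dfin bn).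
apply: ge0_le_integral => //.
- by apply/measurable_EFinP; have [] := bn.
- apply: ge0_emeasurable_sum => // n _.
  by apply/measurable_EFinP; have [] := bounded_on_norm (bh (J + n)).
- move=> y _; have := limsup_tail J y.
  by rewrite -{1}(fineK (limsup_fin y)) -EFinB abse_EFin.
Qed.

End fast_L2_cauchy.

Lemma midpoint_gap (R : realFieldType) (a b c d e : R) :
  a <= d + e -> b <= d + e -> d - e <= c -> 2 * a + 2 * b - 4 * c <= 8 * e.
Proof. by lra. Qed.

Section selection.
Context {R : realType} {dX dY : measure_display}.
Context {X : measurableType dX} {Y : measurableType dY}.
Variables (m : {measure set X -> \bar R}) (m' : {measure set Y -> \bar R}).
Variables (D : set X) (D' : set Y).
Hypotheses (mD : measurable D) (mD' : measurable D').
Hypotheses (Dfin : (m D < +oo)%E) (Dfin' : (m' D' < +oo)%E).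
Variable V : (nat -> X -> R) -> (Y -> R) -> Prop.
Hypothesis mV : mean_algebra m m' D D' V.
Hypothesis clampV : forall F G, V F G ->
  V (fun n x => clamp (F n x)) (fun y => clamp (G y)).
Variable v : nat -> X -> R.
Hypothesis bv : forall n, bounded_on D (v n).
Hypothesis v01 : forall n x, 0 <= v n x <= 1.

Let dist n (F : nat -> X -> R) := \int[m]_x ((v n x - F n x) ^+ 2).

Let bdist n F G : V F G -> bounded_on D (fun x => v n x - F n x).
Proof. by move=> VF; apply: bounded_onB => //; exact: (mean_algebra_src mV VF). Qed.

Let dist_ge0 n F : 0 <= dist n F.
Proof. by apply: Rintegral_ge0 => x _; exact: sqr_ge0. Qed.

(* [defect S] is the infimum over test functions F of the limsup along S of
   the squared L^2 distance from [v n] to [F n]. *)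
Let achieved (S : set nat) (a : R) := 0 <= a /\
  exists F G, V F G /\ \forall n \near within S \oo, dist n F <= a.

Let defect (S : set nat) := inf [set a | achieved S a].

Let achieved_nonempty S : [set a | achieved S a] !=set0.
Proof.
exists (fine (m D)); split; first exact: fine_ge0.
(* The zero function is a competitor: [0 <= v <= 1] on [D] bounds its squared distance by the
   measure of [D]. *)
exists (fun n x => 0 * \1_D x), (fun y => 0 * \1_D' y); split.
  exact: (mean_algebraZ mV 0 (mean_algebra_unit mV)).
apply: filterE => n; rewrite /dist -(bounded_on_int_indic m mD).
apply: (le_bounded_on_int mD Dfin).
- apply/bounded_on_sqr/bounded_onB => //.
  exact/bounded_onZ/bounded_on_indic.
- exact: bounded_on_indic.
move=> x; rewrite mul0r subr0 indicE; have [_|] := boolP (x \in D).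
  by have /andP[v0 v1] := v01 n x; rewrite expr_le1.
by rewrite notin_setE => Dx; have [_ _ ->] := bv n; rewrite ?expr0n.
Qed.

Let achieved_lb S : has_lbound [set a | achieved S a].
Proof. by exists 0 => a []. Qed.

Let defect_ge0 S : 0 <= defect S.
Proof. by apply: lb_le_inf; [exact: achieved_nonempty|move=> a []]. Qed.

Let defect_mono S' S : almost_sub S' S -> defect S' <= defect S.
Proof.
move=> S'S; apply: lb_le_inf; first exact: achieved_nonempty.
move=> a [a0 [F [G [VF dF]]]].
apply: ge_inf => //; split => //; exists F, G; split => //.
exact: within_almost_sub dF.
Qed.

Section minimizing_set.
Variable S : set nat.
Hypothesis uS : unbounded S.
Hypothesis minS : forall S', unbounded S' -> almost_sub S' S -> defect S' = defect S.

Let PF : ProperFilter (within S \oo) := unbounded_proper uS.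

(** Projecting onto [[0, 1]] brings a number closer to every point of [[0, 1]], so near-minimisers
    may be taken with values there. *)
Let clamp_dist n F G : V F G -> dist n (fun n x => clamp (F n x)) <= dist n F.
Proof.
move=> VF; apply: (le_bounded_on_int mD Dfin).
- exact: bounded_on_sqr (bdist n (clampV VF)).
- exact: bounded_on_sqr (bdist n VF).
move=> x; have /andP[] := v01 n x; rewrite /clamp !expr2.
move: (v n x) (F n x) => a b a0 a1.
by have [b1|b1] := leP b 1; have [b0|b0] := leP 0 b => //;
  rewrite ?(max_idPr _) ?(max_idPl _)//; nra.
Qed.

Let near_minimizer (eta : R) : 0 < eta -> exists F G, [/\ V F G,
  forall n x, 0 <= F n x <= 1, forall y, 0 <= G y <= 1 &
  \forall n \near within S \oo, dist n F <= defect S + eta].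
Proof.
move=> eta0.
have [a [a0 [F [G [VF dF]]]] ale] := inf_adherent eta0 (conj (achieved_nonempty S) (achieved_lb S)).
have clamp01 (s : R) : 0 <= clamp s <= 1.
  by rewrite /clamp le_max lexx/= ge_max ler01/= ge_min lexx orbT.
exists (fun n x => clamp (F n x)), (fun y => clamp (G y)); split => //.
  exact: clampV.
by apply: filterS dF => n dn; rewrite (le_trans (clamp_dist n VF))// (le_trans dn)// ltW.
Qed.

(** Indices violating the bound infinitely often would form a subset of smaller defect, against
    minimality of [S]. *)
Let lower_bound F G (eta : R) : V F G -> 0 < eta ->
  \forall n \near within S \oo, defect S - eta <= dist n F.
Proof.
move=> VF eta0.
(* A negative bound is trivial, and [achieved] admits only nonnegative values, so this case is
   separated. *)
have [a0|a0] := ltP (defect S - eta) 0.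
  by apply: filterE => n; rewrite (le_trans (ltW a0)).
have : ~ unbounded (S `&` [set n | dist n F <= defect S - eta]).
  move=> uS'; have := minS uS' (subset_almost_sub (@subIsetl _ _ _)).
  move=> dS; have : defect (S `&` [set n | dist n F <= defect S - eta]) <= defect S - eta.
    apply: ge_inf => //; split => //; exists F, G; split => //.
    by exists 0%N => // n _ [].
  by rewrite dS lerBrDl gerDr leNgt eta0.
by move/unboundedPn; apply: filterS => n /negP; rewrite -ltNge => /ltW.
Qed.

Let dist_shift n F G F' G' t : V F G -> V F' G' ->
  dist n (fun n x => F n x + t * F' n x) =
  dist n F - 2 * t * \int[m]_x ((v n x - F n x) * F' n x) +
  t ^+ 2 * \int[m]_x (F' n x ^+ 2).
Proof.
move=> VF VF'; have bF' := mean_algebra_src mV VF' n.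
have bF := bdist n VF.
rewrite /dist -[X in X - _]mul1r -mulNr -(bounded_on_int3 mD Dfin).
- by congr Rintegral; apply/funext => x; ring.
- exact: bounded_on_sqr.
- exact: bounded_onM.
- exact: bounded_on_sqr.
Qed.

Let dist_midpoint n F G F' G' : V F G -> V F' G' ->
  \int[m]_x ((F n x - F' n x) ^+ 2) =
  2 * dist n F + 2 * dist n F' - 4 * dist n (fun n x => 2^-1 * (F n x + F' n x)).
Proof.
move=> VF VF'.
have VM := mean_algebraZ mV 2^-1 (mean_algebraD mV VF VF').
have bF := bdist n VF; have bF' := bdist n VF'; have bM := bdist n VM.
rewrite /dist -mulNr -(bounded_on_int3 mD Dfin); [|exact: bounded_on_sqr..].
by congr Rintegral; apply/funext => x; field.
Qed.

Let correlation F G F' G' (s : R) : 0 < s -> V F G ->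
  (\forall n \near within S \oo, dist n F <= defect S + s ^+ 2) -> V F' G' ->
  forall K, (forall n, \int[m]_x (F' n x ^+ 2) <= K) ->
  \forall n \near within S \oo,
    `|\int[m]_x ((v n x - F n x) * F' n x)| <= s * (1 + K).
Proof.
move=> s0 VF dF VF' K FK.
have s20 : 0 < s ^+ 2 by rewrite exprn_gt0.
have L1 := lower_bound (mean_algebraD mV VF (mean_algebraZ mV s VF')) s20.
have L2 := lower_bound (mean_algebraD mV VF (mean_algebraZ mV (- s) VF')) s20.
near=> n.
have h1 : defect S - s ^+ 2 <= dist n (fun n x => F n x + s * F' n x) by near: n.
have h2 : defect S - s ^+ 2 <= dist n (fun n x => F n x + - s * F' n x) by near: n.
have h3 : dist n F <= defect S + s ^+ 2 by near: n.
rewrite !(dist_shift n _ VF VF') in h1 h2.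
have K0 : 0 <= K by apply: le_trans (FK 0%N); apply: Rintegral_ge0 => x _; exact: sqr_ge0.
exact: two_sided_bound s0 K0 (FK n) h3 h1 h2.
Unshelve. all: by end_near. Qed.

(** The parallelogram law is applied on [X] at late indices: two distances at most [defect S + eta]
    and a midpoint distance at least [defect S - eta] give [8 * eta]. As the squared difference
    belongs to the algebra, its mean carries the estimate to the limits on [Y]. *)
Let gap F G F' G' (eta : R) : 0 < eta -> V F G -> V F' G' ->
  (\forall n \near within S \oo, dist n F <= defect S + eta) ->
  (\forall n \near within S \oo, dist n F' <= defect S + eta) ->
  \int[m']_y ((G y - G' y) ^+ 2) <= 8 * eta.
Proof.
move=> eta0 VF VF' dF dF'.
have VM := mean_algebraZ mV 2^-1 (mean_algebraD mV VF VF').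
have Vd := mean_algebraB mV VF VF'.
have /(mean_algebra_mean mV) := mean_algebraM mV Vd Vd.
move=> /(@cvg_within_infty _ _ _ S) cv.
have -> : \int[m']_y ((G y - G' y) ^+ 2) = \int[m']_y ((G y - G' y) * (G y - G' y)).
  by congr Rintegral; apply/funext => y; rewrite expr2.
apply: (cvgr_to_le cv); first exact: PF.
have L := lower_bound VM eta0.
near=> n.
have h1 : dist n F <= defect S + eta by near: n.
have h2 : dist n F' <= defect S + eta by near: n.
have h3 : defect S - eta <= dist n (fun n x => 2^-1 * (F n x + F' n x)) by near: n.
under eq_Rintegral do rewrite -expr2.
by rewrite (dist_midpoint n VF VF'); exact: midpoint_gap h1 h2 h3.
Unshelve. all: by end_near. Qed.

Lemma minimizing_weak_limit : exists theta : Y -> R,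
  [/\ bounded_on D' theta, forall y, 0 <= theta y <= 1 &
  forall F G, V F G -> (fun n => \int[m]_x (v n x * F n x)) @ within S \oo -->
    \int[m']_y (theta y * G y)].
Proof.
have h0 k : 0 < (2^-1 : R) ^+ k by rewrite exprn_gt0.
(* The tolerance is the square of [2^-1 ^+ k]: this is what [correlation] expects for the step
   [s = 2^-1 ^+ k], and it makes the [L^1] gaps of the limits geometric. *)
have eta0 k : 0 < ((2^-1 : R) ^+ k) ^+ 2 by rewrite exprn_gt0.
have /choice[FG FGP] : forall k, exists FG : (nat -> X -> R) * (Y -> R),
    [/\ V FG.1 FG.2, forall y, 0 <= FG.2 y <= 1 &
    \forall n \near within S \oo, dist n FG.1 <= defect S + (2^-1 ^+ k) ^+ 2].
  by move=> k; have [F [G [VF _ G01 dF]]] := near_minimizer (eta0 k); exists (F, G).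
have VFG k : V (FG k).1 (FG k).2 by have [] := FGP k.
have dFG k : \forall n \near within S \oo,
    dist n (FG k).1 <= defect S + (2^-1 ^+ k) ^+ 2 by have [] := FGP k.
have [] := @fast_L2_cauchy_cvg _ _ _ m' D' mD' Dfin' (fun k => (FG k).2).
- by move=> k; exact: (mean_algebra_tgt mV (VFG k)).
- by move=> k; have [] := FGP k.
- move=> k; apply: (gap (eta0 k) (VFG k) (VFG k.+1) (dFG k)).
  apply: filterS (dFG k.+1) => n /le_trans; apply; rewrite lerD2l.
  rewrite lerXn2r ?nnegrE ?(ltW (h0 _))// exprS ler_piMl ?(ltW (h0 _))//.
  by rewrite invf_le1// ler1n.
set C := fine _ + 8 => theta [bth th01 thG]; exists theta; split => // F G VF.
have C0 : 0 <= C by rewrite addr_ge0// fine_ge0.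
have [B B0 FB] := mean_algebra_ubound mV VF.
have [_ [B' GB'] _] := mean_algebra_tgt mV VF.
pose K := B ^+ 2 * fine (m D).
have FK n : \int[m]_x (F n x ^+ 2) <= K.
  have bF := bounded_on_sqr (mean_algebra_src mV VF n).
  apply: le_trans (ler_norm _) _; apply: (bounded_on_int_le mD Dfin bF) => x.
  by rewrite normrX lerXn2r ?nnegrE// ltW.
have K0 : 0 <= K by rewrite mulr_ge0 ?fine_ge0 ?exprn_ge0// ltW.
have B'0 : 0 <= `|B'| by [].
apply/cvgrPdist_le => e e0.
(* These are the coefficients of [2^-1 ^+ k] in the bounds [e1] and [e3] below; the other half of
   [e] is left for convergence of means. *)
pose M := 1 + K + `|B'| * (2 * C).
have M0 : 0 < M by rewrite /M -addrA ltr_wpDr// addr_ge0// mulr_ge0// mulr_ge0.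
have [k ke] : exists k, 2^-1 ^+ k * M <= e / 2.
  have e2M : 0 < e / 2 / M by rewrite !divr_gt0.
  have [k _ kr] := near_infty_natSinv_expn_lt (PosNum e2M).
  exists k; rewrite -ler_pdivlMr// exprVn -div1r ltW//; exact: kr (leqnn k).
have VFkF := mean_algebraM mV (VFG k) VF.
have cv := mean_algebra_mean mV VFkF.
have /cvgrPdist_le /(_ (e / 2)) := @cvg_within_infty _ _ _ S cv.
rewrite divr_gt0// => /(_ isT) cvk.
have ck := correlation (h0 k) (VFG k) (dFG k) VF FK.
near=> n.
have bF := mean_algebra_src mV VF n.
have bFk := mean_algebra_src mV (VFG k) n.
have bG := mean_algebra_tgt mV VF.
have bGk := mean_algebra_tgt mV (VFG k).
(* Three errors: [theta] against the limit of the [k]-th minimiser, the mean of the product of that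
   minimiser with [F], and the residual of the minimiser tested against [F]. *)
rewrite (_ : _ - _ =
  \int[m']_y ((theta y - (FG k).2 y) * G y) +
  (\int[m']_y ((FG k).2 y * G y) - \int[m]_x ((FG k).1 n x * F n x)) -
  \int[m]_x ((v n x - (FG k).1 n x) * F n x)); last first.
  under [X in _ = X + _ - _]eq_Rintegral do rewrite mulrBl.
  under [X in _ = _ + _ - X]eq_Rintegral do rewrite mulrBl.
  rewrite (bounded_on_intB mD' Dfin'); [|exact: bounded_onM..].
  rewrite (bounded_on_intB mD Dfin); [|exact: bounded_onM..].
  move: (Rintegral _ _ _) (Rintegral _ _ _) (Rintegral _ _ _) (Rintegral _ _ _).
  by move=> *; ring.
have e1 : `|\int[m']_y ((theta y - (FG k).2 y) * G y)| <= `|B'| * (2 * C) * 2^-1 ^+ k.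
  apply: le_trans (bounded_on_int_norm mD' Dfin' (B := `|B'|) _ bG _) _.
  - exact: bounded_onB.
  - by move=> y; rewrite (le_trans (GB' y))// ler_norm.
  - by rewrite -mulrA ler_wpM2l.
have e2 : `|\int[m']_y ((FG k).2 y * G y) - \int[m]_x ((FG k).1 n x * F n x)| <= e / 2.
  by near: n.
have e3 : `|\int[m]_x ((v n x - (FG k).1 n x) * F n x)| <= 2^-1 ^+ k * (1 + K).
  by near: n.
rewrite (le_trans (ler_normB _ _))//.
apply: (@le_trans _ _ (`|B'| * (2 * C) * 2^-1 ^+ k + e / 2 + 2^-1 ^+ k * (1 + K))).
  by rewrite lerD// (le_trans (ler_normD _ _))// lerD.
by move: ke; rewrite /M mulrDr [_ * 2^-1 ^+ k]mulrC; move: (2^-1 ^+ k * _) (2^-1 ^+ k * _) => a b ab; lra.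
Unshelve. all: by end_near. Qed.

End minimizing_set.

Lemma weak_selection (S : set nat) : unbounded S ->
  exists S', [/\ S' `<=` S, unbounded S' & exists theta : Y -> R,
  [/\ bounded_on D' theta, forall y, 0 <= theta y <= 1 &
  forall F G, V F G -> (fun n => \int[m]_x (v n x * F n x)) @ within S' \oo -->
    \int[m']_y (theta y * G y)]].
Proof.
move=> uS.
have [S' [S'S uS' minS']] := exhaustion (fun S _ => defect_ge0 S)
  (fun S1 S2 _ => @defect_mono S1 S2) uS.
by exists S'; split => //; exact: minimizing_weak_limit.
Qed.

End selection.

(** * N-functions and dyadic layers *)

Section N_function_theory.
Context {R : realType} (Phi : R -> R).
Hypothesis NPhi : N_function Phi.

Lemma N_function_conv a b r : 0 <= a -> 0 <= b -> 0 <= r <= 1 ->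
  Phi (r * a + (1 - r) * b) <= r * Phi a + (1 - r) * Phi b.
Proof.
move=> a0 b0 /andP[r0 r1].
have Da : a \in (`[0, +oo[%classic : set R) by rewrite inE /= in_itv/= a0.
have Db : b \in (`[0, +oo[%classic : set R) by rewrite inE /= in_itv/= b0.
exact: (N_function_convex NPhi (Itv01 r0 r1) Da Db).
Qed.

(** Near [0] one has [Phi t = (Phi t / t) * t], a product of two quantities tending to [0]; right
    continuity gives the value. *)
Lemma N_function0 : Phi 0 = 0.
Proof.
have [_ Phi0] := (continuous_within_itvcyP 0 Phi).1 (N_function_continuous NPhi).
have id0 : (t : R) @[t --> 0^'+] --> (0 : R).
  by apply: cvg_within_filter; exact: cvg_id.
have Phi00 : Phi t @[t --> 0^'+] --> (0 : R).
  rewrite -[X in _ --> X](mulr0 (0 : R)).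
  apply: cvg_trans (cvgM (N_function_at0 NPhi) id0).
  apply: near_eq_cvg; apply: filterS (nbhs_right_gt _) => t t0.
  by rewrite /= divfK// gt_eqF.
exact: (cvg_unique _ Phi0 Phi00).
Qed.

Lemma N_function_le a b : 0 <= a -> a <= b -> Phi a <= Phi b.
Proof.
move=> a0 ab; have b0 := le_trans a0 ab.
have [b00|bn0] := eqVneq b 0.
  by rewrite (_ : a = b)//; apply/le_anti; rewrite ab b00 a0.
have bp : 0 < b by rewrite lt_neqAle eq_sym bn0.
have ab01 : 0 <= a / b <= 1 by rewrite divr_ge0//= ler_pdivrMr// mul1r.
have := N_function_conv b0 (lexx 0) ab01.
rewrite mulr0 addr0 N_function0 mulr0 addr0 divfK// => /le_trans; apply.
by rewrite ler_piMl ?(N_function_ge0 NPhi)//; case/andP: ab01.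
Qed.

Lemma N_function_small e : 0 < e -> exists2 t, 0 < t & Phi t <= e.
Proof.
move=> e0.
have [_ Phi0] := (continuous_within_itvcyP 0 Phi).1 (N_function_continuous NPhi).
rewrite N_function0 in Phi0.
have : \forall t \near (0 : R)^'+, 0 < t /\ Phi t <= e.
  near=> t; split; first by near: t; exact: nbhs_right_gt.
  by near: t; exact: (cvgr_le _ Phi0).
by move=> /filter_ex[t [t0 te]]; exists t.
Unshelve. all: by end_near. Qed.

Lemma N_function_superlinear e : 0 < e ->
  exists2 c, 0 < c & forall t, c <= t -> t <= e * Phi t.
Proof.
move=> e0; have /cvgryPge/(_ e^-1)[c [_ cP]] := N_function_atoo NPhi.
exists (`|c| + 1); first by rewrite ltr_wpDl.
move=> t ct; have t0 : 0 < t by rewrite (lt_le_trans _ ct)// ltr_wpDl.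
have : c < t by rewrite (lt_le_trans _ ct)// ltr_pwDr// ler_norm.
by move=> /cP; rewrite ler_pdivlMr// ler_pdivrMl.
Qed.

Lemma N_function_sup (P : nat -> R) (w K : R) : (forall k, 0 <= P k) ->
  P @ \oo --> w -> (forall k, Phi (P k) <= K) -> Phi w <= K.
Proof.
move=> P0 Pw PK; have w0 : 0 <= w by apply: (cvgr_to_ge Pw); exact: nearW.
have [c _] := (continuous_within_itvcyP 0 Phi).1 (N_function_continuous NPhi).
(* Continuity within [[0, +oo[] is two-sided only at positive points; at [0] the value [Phi 0 = 0]
   is enough. *)
have [w00|wn0] := eqVneq w 0.
  rewrite w00 N_function0; apply: le_trans (PK 0%N).
  exact: (N_function_ge0 NPhi).
have wp : 0 < w by rewrite lt_neqAle eq_sym wn0.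
have cw : {for w, continuous Phi} by apply: c; rewrite in_itv/= wp.
have PhiP : (fun k => Phi (P k)) @ \oo --> Phi w by apply: continuous_cvg.
by apply: (cvgr_to_le PhiP); exact: nearW.
Qed.

Lemma measurable_N_function {dX : measure_display} {X : measurableType dX}
    (f : X -> R) : measurable_fun setT f -> (forall x, 0 <= f x) ->
  measurable_fun setT (fun x => Phi (f x)).
Proof.
move=> mf f0; rewrite (_ : (fun x => _) = Phi \o f)//.
apply: (@measurable_comp _ _ _ X R R `[0, +oo[%classic Phi setT f) => //.
- by move=> _ [x _ <-] /=; rewrite in_itv/= f0.
- by apply: subspace_continuous_measurable_fun => //; exact: (N_function_continuous NPhi).
Qed.

(* The chord of a convex function on [c, 2 c] dominates its increments further left. *)
Lemma N_function_increment c p t : 0 < c -> 0 <= p <= c -> 0 <= t <= c ->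
  Phi (p + t) <= Phi p + (Phi (2 * c) - Phi c) / c * t.
Proof.
move=> c0 /andP[p0 pc] /andP[t0 tc].
have ct0 : 0 <= c + t by rewrite addr_ge0// ltW.
have h1 : Phi (c + t) <= Phi c + (Phi (2 * c) - Phi c) / c * t.
  have tc01 : 0 <= t / c <= 1 by rewrite divr_ge0 ?(ltW c0)//= ler_pdivrMr// mul1r.
  have c20 : 0 <= 2 * c by rewrite mulr_ge0// ltW.
  have := N_function_conv c20 (ltW c0) tc01.
  rewrite (_ : _ * (2 * c) + _ = c + t); last by field; rewrite gt_eqF.
  by move=> /le_trans; apply; rewrite le_eqVlt; apply/orP; left; apply/eqP; field; rewrite gt_eqF.
apply: (@le_trans _ _ (Phi p + (Phi (c + t) - Phi c))); last by rewrite lerD2l lerBlDl.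
(* This excludes [p = c] with [t = 0], where the interval [[p, c + t]] would be a point and its
   length could not be divided by. *)
have [->|tn0] := eqVneq t 0; first by rewrite !addr0 subrr addr0.
have tp : 0 < t by rewrite lt_neqAle eq_sym tn0.
have L0 : 0 < c + t - p by rewrite subr_gt0 (le_lt_trans pc)// ltrDl.
(* The points [p + t] and [c] divide [[p, c + t]] with complementary weights, so the two convexity
   inequalities add up to [Phi (p + t) + Phi c <= Phi p + Phi (c + t)]. *)
have s01 : 0 <= t / (c + t - p) <= 1.
  rewrite divr_ge0 ?(ltW L0)//= ler_pdivrMr// mul1r.
  by rewrite addrAC lerDr subr_ge0.
have s01' : 0 <= 1 - t / (c + t - p) <= 1.
  by case/andP: s01 => s0 s1; rewrite subr_ge0 s1 gerBl s0.
have e1 := N_function_conv ct0 p0 s01.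
have e2 := N_function_conv ct0 p0 s01'.
rewrite (_ : _ * (c + t) + _ = p + t) in e1; last by field; rewrite gt_eqF.
rewrite (_ : _ * (c + t) + _ = c) in e2; last by field; rewrite gt_eqF.
rewrite subKr in e2.
by move: e1 e2; move: (t / _) (Phi _) (Phi _) (Phi _) (Phi _) => *; lra.
Qed.

End N_function_theory.

Section layers.
Context {R : realType}.
Variable tau : R.
Hypothesis tau0 : 0 < tau.

(* [b] is the sum of its layers, and [layer j.+1 b] vanishes unless
   [level j < b], so that its coefficient [slope j] below is paid for by the
   increment of Phi between [level j] and [level j.+1], hence by [Phi (2 * b)]. *)
Definition level (j : nat) : R := tau * 2 ^+ j.

Definition layer (j : nat) (b : R) : R :=
  if j is j'.+1 then Num.max 0 (Num.min (b - level j') (level j'))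
  else Num.min b tau.

Definition height (j : nat) : R := if j is j'.+1 then level j' else tau.

Lemma level_gt0 j : 0 < level j.
Proof. by rewrite mulr_gt0// exprn_gt0. Qed.

Lemma levelS j : level j.+1 = 2 * level j.
Proof. by rewrite /level exprS mulrCA. Qed.

Lemma height_gt0 j : 0 < height j.
Proof. by case: j => [|j] //=; exact: level_gt0. Qed.

Lemma layer_bounds j b : 0 <= b -> 0 <= layer j b <= height j.
Proof.
move=> b0; case: j => [|j] /=.
  by rewrite le_min b0 (ltW tau0) ge_min lexx orbT.
by rewrite le_max lexx ge_max ge_min lexx orbT (ltW (level_gt0 j)).
Qed.

Lemma layer_at0 j : layer j 0 = 0.
Proof.
case: j => [|j] /=; first by apply/min_idPl; exact: ltW.
apply/max_idPl; rewrite ge_min sub0r oppr_le0 ltW//; exact: level_gt0.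
Qed.

Lemma sum_layer J b : 0 <= b ->
  \sum_(j < J.+1) layer j b = Num.min b (level J).
Proof.
move=> b0; elim: J => [|J IH].
  by rewrite big_ord1 /= /level expr0 mulr1.
rewrite big_ord_recr IH /= levelS; have := level_gt0 J.
move: (level J) => c c0; rewrite /Num.max /Num.min.
by do ![case: ifP => //=]; lra.
Qed.

Lemma sum_height J : \sum_(j < J.+1) height j = level J.
Proof.
elim: J => [|J IH]; first by rewrite big_ord1 /= /level expr0 mulr1.
by rewrite big_ord_recr IH /= levelS mulrDl mul1r.
Qed.

Lemma measurable_layer j {dX : measure_display} {X : measurableType dX}
  (f : X -> R) : measurable_fun setT f -> measurable_fun setT (fun x => layer j (f x)).
Proof.
move=> mf; case: j => [|j] /=; first by apply: measurable_minr => //; exact: measurable_cst.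
apply: measurable_maxr; first exact: measurable_cst.
apply: measurable_minr; last exact: measurable_cst.
by apply: measurable_funB => //; exact: measurable_cst.
Qed.

Variable Phi : R -> R.
Hypothesis NPhi : N_function Phi.

Definition slope (j : nat) : R := (Phi (level j.+1) - Phi (level j)) / level j.

Lemma slope_ge0 j : 0 <= slope j.
Proof.
rewrite divr_ge0 ?(ltW (level_gt0 j))// subr_ge0 (N_function_le NPhi)//.
  by rewrite ltW// level_gt0.
by rewrite levelS ler_peMl ?ler1n// ltW// level_gt0.
Qed.

(** A layer is at most its height, so each term is at most an increment of [Phi] and the sum
    telescopes. At the last active index [level J < b], hence [level J.+1 = 2 * level J] is below
    [2 * b]; later layers vanish. *)
Lemma sum_slope_layer J b : 0 <= b ->
  \sum_(j < J) slope j * layer j.+1 b <= Phi (2 * b).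
Proof.
move=> b0; have b20 : 0 <= 2 * b by rewrite mulr_ge0.
have slopeM j : slope j * level j = Phi (level j.+1) - Phi (level j).
  by rewrite divfK// gt_eqF// level_gt0.
have crude J' : \sum_(j < J') slope j * layer j.+1 b <= Phi (level J') - Phi (level 0).
  elim: J' => [|J' IH]; first by rewrite big_ord0 subrr.
  have : slope J' * layer J'.+1 b <= Phi (level J'.+1) - Phi (level J').
    rewrite -slopeM ler_wpM2l ?slope_ge0//.
    by have /andP[_] := layer_bounds J'.+1 b0.
  rewrite big_ord_recr; move: IH; move: (\sum_(j < J') _) (slope J' * _) (Phi _) (Phi _) (Phi _).
  by move=> /= x y z t u; lra.
elim: J => [|J IH]; first by rewrite big_ord0 (N_function_ge0 NPhi).
have [bJ|Jb] := leP b (level J).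
  rewrite big_ord_recr/= (_ : Num.max _ _ = 0) ?mulr0 ?addr0//.
  by apply/max_idPl; rewrite ge_min subr_le0 bJ.
apply: le_trans (crude J.+1) _; rewrite lerBlDr ler_wpDr//.
  by rewrite (N_function_ge0 NPhi)// ltW// level_gt0.
apply: (N_function_le NPhi); first by rewrite ltW// level_gt0.
by rewrite levelS ler_pM2l// ltW.
Qed.

(** The right-hand side is linear in [theta], hence passes to weak limits; the [theta j] need only
    respect the heights and need not be layers of a single number. The heights before [J.+1] add up
    to [level J], so [N_function_increment] applies with [c = level J]. *)
Lemma N_function_sum_layers (theta : nat -> R) J :
  (forall j, 0 <= theta j <= height j) ->
  Phi (\sum_(j < J.+1) theta j) <= Phi tau + \sum_(j < J) slope j * theta j.+1.
Proof.
move=> th; elim: J => [|J IH].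
  rewrite big_ord1 big_ord0 addr0 /=.
  by have /andP[t0 t1] := th 0%N; exact: (N_function_le NPhi).
rewrite big_ord_recr [in leRHS]big_ord_recr /= addrA.
apply: le_trans (N_function_increment NPhi (level_gt0 J) _ (th J.+1)) _.
  rewrite sumr_ge0 /= => [|j _]; last by have /andP[] := th j.
  by rewrite -sum_height; apply: ler_sum => j _; have /andP[] := th j.
by rewrite -levelS lerD2r.
Qed.

End layers.

(** Bolzano-Weierstrass by exhaustion: on an index set whose limsup no infinite subset can lower,
    terms cannot stay a fixed amount below the limsup infinitely often, so the limsup is a limit. *)
Lemma bounded_along (R : realType) (S : set nat) (k : nat -> R) : unbounded S ->
  (forall n, 0 <= k n <= 1) ->
  exists S', [/\ S' `<=` S, unbounded S' &
    exists2 l : R, 0 <= l & k @ within S' \oo --> l].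
Proof.
move=> uS k01.
pose ub (S : set nat) := [set a | 0 <= a /\ \forall n \near within S \oo, k n <= a].
have ub0 (S0 : set nat) : ub S0 !=set0.
  exists 1; split => //; apply: filterE => n; by have /andP[] := k01 n.
have ublb (S0 : set nat) : has_lbound (ub S0) by exists 0 => a [].
have [| |S' [S'S uS' minS']] := @exhaustion R (fun S => inf (ub S)) _ _ S uS.
- by move=> S0 _; apply: lb_le_inf => // a [].
- move=> S2 S1 _ S21; apply: lb_le_inf => // a [a0 ka].
  by apply: ge_inf => //; split => //; exact: within_almost_sub ka.
have PF := unbounded_proper uS'.
exists S'; split => //; exists (inf (ub S')); first by apply: lb_le_inf => // a [].
apply/cvgrPdist_le => e e0.
have [a [a0 ka] ale] := inf_adherent e0 (conj (ub0 S') (ublb S')).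
have : ~ unbounded (S' `&` [set n | k n <= inf (ub S') - e]).
  move=> uS2; have := minS' _ uS2 (subset_almost_sub (@subIsetl _ _ _)).
  move=> dS; suff : inf (ub (S' `&` [set n | k n <= inf (ub S') - e])) <= inf (ub S') - e.
    by rewrite dS lerBrDl gerDr leNgt e0.
  have [n _ [_ nS2]] := uS2 0%N.
  apply: ge_inf => //; split; last by exists 0%N => // j _ [].
  by rewrite (le_trans _ nS2)//; have /andP[] := k01 n.
move=> /unboundedPn low; near=> n.
rewrite ler_distlC; apply/andP; split.
  have : ~ k n <= inf (ub S') - e by near: n.
  by move=> /negP; rewrite -ltNge => /ltW.
by rewrite (le_trans _ (ltW ale))//; near: n.
Unshelve. all: by end_near. Qed.

Lemma nneseries_le_bound (R : realType) (f : nat -> \bar R) (K : \bar R) :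
  (forall i, (0 <= f i)%E) -> (forall n, (\sum_(0 <= i < n) f i <= K)%E) ->
  (\sum_(0 <= i <oo) f i <= K)%E.
Proof.
move=> f0 fK; apply: lime_le; first by apply: is_cvg_nneseries => n _ _; exact: f0.
by apply: nearW => n; exact: fK.
Qed.

Section integrable_products.
Context {R : realType} {dX : measure_display} {X : measurableType dX}.
Variables (m : {measure set X -> \bar R}).

Lemma integrable_mul_bounded (D : set X) (f g : X -> R) :
  m.-integrable setT (EFin \o f) -> bounded_on D g ->
  m.-integrable setT (EFin \o (fun x => f x * g x)).
Proof.
move=> intf [mg [B gB] _].
have -> : EFin \o (fun x => f x * g x) = ((EFin \o f) \* (EFin \o g))%E by [].
apply: integrableMl => //; exists B; split; first exact: num_real.
by move=> y By x _ /=; exact: le_trans (gB x) (ltW By).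
Qed.

Lemma le_normr_int_mul (D : set X) (f g : X -> R) B :
  m.-integrable setT (EFin \o f) -> bounded_on D g -> (forall x, `|g x| <= B) ->
  `|\int[m]_x (f x * g x)| <= B * \int[m]_x `|f x|.
Proof.
move=> intf bg gB; have intfg := integrable_mul_bounded intf bg.
rewrite (le_trans (le_normr_Rintegral _ _))// -RintegralZl//; last exact: integrable_norm.
apply: le_Rintegral => //.
- exact: integrable_norm.
- have -> : EFin \o (fun x => B * `|f x|) =
    (fun x => B%:E * (EFin \o (fun x => `|f x|%R)) x)%E by [].
  by apply: integrableZl => //; exact: integrable_norm.
- by move=> x _; rewrite normrM mulrC ler_wpM2r.
Qed.

Variables (Phi : R -> R) (D : set X).
Hypotheses (NPhi : N_function Phi) (mD : measurable D) (Dfin : (m D < +oo)%E).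

(** By superlinearity [f <= c + Phi f], and the constant [c] is integrable over [D], of finite
    measure. *)
Lemma integrable_of_N_function (f : X -> R) : measurable_fun setT f ->
  (forall x, 0 <= f x) -> (forall x, ~ D x -> f x = 0) ->
  (\int[m]_x (Phi (f x))%:E < +oo)%E -> m.-integrable setT (EFin \o f).
Proof.
move=> mf f0 fD Phif; have [c c0 cP] := N_function_superlinear NPhi (@ltr01 R).
have mPhi := measurable_N_function NPhi mf f0.
apply/integrableP; split; first exact/measurable_EFinP.
apply: (@le_lt_trans _ _ (\int[m]_x ((c * \1_D x)%:E + (Phi (f x))%:E))%E).
  apply: ge0_le_integral => //.
  - by apply: measurableT_comp => //; exact/measurable_EFinP.
  - apply: emeasurable_funD; last exact/measurable_EFinP.
    apply/measurable_EFinP; apply: measurable_funM; first exact: measurable_cst.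
    exact: measurable_indic.
  - move=> x _; rewrite /= lee_fin ger0_norm// indicE.
    have [_|] := boolP (x \in D); last first.
      by rewrite notin_setE => /fD ->; rewrite mulr0 add0r (N_function_ge0 NPhi).
    rewrite mulr1; have [/ltW fc|/cP] := ltP (f x) c.
      by rewrite (le_trans fc)// lerDl (N_function_ge0 NPhi).
    by rewrite mul1r => /le_trans; apply; rewrite lerDr ltW.
rewrite ge0_integralD//; last 4 first.
- by move=> x _; rewrite lee_fin mulr_ge0// ltW.
- apply/measurable_EFinP; apply: measurable_funM; first exact: measurable_cst.
  exact: measurable_indic.
- by move=> x _; rewrite lee_fin (N_function_ge0 NPhi).
- exact/measurable_EFinP.
rewrite lte_add_pinfty//.
have bD := bounded_onZ c (bounded_on_indic mD).
have /integrableP[_] := bounded_on_integrable mD Dfin bD.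
apply: le_lt_trans; apply: le_integral => //.
- exact: (bounded_on_integrable mD Dfin bD).
- by have := integrable_abse (bounded_on_integrable mD Dfin bD).
- by move=> x _; rewrite lee_fin ler_norm.
Qed.

End integrable_products.

(** * Superposition of the weak limits of dyadic layers *)

Section superposition.
Context {R : realType} {dX dY : measure_display}.
Context {X : measurableType dX} {Y : measurableType dY}.
Variables (m : {measure set X -> \bar R}) (m' : {measure set Y -> \bar R}).
Variables (D : set X) (D' : set Y).
Hypotheses (mD : measurable D) (mD' : measurable D').
Hypotheses (Dfin : (m D < +oo)%E) (Dfin' : (m' D' < +oo)%E).
Variable V : (nat -> X -> R) -> (Y -> R) -> Prop.
Hypothesis mV : mean_algebra m m' D D' V.
Variable Phi : R -> R.
Hypothesis NPhi : N_function Phi.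
Variable b : nat -> X -> R.
Hypothesis mb : forall n, measurable_fun setT (b n).
Hypothesis b0 : forall n x, 0 <= b n x.
Hypothesis bD : forall n x, ~ D x -> b n x = 0.
Hypothesis Phib : forall n, (\int[m]_x (Phi (2 * b n x))%:E <= 1)%E.
Variable tau : R.
Hypothesis tau0 : 0 < tau.

Let blayer n j : bounded_on D (fun x => layer tau j (b n x)).
Proof.
split; first exact: measurable_layer.
  exists (height tau j) => x; have /andP[l0 lh] := layer_bounds tau0 j (b0 n x).
  by rewrite ger0_norm.
by move=> x Dx; rewrite bD// layer_at0.
Qed.

Let layer_limits (S : set nat) : unbounded S ->
  exists S', [/\ S' `<=` S, unbounded S' & exists theta : nat -> Y -> R, forall j,
    [/\ bounded_on D' (theta j), forall y, 0 <= theta j y <= height tau j &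
    forall F G, V F G ->
      (fun n => \int[m]_x (layer tau j (b n x) * F n x)) @ within S' \oo -->
      \int[m']_y (theta j y * G y)]].
Proof.
pose P j (S' : set nat) := exists theta : Y -> R,
  [/\ bounded_on D' theta, forall y, 0 <= theta y <= height tau j &
    forall F G, V F G ->
      (fun n => \int[m]_x (layer tau j (b n x) * F n x)) @ within S' \oo -->
      \int[m']_y (theta y * G y)].
move=> uS; have [| |S' [S'S uS' PS']] := @diagonal_extraction P _ _ S uS.
- move=> j S2 S1 S21 [theta [bth th cth]]; exists theta; split => // F G VF.
  exact: cvg_almost_sub (cth _ _ VF).
- move=> j S1 uS1; have h0 := height_gt0 tau0 j.
  have hh z : height tau j * ((height tau j)^-1 * z) = z.
    by rewrite mulrA divff ?mul1r// gt_eqF.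
  (* Division by the height brings the layer into [[0, 1]]. The selection is run against the uniform
     closure, which is stable under truncation; in particular it covers the pairs in [V]. *)
  have [| | |S2 [S21 uS2 [theta [bth th cth]]]] := @weak_selection _ _ _ _ _ m m' D D' mD mD'
    Dfin Dfin' _ (uniform_closure_mean_algebra mD mD' Dfin Dfin' mV) _
    (fun n x => (height tau j)^-1 * layer tau j (b n x)) _ _ S1 uS1.
  + exact: (uniform_closure_clamp mD mD' Dfin Dfin' mV).
  + by move=> n; exact: bounded_onZ.
  + move=> n x; have /andP[l0 lh] := layer_bounds tau0 j (b0 n x).
    by rewrite mulr_ge0 ?invr_ge0 ?(ltW h0)//= ler_pdivrMl// mulr1.
  exists S2; split => //; exists (fun y => height tau j * theta y); split.
  + exact: bounded_onZ.
  + move=> y; have /andP[t0 t1] := th y.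
    by rewrite mulr_ge0 ?(ltW h0)//= -[leRHS]mulr1 ler_pM2l.
  + move=> F G VF.
    have cv := cth _ _ (subset_uniform_closure mV VF).
    have bG := mean_algebra_tgt mV VF.
    have -> : \int[m']_y (height tau j * theta y * G y) =
        height tau j * \int[m']_y (theta y * G y).
      rewrite -(bounded_on_intZ mD' Dfin'); last exact: bounded_onM.
      by apply: eq_Rintegral => y _; rewrite mulrA.
    rewrite (_ : (fun n => _) = (fun n => height tau j *
        \int[m]_x ((height tau j)^-1 * layer tau j (b n x) * F n x))).
      have FS2 := @within_filter nat S2 \oo _; exact: cvgMl_tmp cv.
    apply/funext => n; have bF := mean_algebra_src mV VF n.
    rewrite -(bounded_on_intZ mD Dfin).
      by apply: eq_Rintegral => x _; rewrite mulrA hh.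
    by apply: bounded_onM => //; exact: bounded_onZ.
by move: PS'; rewrite /P => /choice[theta thP]; exists S'; split => //; exists theta.
Qed.

(** Used twice: with unit coefficients for the truncations [Num.min b (level J)], and with the
    slopes and shifted indices for the modular estimate. *)
Let combination_limit S (theta : nat -> Y -> R) (c : nat -> R) (a : nat -> nat) :
  (forall j, [/\ bounded_on D' (theta j), forall y, 0 <= theta j y <= height tau j &
    forall F G, V F G ->
      (fun n => \int[m]_x (layer tau j (b n x) * F n x)) @ within S \oo -->
      \int[m']_y (theta j y * G y)]) -> forall J F G, V F G ->
  (fun n => \int[m]_x ((\sum_(j < J) c j * layer tau (a j) (b n x)) * F n x)) @
      within S \oo --> \int[m']_y ((\sum_(j < J) c j * theta (a j) y) * G y).
Proof.
move=> thP J F G VF; have bG := mean_algebra_tgt mV VF.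
have bF := mean_algebra_src mV VF.
have bth j : bounded_on D' (theta j) by have [] := thP j.
have bl J' n : bounded_on D (fun x => \sum_(j < J') c j * layer tau (a j) (b n x)).
  have bl0 (j : 'I_J') : bounded_on D (fun x => c j * layer tau (a j) (b n x)) by exact: bounded_onZ.
  exact: (bounded_on_sum mD _ bl0).
have bt J' : bounded_on D' (fun y => \sum_(j < J') c j * theta (a j) y).
  have bt0 (j : 'I_J') : bounded_on D' (fun y => c j * theta (a j) y) by exact: bounded_onZ.
  exact: (bounded_on_sum mD' _ bt0).
elim: J => [|J IH].
  rewrite (_ : \int[m']_y _ = 0); last first.
    by under eq_Rintegral do rewrite big_ord0 mul0r; rewrite Rintegral_cst// mul0r.
  rewrite (_ : (fun n => _) = (fun=> 0)); first exact: cvg_cst.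
  apply/funext => n.
  by under eq_Rintegral do rewrite big_ord0 mul0r; rewrite Rintegral_cst// mul0r.
rewrite (_ : \int[m']_y _ = \int[m']_y ((\sum_(j < J) c j * theta (a j) y) * G y) +
    c J * \int[m']_y (theta (a J) y * G y)); last first.
  rewrite -(bounded_on_intZ mD' Dfin'); last exact: bounded_onM.
  rewrite -(bounded_on_intD mD' Dfin'); last 2 first.
  - exact: bounded_onM.
  - exact/bounded_onZ/bounded_onM.
  by apply: eq_Rintegral => y _; rewrite big_ord_recr/= mulrDl mulrA.
rewrite (_ : (fun n => _) = (fun n =>
    \int[m]_x ((\sum_(j < J) c j * layer tau (a j) (b n x)) * F n x) +
    c J * \int[m]_x (layer tau (a J) (b n x) * F n x))); last first.
  apply/funext => n.
  rewrite -(bounded_on_intZ mD Dfin); last exact: bounded_onM.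
  rewrite -(bounded_on_intD mD Dfin); last 2 first.
  - exact: bounded_onM.
  - exact/bounded_onZ/bounded_onM.
  by apply: eq_Rintegral => y _; rewrite big_ord_recr/= mulrDl mulrA.
have FS := @within_filter nat S \oo _.
apply: cvgD => //; apply: cvgMl_tmp.
by have [_ _] := thP (a J); apply.
Qed.

Let bPhi0 n x : 0 <= 2 * b n x. Proof. by rewrite mulr_ge0. Qed.

Let mPhib n : measurable_fun setT (fun x => Phi (2 * b n x)).
Proof.
apply: (measurable_N_function NPhi) => //.
by apply: measurable_funM => //; exact: measurable_cst.
Qed.

Let intPhib n : m.-integrable setT (EFin \o (fun x => Phi (2 * b n x))).
Proof.
apply/integrableP; split; first exact/measurable_EFinP.
apply: le_lt_trans (ltry 1); rewrite (le_trans _ (Phib n))//.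
apply: ge0_le_integral => //.
- by apply: measurableT_comp => //; exact/measurable_EFinP.
- exact/measurable_EFinP.
- by move=> x _; rewrite /= lee_fin ger0_norm// (N_function_ge0 NPhi).
Qed.

Let int_Phib n : 0 <= \int[m]_x Phi (2 * b n x) <= 1.
Proof.
rewrite Rintegral_ge0 => [|x _]; last exact: (N_function_ge0 NPhi).
rewrite /= -lee_fin fineK; first exact: Phib.
by apply: integrable_fin_num => //; exact: intPhib.
Qed.

Let intb n : m.-integrable setT (EFin \o b n).
Proof.
apply: (integrable_of_N_function NPhi mD Dfin) => //.
  exact: bD.
apply: le_lt_trans (ltry 1); rewrite (le_trans _ (Phib n))//.
apply: ge0_le_integral => //.
- by move=> x _; rewrite lee_fin (N_function_ge0 NPhi).
- exact/measurable_EFinP/(measurable_N_function NPhi).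
- exact/measurable_EFinP.
- move=> x _; rewrite lee_fin (N_function_le NPhi)//.
  by rewrite ler_peMl// ler1n.
Qed.

Let bmin n J : bounded_on D (fun x => Num.min (b n x) (level tau J)).
Proof.
have L0 := level_gt0 tau0 J; split.
- by apply: measurable_minr => //; exact: measurable_cst.
- exists (level tau J) => x; rewrite ger0_norm ?le_min ?b0 ?(ltW L0)//.
  by rewrite ge_min lexx orbT.
- by move=> x Dx; rewrite bD//; apply/min_idPl; exact: ltW.
Qed.

Let intbmin n J : m.-integrable setT (EFin \o (fun x => b n x - Num.min (b n x) (level tau J))).
Proof.
have -> : EFin \o (fun x => b n x - Num.min (b n x) (level tau J)) =
  ((EFin \o b n) \- (EFin \o (fun x => Num.min (b n x) (level tau J))))%E by [].
by apply: integrableB => //; exact: (bounded_on_integrable mD Dfin (bmin n J)).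
Qed.

(** The excess of [b] over [level J] vanishes unless [b] is larger than that level; once the level
    passes [c], superlinearity bounds the excess by [e * Phi (2 * b)], whose integral is at most [e]
    for every [n]. *)
Let uniform_tail (e : R) : 0 < e -> exists J0, forall J, (J0 <= J)%N -> forall n,
  \int[m]_x (b n x - Num.min (b n x) (level tau J)) <= e.
Proof.
move=> e0; have [c c0 cP] := N_function_superlinear NPhi e0.
have [J0 cJ0] : exists J0, forall J, (J0 <= J)%N -> c <= level tau J.
  (* It suffices that [J] exceed [c / tau], because [J < 2 ^ J] and [level tau J = tau * 2 ^ J]. *)
  exists (Num.bound (c / tau)) => J boundJ.
  rewrite /level -ler_pdivrMl// mulrC.
  have ct0 : 0 <= c / tau by rewrite divr_ge0// ltW.
  rewrite (le_trans (ltW (archi_boundP ct0)))// -natrX ler_nat.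
  by rewrite (leq_trans boundJ)// ltnW// ltn_expl.
exists J0 => J /cJ0 cJ n.
apply: (@le_trans _ _ (\int[m]_x (e * Phi (2 * b n x)))).
  apply: le_Rintegral => //.
    have -> : EFin \o (fun x => e * Phi (2 * b n x)) =
      (fun x => e%:E * (EFin \o (fun x => Phi (2 * b n x)%R)) x)%E by [].
    exact: integrableZl.
  move=> x _; have [bJ|Jb] := leP (b n x) (level tau J).
    by rewrite subrr mulr_ge0 ?(ltW e0)// (N_function_ge0 NPhi).
  apply: (@le_trans _ _ (2 * b n x)).
    rewrite mulrDl mul1r lerD2l (le_trans _ (b0 n x))// oppr_le0.
    by rewrite ltW// level_gt0.
  apply: cP; rewrite (le_trans cJ)// (le_trans (ltW Jb))// ler_peMl// ?ler1n//.
rewrite RintegralZl// -[leRHS]mulr1 ler_wpM2l ?(ltW e0)//.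
by have /andP[] := int_Phib n.
Qed.

Section limit_function.
Variables (S : set nat) (theta : nat -> Y -> R) (kappa : R).
Hypothesis uS : unbounded S.
Hypothesis thP : forall j, [/\ bounded_on D' (theta j),
  forall y, 0 <= theta j y <= height tau j &
  forall F G, V F G ->
    (fun n => \int[m]_x (layer tau j (b n x) * F n x)) @ within S \oo -->
    \int[m']_y (theta j y * G y)].
Hypothesis kappaP : (fun n => \int[m]_x Phi (2 * b n x)) @ within S \oo --> kappa.

Let PF : ProperFilter (within S \oo) := unbounded_proper uS.

Let bth j : bounded_on D' (theta j). Proof. by have [] := thP j. Qed.
Let th0 j y : 0 <= theta j y. Proof. by have [_ /(_ y)/andP[]] := thP j. Qed.

Let w_ J y := \sum_(j < J.+1) theta j y.
Let W y : \bar R := (\sum_(0 <= j <oo) (theta j y)%:E)%E.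
Let T J y : \bar R := (\sum_(0 <= i <oo) (theta (i + J.+1)%N y)%:E)%E.
(** Where the series is infinite, [fine] gives the default value [0]. There [w_error] holds because
    the tail is infinite too, and [Phi_w] because [Phi 0 = 0]. *)
Let w y := fine (W y).

Let w_ge0 J y : 0 <= w_ J y. Proof. exact: sumr_ge0. Qed.

Let bw J : bounded_on D' (w_ J).
Proof.
rewrite /w_; elim: J => [|J IH].
  by under eq_fun do rewrite big_ord1; exact: bth.
by under eq_fun do rewrite big_ord_recr; exact: bounded_onD.
Qed.

Let mT J : measurable_fun setT (T J).
Proof.
apply: ge0_emeasurable_sum => [i x _ _|i _]; first by rewrite lee_fin.
by apply/measurable_EFinP; have [] := bth (i + J.+1).
Qed.

Let T_ge0 J y : (0 <= T J y)%E.
Proof. by apply: nneseries_ge0 => i _ _; rewrite lee_fin. Qed.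

Let W_split J y : W y = ((w_ J y)%:E + T J y)%E.
Proof.
rewrite /W (nneseries_split 0 J.+1) => [|k _]; last by rewrite lee_fin.
rewrite add0n sumEFin big_mkord; congr (_ + _)%E.
by rewrite /T (nneseries_addn (f := fun i => (theta i y)%:E))// => i; rewrite lee_fin.
Qed.

Let cvg_w J F G : V F G ->
  (fun n => \int[m]_x (Num.min (b n x) (level tau J) * F n x)) @ within S \oo -->
  \int[m']_y (w_ J y * G y).
Proof.
move=> VF; apply: cvg_ext (@combination_limit S theta (fun=> 1) id thP J.+1 F G VF).
  move=> n; apply: eq_Rintegral => x _; rewrite -(sum_layer tau0 J (b0 n x)).
  by under eq_bigr do rewrite mul1r.
by apply: eq_Rintegral => y _; under eq_bigr do rewrite mul1r.
Qed.

Let bounded_on_mul_indic (f : X -> R) : (forall x, ~ D x -> f x = 0) ->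
  (fun x => f x * \1_D x) = f.
Proof.
move=> fD; apply/funext => x; rewrite indicE; have [_|] := boolP (x \in D).
  by rewrite mulr1.
by rewrite notin_setE => /fD ->; rewrite mul0r.
Qed.

Let cvg_w1 J :
  (fun n => \int[m]_x Num.min (b n x) (level tau J)) @ within S \oo -->
  \int[m']_y w_ J y.
Proof.
apply: cvg_ext (@cvg_w J _ _ (mean_algebra_unit mV)) => [n|].
  by congr Rintegral; apply: bounded_on_mul_indic; have [] := bmin n J.
congr Rintegral; apply/funext => y; rewrite indicE.
have [_|] := boolP (y \in D'); first by rewrite mulr1.
by rewrite notin_setE => Dy; have [_ _ ->//] := bw J; rewrite mul0r.
Qed.

(** A partial sum of the tail is a difference of two functions [w_], whose integral is the limit of
    the integrals of the corresponding difference of truncations of [b n]. That difference is at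
    most the excess over [level tau J], so the uniform bound passes to the limit. *)
Let int_T e J : (forall n, \int[m]_x (b n x - Num.min (b n x) (level tau J)) <= e) ->
  (\int[m']_y T J y <= e%:E)%E.
Proof.
move=> be; rewrite /T integral_nneseries//; last 2 first.
- by move=> i; apply/measurable_EFinP; have [] := bth (i + J.+1).
- by move=> i y _; rewrite lee_fin.
apply: nneseries_le_bound => [i|k].
  by apply: integral_ge0 => y _; rewrite lee_fin.
have -> : (\sum_(0 <= i < k) \int[m']_y (theta (i + J.+1)%N y)%:E)%E =
   (\int[m']_y w_ (J + k) y - \int[m']_y w_ J y)%:E.
  elim: k => [|k IH]; first by rewrite big_geq// addn0 subrr.
  rewrite big_nat_recr//= IH addnS [(J + k.+1)%N]addnS.
  have -> : w_ (J + k).+1 = fun y => w_ (J + k) y + theta (k + J).+1 y.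
    by apply/funext => y; rewrite /w_ big_ord_recr/= [(J + k)%N]addnC.
  rewrite (bounded_on_intD mD' Dfin')// EFinB EFinB [in RHS]EFinD.
  rewrite [in LHS]addeAC; congr (_ + _ - _)%E; rewrite fineK//.
  exact: integrable_fin_num (bounded_on_integrable mD' Dfin' (bth _)).
rewrite lee_fin.
have cv : (fun n => \int[m]_x Num.min (b n x) (level tau (J + k)) -
    \int[m]_x Num.min (b n x) (level tau J)) @ within S \oo -->
    \int[m']_y w_ (J + k) y - \int[m']_y w_ J y.
  by apply: cvgB; exact: cvg_w1.
apply: (cvgr_to_le cv); first exact: PF.
apply: filterE => n /=; apply: le_trans (be n).
rewrite -(bounded_on_intB mD Dfin)//; apply: le_Rintegral => //.
  exact: (bounded_on_integrable mD Dfin (bounded_onB (bmin n (J + k)) (bmin n J))).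
by move=> x _; rewrite lerD2r ge_min lexx.
Qed.

Let w_error J y : (`|w y - w_ J y|%:E <= T J y)%E.
Proof.
have [->|Tfin] := eqVneq (T J y) +oo%E; first exact: leey.
have TE : T J y \is a fin_num by rewrite ge0_fin_numE// lt_neqAle Tfin leey.
rewrite /w (W_split J) -(fineK TE) -EFinD /= [w_ J y + _]addrC addrK.
by rewrite ger0_norm// fine_ge0.
Qed.

Let mw : measurable_fun setT w.
Proof.
apply: measurableT_comp => //.
apply: ge0_emeasurable_sum => [i x _ _|i _]; first by rewrite lee_fin.
by apply/measurable_EFinP; have [] := bth i.
Qed.

Let w0 y : 0 <= w y.
Proof. by apply/fine_ge0/nneseries_ge0 => i _ _; rewrite lee_fin. Qed.

Let wD y : ~ D' y -> w y = 0.
Proof.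
by move=> Dy; rewrite /w /W eseries0// => i _ _; have [_ _ ->] := bth i.
Qed.

Let int_w_error e J :
  (forall n, \int[m]_x (b n x - Num.min (b n x) (level tau J)) <= e) ->
  m'.-integrable setT (EFin \o (fun y => w y - w_ J y)) /\
  \int[m']_y `|w y - w_ J y| <= e.
Proof.
move=> be; have mwJ : measurable_fun setT (fun y => w y - w_ J y).
  by apply: measurable_funB => //; have [] := bw J.
have iT : (\int[m']_y `|(w y - w_ J y)%:E| <= e%:E)%E.
  apply: le_trans (int_T be); apply: ge0_le_integral => //.
    by apply: measurableT_comp => //; exact/measurable_EFinP.
  by move=> y _; exact: w_error.
have iw : m'.-integrable setT (EFin \o (fun y => w y - w_ J y)).
  apply/integrableP; split; first exact/measurable_EFinP.
  exact: le_lt_trans iT (ltry _).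
split => //; rewrite -lee_fin fineK//.
by apply: integrable_fin_num => //; exact: integrable_norm.
Qed.

Let intw : m'.-integrable setT (EFin \o w).
Proof.
have [J0 JP] := uniform_tail (@ltr01 R); have [iw _] := int_w_error (JP J0 (leqnn J0)).
have -> : EFin \o w = ((EFin \o (fun y => w y - w_ J0 y)%R) \+ (EFin \o w_ J0))%E.
  by apply/funext => y /=; rewrite -EFinD subrK.
by apply: integrableD => //; exact: (bounded_on_integrable mD' Dfin').
Qed.

Let cvg_pairing F G : V F G ->
  (fun n => \int[m]_x (b n x * F n x)) @ within S \oo --> \int[m']_y (w y * G y).
Proof.
move=> VF; have bG := mean_algebra_tgt mV VF; have bF := mean_algebra_src mV VF.
have [B B0 FB] := mean_algebra_ubound mV VF; have [_ [B' GB'] _] := bG.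
pose C := B + `|B'| + 1.
have C0 : 0 < C by rewrite addr_gt0// ltr_wpDr.
have BC : B <= C by rewrite /C -addrA lerDl addr_ge0.
have GC y : `|G y| <= C.
  rewrite (le_trans (GB' y))// (le_trans (ler_norm _))// /C.
  by rewrite addrAC lerDr addr_ge0// ltW.
apply/cvgrPdist_le => e e0; have e3 : 0 < e / 3 by rewrite divr_gt0.
have [J0 /(_ J0 (leqnn _)) bJ] := uniform_tail (divr_gt0 e3 C0).
have [iw iwe] := int_w_error bJ.
have /cvgrPdist_le/(_ _ e3) := @cvg_w J0 _ _ VF.
apply: filterS => n cn.
rewrite (_ : _ - _ = \int[m']_y ((w y - w_ J0 y) * G y) +
  (\int[m']_y (w_ J0 y * G y) -
    \int[m]_x (Num.min (b n x) (level tau J0) * F n x)) -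
  \int[m]_x ((b n x - Num.min (b n x) (level tau J0)) * F n x)); last first.
  under [X in _ = X + _ - _]eq_Rintegral do rewrite mulrBl.
  under [X in _ = _ + _ - X]eq_Rintegral do rewrite mulrBl.
  rewrite RintegralB//; last 2 first.
  - exact: integrable_mul_bounded bG.
  - by apply: (bounded_on_integrable mD' Dfin'); exact: bounded_onM.
  rewrite RintegralB//; last 2 first.
  - exact: integrable_mul_bounded (bF n).
  - by apply: (bounded_on_integrable mD Dfin); exact: bounded_onM.
  move: (Rintegral _ _ _) (Rintegral _ _ _) (Rintegral _ _ _) (Rintegral _ _ _).
  by move=> *; ring.
have h1 : `|\int[m']_y ((w y - w_ J0 y) * G y)| <= e / 3.
  rewrite (le_trans (le_normr_int_mul iw bG GC))//.
  by rewrite mulrC -ler_pdivlMr.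
have h2 : `|\int[m]_x ((b n x - Num.min (b n x) (level tau J0)) * F n x)| <= e / 3.
  have FC x : `|F n x| <= C by exact: le_trans BC.
  rewrite (le_trans (le_normr_int_mul (intbmin n J0) (bF n) FC))//.
  rewrite mulrC -ler_pdivlMr//; apply: le_trans (bJ n).
  rewrite le_eqVlt; apply/orP; left; apply/eqP; apply: eq_Rintegral => x _.
  by rewrite ger0_norm// subr_ge0 ge_min lexx.
rewrite (le_trans (ler_normB _ _))// (_ : e = e / 3 + e / 3 + e / 3); last by field.
by rewrite lerD// (le_trans (ler_normD _ _))// lerD.
Qed.

Let Wslope y : \bar R := (\sum_(0 <= j <oo) (slope tau Phi j * theta j.+1 y)%:E)%E.

Let slope0 j : 0 <= slope tau Phi j. Proof. exact: slope_ge0. Qed.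

Let Phi_w y : ((Phi (w y))%:E <= (Phi tau * \1_D' y)%:E + Wslope y)%E.
Proof.
have Phitau : 0 <= Phi tau by rewrite (N_function_ge0 NPhi)// ltW.
have Ws0 : (0 <= Wslope y)%E.
  by apply: nneseries_ge0 => j _ _; rewrite lee_fin mulr_ge0.
have rhs0 : (0 <= (Phi tau * \1_D' y)%:E + Wslope y)%E.
  by rewrite adde_ge0// lee_fin mulr_ge0.
have [Dy|Dy] := pselect (D' y); last by rewrite wD// (N_function0 NPhi).
have [Woo|Wfin] := eqVneq (W y) +oo%E.
  by rewrite /w Woo /= (N_function0 NPhi).
have W_ge0 : (0 <= W y)%E by apply: nneseries_ge0 => i _ _; rewrite lee_fin.
have WE : W y \is a fin_num by rewrite ge0_fin_numE// lt_neqAle Wfin leey.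
have [->|Wsfin] := eqVneq (Wslope y) +oo%E; first by rewrite addey// leey.
have WsE : Wslope y \is a fin_num by rewrite ge0_fin_numE// lt_neqAle Wsfin leey.
rewrite -(fineK WsE) -EFinD lee_fin.
apply: (N_function_sup NPhi (P := fun J => w_ J y)) => //.
- have cW : (fun k => \sum_(0 <= i < k) (theta i y)%:E)%E @ \oo --> W y.
    by apply: is_cvg_nneseries => i _ _; rewrite lee_fin.
  rewrite -(fineK WE) in cW.
  have fc : fine \o (fun k => \sum_(0 <= i < k) (theta i y)%:E)%E @ \oo --> w y.
    exact: fine_cvg.
  (* The sum [w_ J] has [J.+1] terms, hence the shift by one. *)
  rewrite -cvg_shiftS in fc; apply: cvg_ext fc => // k.
  by rewrite /= sumEFin /= big_mkord.
- move=> J; rewrite indicE mem_set// mulr1.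
  have th j : 0 <= theta j y <= height tau j by have [_] := thP j.
  apply: le_trans (N_function_sum_layers tau0 NPhi J th) _.
  rewrite lerD2l -lee_fin fineK//.
  apply: le_trans (nneseries_lim_ge J _); last by move=> j _ _; rewrite lee_fin mulr_ge0.
  by rewrite sumEFin big_mkord.
Qed.

(** Partial sums are linear in the [theta j], so their integrals are limits of integrals of the same
    combinations of layers, tested against the unit pair; [sum_slope_layer] compares these with
    [Phi (2 * b n)]. *)
Let int_Wslope : (\int[m']_y Wslope y <= kappa%:E)%E.
Proof.
have bs j : bounded_on D' (fun y => slope tau Phi j * theta j.+1 y) by exact: bounded_onZ.
have bl n j : bounded_on D (fun x => slope tau Phi j * layer tau j.+1 (b n x)).
  exact: bounded_onZ.
rewrite /Wslope integral_nneseries//; last 2 first.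
- by move=> i; apply/measurable_EFinP; have [] := bs i.
- by move=> i y _; rewrite lee_fin mulr_ge0.
apply: nneseries_le_bound => [i|k].
  by apply: integral_ge0 => y _; rewrite lee_fin mulr_ge0.
have cv := @combination_limit S theta (slope tau Phi) succn thP k _ _ (mean_algebra_unit mV).
have -> : (\sum_(0 <= i < k) \int[m']_y (slope tau Phi i * theta i.+1 y)%:E)%E =
   (\int[m']_y ((\sum_(j < k) slope tau Phi j * theta j.+1 y) * \1_D' y))%:E.
  have -> : (\int[m']_y ((\sum_(j < k) slope tau Phi j * theta j.+1 y) * \1_D' y)) =
      \int[m']_y (\sum_(j < k) slope tau Phi j * theta j.+1 y).
    apply: eq_Rintegral => y _; rewrite indicE; have [_|] := boolP (y \in D').
      by rewrite mulr1.
    rewrite notin_setE => Dy; rewrite mulr0 big1// => j _.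
    by have [_ _ ->] := bs j.
  rewrite (bounded_on_int_sum mD' Dfin' _ (fun j : 'I_k => bs j)) -sumEFin big_mkord.
  apply: eq_bigr => j _; rewrite fineK//.
  exact: integrable_fin_num (bounded_on_integrable mD' Dfin' (bs j)).
rewrite lee_fin.
apply: (@ler_cvg_to _ _ PF _ _ _ _ _ cv kappaP).
apply: filterE => n; apply: le_Rintegral => //.
  apply: (bounded_on_integrable mD Dfin); apply: bounded_onM; last exact: bounded_on_indic.
  exact: (bounded_on_sum mD _ (fun j : 'I_k => bl n j)).
move=> x _; rewrite indicE; have [_|] := boolP (x \in D).
  by rewrite mulr1; exact: sum_slope_layer.
by rewrite mulr0 (N_function_ge0 NPhi).
Qed.

Let modular_w : (\int[m']_y (Phi (w y))%:E <= (Phi tau)%:E * m' D' + kappa%:E)%E.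
Proof.
have Phitau : 0 <= Phi tau by rewrite (N_function_ge0 NPhi)// ltW.
have mWs : measurable_fun setT Wslope.
  apply: ge0_emeasurable_sum => [j y _ _|j _]; first by rewrite lee_fin mulr_ge0.
  apply/measurable_EFinP; apply: measurable_funM; first exact: measurable_cst.
  by have [] := bth j.+1.
have mc : measurable_fun setT (fun y => (Phi tau * \1_D' y)%:E).
  apply/measurable_EFinP; apply: measurable_funM; first exact: measurable_cst.
  exact: measurable_indic.
apply: (@le_trans _ _ (\int[m']_y ((Phi tau * \1_D' y)%:E + Wslope y))%E).
  apply: ge0_le_integral => //.
  - by move=> y _; rewrite lee_fin (N_function_ge0 NPhi).
  - exact/measurable_EFinP/(measurable_N_function NPhi).
  - exact: emeasurable_funD.
rewrite ge0_integralD//; last 2 first.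
- by move=> y _; rewrite lee_fin mulr_ge0.
- by move=> y _; apply: nneseries_ge0 => j _ _; rewrite lee_fin mulr_ge0.
rewrite leeD//; under eq_integral do rewrite EFinM.
by rewrite ge0_integralZl_EFin// ?integral_indic ?setIT//; exact/measurable_EFinP/measurable_indic.
Qed.

Lemma limit_function : exists w : Y -> R, [/\
  measurable_fun setT w, forall y, 0 <= w y & forall y, ~ D' y -> w y = 0] /\
  [/\ m'.-integrable setT (EFin \o w),
    (\int[m']_y (Phi (w y))%:E <= (Phi tau)%:E * m' D' + kappa%:E)%E &
  forall F G, V F G ->
  (fun n => \int[m]_x (b n x * F n x)) @ within S \oo --> \int[m']_y (w y * G y)].
Proof. by exists w; split; split => //; exact: cvg_pairing. Qed.

End limit_function.

(** The modular bound retains [kappa] instead of [1]: when countably many pieces are glued, it is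
    the sum of their [kappa] that stays bounded, and [tau] remains free to make the other terms
    summable. *)
Lemma superposition_limit S : unbounded S ->
  exists S', [/\ S' `<=` S, unbounded S' & exists kappa : R,
    (fun n => \int[m]_x Phi (2 * b n x)) @ within S' \oo --> kappa /\
  exists w : Y -> R, [/\
  measurable_fun setT w, forall y, 0 <= w y & forall y, ~ D' y -> w y = 0] /\
  [/\ m'.-integrable setT (EFin \o w),
    (\int[m']_y (Phi (w y))%:E <= (Phi tau)%:E * m' D' + kappa%:E)%E &
  forall F G, V F G ->
  (fun n => \int[m]_x (b n x * F n x)) @ within S' \oo --> \int[m']_y (w y * G y)]].
Proof.
move=> uS; have [S1 [S1S uS1 [theta thP]]] := layer_limits uS.
have [S2 [S21 uS2 [kappa _ kappaP]]] := bounded_along uS1 int_Phib.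
have thP2 j : [/\ bounded_on D' (theta j),
  forall y, 0 <= theta j y <= height tau j &
  forall F G, V F G ->
    (fun n => \int[m]_x (layer tau j (b n x) * F n x)) @ within S2 \oo -->
    \int[m']_y (theta j y * G y)].
  have [bt ht ct] := thP j; split => // F G VF.
  exact: cvg_almost_sub (subset_almost_sub S21) (ct F G VF).
exists S2; split => //; first exact: subset_trans S1S.
by exists kappa; split => //; exact: limit_function uS2 thP2 kappaP.
Qed.

End superposition.

(** * Lebesgue measure on R^d *)

Section lebesgue_Rd_theory.
Context (d : nat) (R : realType).
Local Notation Rd := 'rV[R]_d.
Local Notation outer := (@lebesgue_outer d R).

(** Half-open boxes are cut without overlap or loss. If [t] misses the [i]-th side, one piece is
    degenerate and [Num.max 0] gives it volume [0]. *)
Lemma box_volume_split (c : option (Rd * Rd)) (i : 'I_d) (t : R) :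
  exists c1 c2, [/\ box c `&` [set x : Rd | x ord0 i <= t] `<=` box c1,
    box c `&` ~` [set x : Rd | x ord0 i <= t] `<=` box c2 &
    (box_volume c1 + box_volume c2 = box_volume c)%E].
Proof.
case: c => [[a b]|]; last by exists None, None; rewrite /= adde0; split => // x [].
pose b' : Rd := \row_j (if j == i then Num.min (b ord0 j) t else b ord0 j).
pose a' : Rd := \row_j (if j == i then Num.max (a ord0 j) t else a ord0 j).
exists (Some (a, b')), (Some (a', b)); split.
- move=> x [/= ab xt] j; have /andP[aj bj] := ab j; rewrite mxE aj /=.
  by case: eqP => // ->; rewrite le_min xt andbT; have /andP[] := ab i.
- move=> x [/= ab /negP]; rewrite -ltNge => xt j; have /andP[aj bj] := ab j.
  rewrite mxE bj andbT.
  by case: eqP => // ->; rewrite gt_max xt andbT; have /andP[] := ab i.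
rewrite /= -EFinD; congr EFin.
have D1 (g : 'I_d -> R) : \prod_(j < d) g j = g i * \prod_(j < d | j != i) g j.
  by rewrite (bigD1 i).
rewrite !D1 !mxE eqxx.
have e1 : \prod_(j < d | j != i) Num.max 0 (b' ord0 j - a ord0 j) =
   \prod_(j < d | j != i) Num.max 0 (b ord0 j - a ord0 j).
  by apply: eq_bigr => j /negbTE ji; rewrite mxE ji.
have e2 : \prod_(j < d | j != i) Num.max 0 (b ord0 j - a' ord0 j) =
   \prod_(j < d | j != i) Num.max 0 (b ord0 j - a ord0 j).
  by apply: eq_bigr => j /negbTE ji; rewrite mxE ji.
rewrite e1 e2 -mulrDl; congr (_ * _).
move: (a ord0 i) (b ord0 i) => u v.
by rewrite /Num.max /Num.min; do ![case: ifP => //=]; lra.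
Qed.

(** Cutting every box of a cover of [X] yields covers of the two parts of [X] with the same total
    volume, which is the Caratheodory inequality. *)
Lemma halfspace_measurable (i : 'I_d) (t : R) :
  measurable ([set x : Rd | x ord0 i <= t] : set (lebesgueType d R)).
Proof.
apply: le_caratheodory_measurable => X; set H := [set x | _].
apply: le_ereal_inf_tmp => _ [F XF <-].
have [F1 F1P] := choice (fun k => box_volume_split (F k) i t).
have [F2 {F1P}FP] := choice F1P.
rewrite (eq_eseriesr (g := fun k => box_volume (F1 k) + box_volume (F2 k))%E); last first.
  by move=> k _; have [_ _ ->] := FP k.
rewrite nneseriesD; [|by move=> k _ _; exact: box_volume_ge0..].
apply: leeD; apply: ereal_inf_lbound.
- exists F1 => // x [/XF[k _ Fx] Hx]; exists k => //.
  by have [+ _ _] := FP k; apply.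
- exists F2 => // x [/XF[k _ Fx] Hx]; exists k => //.
  by have [_ + _] := FP k; apply.
Qed.

Lemma measurable_coord (i : 'I_d) :
  measurable_fun [set: lebesgueType d R] (fun x : lebesgueType d R => (x : Rd) ord0 i).
Proof.
apply: (measurability _ (RGenOInfty.measurableE R)).
move=> _ [_ [t ->] <-]; rewrite setTI.
rewrite (_ : _ @^-1` _ = ~` [set x : Rd | x ord0 i <= t]); last first.
  apply/seteqP; split => x /=; rewrite in_itv/= andbT ltNge => /negP //.
exact/measurableC/halfspace_measurable.
Qed.

(** [U] is the union of the countably many cubes with rational centre and radius [1 / (k + 1)] that
    it contains, each a finite intersection of coordinate conditions. *)
Lemma open_measurable_Rd (U : set Rd) : open U ->
  measurable (U : set (lebesgueType d R)).
Proof.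
move=> oU.
pose cube (qk : 'rV[rat]_d * nat) : set Rd :=
  [set y | forall i, `|ratr (qk.1 ord0 i) - y ord0 i| < qk.2.+1%:R^-1].
have mcube qk : measurable (cube qk : set (lebesgueType d R)).
  rewrite (_ : cube qk = \bigcap_(i in [set: 'I_d])
      [set y : Rd | `|ratr (qk.1 ord0 i) - y ord0 i| < qk.2.+1%:R^-1]); last first.
    by apply/seteqP; split=> [y yq i _|y yq i]; [exact: yq|exact: (yq i)].
  apply: fin_bigcap_measurable => // i _.
  rewrite -[X in measurable X]setTI.
  have : measurable_fun [set: lebesgueType d R]
      (fun y : lebesgueType d R => `|ratr (qk.1 ord0 i) - (y : Rd) ord0 i| : R).
    apply: measurableT_comp; first exact: normr_measurable.
    apply: measurable_funB; first exact: measurable_cst.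
    exact: measurable_coord.
  move=> /(_ measurableT `]-oo, qk.2.+1%:R^-1[%classic (measurable_itv _)).
  rewrite (_ : _ @^-1` _ = [set y : Rd | `|ratr (qk.1 ord0 i) - y ord0 i| < qk.2.+1%:R^-1])//.
rewrite (_ : U = \bigcup_(qk in [set: 'rV[rat]_d * nat])
    (if `[< cube qk `<=` U >] then cube qk else set0)).
  apply: countable_bigcupT_measurable => [|qk].
    by apply: countableP.
  by case: ifP => _; [exact: mcube|exact: measurable0].
apply/seteqP; split => [x Ux|x [qk _]]; last by case: asboolP => // sU /sU.
have /nbhs_ballP[e /= e0 xeU] := open_nbhs_nbhs (conj oU Ux).
(* A radius below [e / 2] places every cube through [x] inside the ball of radius [e] around [x]. *)
have [k _ kP] := near_infty_natSinv_lt (PosNum (divr_gt0 e0 (ltr0Sn R 1))).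
have ke : k.+1%:R^-1 < e / 2 := kP k (leqnn k).
have k0 : 0 < k.+1%:R^-1 :> R by rewrite invr_gt0.
have /choice[q qP] : forall i : 'I_d, exists q : rat,
    `|ratr q - x ord0 i| < k.+1%:R^-1.
  move=> i; have [q] : exists q : rat,
      ratr q \in `](x ord0 i - k.+1%:R^-1), (x ord0 i + k.+1%:R^-1)[.
    by apply: rat_in_itvoo; rewrite ltrD2l gtrN.
  by rewrite in_itv/= -ltr_distl => qP; exists q.
have cx : cube (\row_i q i, k) x by move=> i; rewrite /= mxE.
exists (\row_i q i, k) => //; case: asboolP => // nU; exfalso; apply: nU => y cy.
apply: xeU; split => // i j; rewrite (ord1 i).
have := cy j; have := cx j; rewrite /= mxE => h1 h2.
rewrite -ball_normE /ball_/= (_ : _ - _ = (ratr (q j) - y ord0 j) - (ratr (q j) - x ord0 j)); last by ring.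
by rewrite (le_lt_trans (ler_normB _ _))// [ltRHS]splitr ltrD// (lt_trans _ ke).
Qed.

Lemma continuous_measurable_Rd (f : Rd -> R) : continuous f ->
  measurable_fun [set: lebesgueType d R] (f : lebesgueType d R -> R).
Proof.
move=> cf; apply: (measurability _ (RGenOpens.measurableE R)).
move=> _ [_ [a [b ->]] <-]; rewrite setTI; apply: open_measurable_Rd.
by apply: open_comp => // x _; exact: cf.
Qed.

Lemma lebesgue_outer_scale (c : R) (X : set Rd) : 0 < c ->
  (outer [set c *: x | x in X] <= (c ^+ d)%:E * outer X)%E.
Proof.
move=> c0; have cd0 : 0 < c ^+ d by rewrite exprn_gt0.
rewrite -lee_pdivrMl//; apply: le_ereal_inf_tmp => _ [F XF <-].
rewrite lee_pdivrMl//.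
pose Fc k := if F k is Some (a, b) then Some (c *: a, c *: b) else None.
rewrite -nneseriesZl; last by move=> k _; exact: box_volume_ge0.
apply: ereal_inf_lbound; exists Fc.
  move=> _ [x /XF[k _ Fx] <-]; exists k => //; move: Fx; rewrite /Fc.
  case: (F k) => [[a b]|]//= ab i; rewrite !mxE.
  by have /andP[ai bi] := ab i; rewrite ltr_pM2l// ler_pM2l// ai.
apply: eq_eseriesr => k _; rewrite /Fc; case: (F k) => [[a b]|] /=; last by rewrite mule0.
rewrite -EFinM; congr EFin; under eq_bigr do rewrite !mxE -mulrBr -[X in Num.max X]( mulr0 c) -maxr_pMr ?(ltW c0)//.
by rewrite big_split/= prodr_const card_ord.
Qed.

(** Measurability is between Lebesgue sigma-algebras, for which continuity does not suffice. Scaling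
    by [c] and by [c^-1] bounds the outer measure from both sides, so the Caratheodory criterion for
    [A] at the scaled set gives the one for the preimage at [X]. *)
Lemma measurable_scale (c : R) : 0 < c -> measurable_fun [set: lebesgueType d R]
  ((fun x : Rd => c *: x) : lebesgueType d R -> lebesgueType d R).
Proof.
move=> c0 _ A mA; rewrite setTI.
have cK : cancel (fun x : Rd => c *: x) (fun x : Rd => c^-1 *: x).
  by move=> x; rewrite scalerA mulVf ?scale1r// gt_eqF.
have cK' : cancel (fun x : Rd => c^-1 *: x) (fun x : Rd => c *: x).
  by move=> x; rewrite scalerA mulfV ?scale1r// gt_eqF.
have ci0 : 0 < c^-1 by rewrite invr_gt0.
have back (X : set Rd) : [set c^-1 *: x | x in [set c *: x | x in X]] = X.
  rewrite image_comp; rewrite -[RHS]image_id; apply: eq_imagel => x _ /=; exact: cK.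
have scale_le (X : set Rd) : (outer X <= (c^-1 ^+ d)%:E * outer [set c *: x | x in X])%E.
  by have := lebesgue_outer_scale [set c *: x | x in X] ci0; rewrite back.
apply: le_caratheodory_measurable => X.
have := mA [set c *: x | x in X].
rewrite /= => mAX.
apply: (@le_trans _ _ ((c^-1 ^+ d)%:E * outer ([set c *: x | x in X] `&` A) +
   (c^-1 ^+ d)%:E * outer ([set c *: x | x in X] `&` ~` A))%E).
  apply: leeD; apply: le_trans (scale_le _) _; rewrite lee_pmul2l// ?lte_fin ?exprn_gt0//.
    by apply: le_lebesgue_outer => _ [x [Xx Ax] <-]; split => //; exists x.
  by apply: le_lebesgue_outer => _ [x [Xx Ax] <-]; split => //; exists x.
rewrite -ge0_muleDr ?lebesgue_outer_ge0//.
have -> : (outer ([set c *: x | x in X] `&` A) + outer ([set c *: x | x in X] `&` ~` A) =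
  outer [set c *: x | x in X])%E by rewrite mAX.
apply: (@le_trans _ _ ((c^-1 ^+ d)%:E * ((c ^+ d)%:E * outer X))%E).
  by rewrite lee_pmul2l// ?lte_fin ?exprn_gt0//; exact: lebesgue_outer_scale.
by rewrite muleA -EFinM -exprMn mulVf ?gt_eqF// expr1n mul1e.
Qed.

Lemma le_coord_norm (x : Rd) i : `|x ord0 i| <= `|x|.
Proof.
rewrite {2}/Num.norm/= mx_normrE.
exact: (le_bigmax _ (fun ij => `|x ij.1 ij.2|) (ord0, i)).
Qed.

Lemma lebesgue_Rd_bounded (r : R) (X : set Rd) : (forall x, X x -> `|x| < r) ->
  (lebesgue_Rd d R X < +oo)%E.
Proof.
move=> Xr; pose a : Rd := const_mx (- r); pose b : Rd := const_mx r.
apply: (@le_lt_trans _ _ (box_volume (Some (a, b)))); last exact: ltry.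
pose F k : option (Rd * Rd) := if k is 0%N then Some (a, b) else None.
apply: (@le_trans _ _ (\sum_(0 <= k <oo) box_volume (F k))%E).
  apply: ereal_inf_lbound; exists F => // x Xx; exists 0%N => //= i.
  have := le_lt_trans (le_coord_norm x i) (Xr x Xx).
  by rewrite !mxE ltr_norml => /andP[-> /ltW].
rewrite (nneseries_split 0 1); last by move=> k _; exact: box_volume_ge0.
rewrite add0n big_nat1 eseries0 ?adde0//.
by case.
Qed.

Lemma measurable_normRd : measurable_fun [set: lebesgueType d R]
  (fun x : lebesgueType d R => `|x : Rd| : R).
Proof. by apply: continuous_measurable_Rd => x; exact: norm_continuous. Qed.

Lemma lebesgue_Rd_sigma_finite : sigma_finite setT (lebesgue_Rd d R).
Proof.
exists (fun k => [set x : Rd | `|x| < k%:R]).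
  apply/esym/seteqP; split => // x _; exists (Num.bound `|x|) => //=.
  exact: archi_boundP.
move=> k; split; last by apply: (@lebesgue_Rd_bounded k%:R).
have := measurable_normRd measurableT (measurable_itv `]-oo, k%:R[).
rewrite setTI (_ : _ @^-1` _ = [set x : Rd | `|x| < k%:R])//.
Qed.

End lebesgue_Rd_theory.

(** * The Gelfand transform *)

Section complex_numbers.
Context {R : realType}.
Implicit Types z w : cplx R.

Lemma cplxP z w : cre z = cre w -> cim z = cim w -> z = w.
Proof. by case: z w => [a b] [a' b'] /= -> ->. Qed.

Lemma creD z w : cre (z + w) = cre z + cre w. Proof. by case: z w => [a b] []. Qed.
Lemma cimD z w : cim (z + w) = cim z + cim w. Proof. by case: z w => [a b] []. Qed.
Lemma creN z : cre (- z) = - cre z. Proof. by case: z. Qed.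
Lemma cimN z : cim (- z) = - cim z. Proof. by case: z. Qed.
Lemma creB z w : cre (z - w) = cre z - cre w. Proof. by rewrite creD creN. Qed.
Lemma cimB z w : cim (z - w) = cim z - cim w. Proof. by rewrite cimD cimN. Qed.
Lemma creM z w : cre (z * w) = cre z * cre w - cim z * cim w.
Proof. by case: z w => [a b] []. Qed.
Lemma cimM z w : cim (z * w) = cre z * cim w + cim z * cre w.
Proof. by case: z w => [a b] []. Qed.

Lemma cabsM z w : cabs (z * w) = cabs z * cabs w.
Proof. exact: ComplexField.Normc.normcM. Qed.
Lemma cabsV z : cabs z^-1 = (cabs z)^-1.
Proof. exact: ComplexField.Normc.normcV. Qed.
Lemma cabs1 : cabs (1 : cplx R) = 1. Proof. exact: ComplexField.Normc.normc1. Qed.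
Lemma cabs0 : cabs (0 : cplx R) = 0. Proof. exact: ComplexField.Normc.normc0. Qed.
Lemma ler_cabsD z w : cabs (z + w) <= cabs z + cabs w. Proof. exact: le_normcD. Qed.
Lemma cabs_ge0 z : 0 <= cabs z. Proof. by case: z => a b; exact: sqrtr_ge0. Qed.

Lemma cabs_sqr z : cabs z ^+ 2 = cre z ^+ 2 + cim z ^+ 2.
Proof. by case: z => a b; rewrite /cabs/= sqr_sqrtr// addr_ge0// sqr_ge0. Qed.

Lemma cre_le_cabs z : `|cre z| <= cabs z.
Proof.
rewrite -(ler_pXn2r (ltn0Sn 1)) ?nnegrE ?cabs_ge0// cabs_sqr real_normK ?num_real//.
by rewrite lerDl sqr_ge0.
Qed.

Lemma cim_le_cabs z : `|cim z| <= cabs z.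
Proof.
rewrite -(ler_pXn2r (ltn0Sn 1)) ?nnegrE ?cabs_ge0// cabs_sqr real_normK ?num_real//.
by rewrite lerDr sqr_ge0.
Qed.

Lemma cabs_le_reim z : cabs z <= `|cre z| + `|cim z|.
Proof.
rewrite -(ler_pXn2r (ltn0Sn 1)) ?nnegrE ?cabs_ge0 ?addr_ge0// cabs_sqr sqrrD.
by rewrite !real_normK ?num_real// lerD2r lerDl mulrn_wge0// mulr_ge0.
Qed.

Lemma norm_cplx z : `|z| = cofr (cabs z).
Proof. by case: z => a b; exact: normc_def. Qed.

Lemma cofr_lt (a b : R) : (cofr a < cofr b) = (a < b). Proof. exact: ltcR. Qed.
Lemma cplx_gt0 (e : cplx R) : 0 < e -> exists2 r, 0 < r & e = cofr r.
Proof.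
case: e => a b /=; rewrite ltcE/= => /andP[/eqP b0 a0]; exists a => //.
by rewrite b0.
Qed.

(** The norm of [cplx R] has values in [cplx R], where a positive element is a positive real; this
    permits real tolerances. *)
Lemma cvg_cabsP {I : Type} {F : set_system I} {FF : Filter F} (f : I -> cplx R) z :
  f @ F --> z <-> forall e : R, 0 < e -> \forall i \near F, cabs (z - f i) < e.
Proof.
split => [/cvgrPdist_lt fz e e0|fz].
  have e0' : 0 < cofr e by rewrite -[X in X < _]/(cofr 0) cofr_lt.
  by apply: filterS (fz _ e0') => i; rewrite norm_cplx cofr_lt.
apply/cvgrPdist_lt => _ /cplx_gt0[e e0 ->].
by apply: filterS (fz _ e0) => i; rewrite norm_cplx cofr_lt.
Qed.

Lemma cvg_cre {I : Type} {F : set_system I} {FF : Filter F} (f : I -> cplx R) z :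
  f @ F --> z -> (fun i => cre (f i)) @ F --> cre z.
Proof.
move=> /cvg_cabsP fz; apply/cvgrPdist_lt => e e0; apply: filterS (fz _ e0) => i.
by rewrite -creB; apply: le_lt_trans (cre_le_cabs _).
Qed.

Lemma cvg_cim {I : Type} {F : set_system I} {FF : Filter F} (f : I -> cplx R) z :
  f @ F --> z -> (fun i => cim (f i)) @ F --> cim z.
Proof.
move=> /cvg_cabsP fz; apply/cvgrPdist_lt => e e0; apply: filterS (fz _ e0) => i.
by rewrite -cimB; apply: le_lt_trans (cim_le_cabs _).
Qed.

Lemma cvg_cplx {I : Type} {F : set_system I} {FF : Filter F} (f : I -> cplx R) z :
  (fun i => cre (f i)) @ F --> cre z -> (fun i => cim (f i)) @ F --> cim z ->
  f @ F --> z.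
Proof.
move=> /cvgrPdist_lt fr /cvgrPdist_lt fi; apply/cvg_cabsP => e e0.
have e20 : 0 < e / 2 by rewrite divr_gt0.
near=> i; apply: le_lt_trans (cabs_le_reim _) _.
by rewrite creB cimB [ltRHS]splitr ltrD//; near: i; [exact: fr|exact: fi].
Unshelve. all: by end_near. Qed.

Lemma continuous_cre {T : topologicalType} (f : T -> cplx R) : continuous f ->
  continuous (fun x => cre (f x)).
Proof. by move=> cf x; apply: cvg_cre; exact: cf. Qed.

Lemma continuous_cim {T : topologicalType} (f : T -> cplx R) : continuous f ->
  continuous (fun x => cim (f x)).
Proof. by move=> cf x; apply: cvg_cim; exact: cf. Qed.

End complex_numbers.

Section gelfand_theory.
Context {R : realType} {d : nat} (A : H_supralgebra R d).

Definition supralg_mk (f : 'rV[R]_d -> cplx R) (Af : supralg_set A f) :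
  supralg_elt A := exist _ f (mem_set Af).

Lemma supralg_mkE f Af : supralg_fun (@supralg_mk f Af) = f. Proof. by []. Qed.

Lemma supralg_funP (u : supralg_elt A) : supralg_set A (supralg_fun u).
Proof. by case: u => f fA; exact: set_mem fA. Qed.

Definition supralg_prod (u v : supralg_elt A) : supralg_elt A :=
  supralg_mk (supralg_mul (supralg_funP u) (supralg_funP v)).

Definition supralg_one : supralg_elt A := supralg_mk (supralg_cst A 1).

Lemma supralg_fun_bounded (u : supralg_elt A) :
  exists2 B : R, 0 <= B & forall y, cabs (supralg_fun u y) <= B.
Proof.
have [_ [C uC]] := supralg_bounded_continuous (supralg_funP u).
by exists C => //; exact: le_trans (cabs_ge0 _) (uC 0).
Qed.

Lemma supralg_fun_continuous (u : supralg_elt A) : continuous (supralg_fun u).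
Proof. by have [] := supralg_bounded_continuous (supralg_funP u). Qed.

Section one_character.
Variable chi : supralg_elt A -> cplx R.
Hypothesis chiP : character chi.

Lemma character_one : chi supralg_one = 1.
Proof.
have [u u0] := character_neq0 chiP.
have : chi u = chi supralg_one * chi u.
  apply: (character_mul chiP); apply/funext => y.
  by rewrite supralg_mkE mul1r.
by move=> /(congr1 (fun z => z / chi u)); rewrite mulfK// divff.
Qed.

(* If [`|chi u| > B], then [u / chi u] has norm [< 1], so [1 - u / chi u] is
   invertible in [A] by the Neumann series, although [chi] kills it. *)
Lemma character_bound (u : supralg_elt A) (B : R) :
  (forall y, cabs (supralg_fun u y) <= B) -> cabs (chi u) <= B.
Proof.
move=> uB; have B0 : 0 <= B := le_trans (cabs_ge0 _) (uB 0).
rewrite leNgt; apply/negP => Bchi.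
have chi0 : 0 < cabs (chi u) by exact: le_lt_trans Bchi.
have chin0 : chi u != 0 by apply/eqP => chiu0; move: chi0; rewrite chiu0 cabs0 ltxx.
pose q := B / cabs (chi u).
have q0 : 0 <= q by rewrite divr_ge0// ltW.
have q1 : q < 1 by rewrite ltr_pdivrMr// mul1r.
pose v y := (chi u)^-1 * supralg_fun u y.
have Av : supralg_set A v by exact: (supralg_mul (supralg_cst A _) (supralg_funP u)).
have vq y : cabs (v y) <= q by rewrite cabsM cabsV mulrC ler_pM2r ?invr_gt0.
have v_lt1 y : 1 - q <= cabs (1 - v y).
  rewrite lerBlDr -(@cabs1 R); apply: le_trans (_ : cabs (1 - v y) + cabs (v y) <= _).
    by rewrite -{1}(subrK (v y) 1) ler_cabsD.
  by rewrite lerD2l.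
have q10 : 0 < 1 - q by rewrite subr_gt0.
have v_neq1 y : 1 - v y != 0.
  by apply/eqP => v1; have := v_lt1 y; rewrite v1 cabs0 leNgt q10.
pose h y := (1 - v y)^-1.
have hq y : cabs (h y) <= (1 - q)^-1.
  by rewrite cabsV lef_pV2 ?posrE// (lt_le_trans q10).
have bch : bounded_continuous h.
  split; last by exists (1 - q)^-1.
  have [cv _] := supralg_bounded_continuous Av.
  move=> y; have FFy : Filter (nbhs y) := nbhs_filter y.
  have c1v : (fun z => 1 - v z) @ y --> 1 - v y.
    apply: (@cvgB _ _ _ _ FFy); [exact: cvg_cst|exact: cv].
  exact: (cvgV (FF := FFy) (v_neq1 y) c1v).
have Apartial n : supralg_set A (fun y => \sum_(k < n) v y ^+ k).
  elim: n => [|n IH].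
    by under eq_fun do rewrite big_ord0; exact: supralg_cst.
  have Avn k : supralg_set A (fun y => v y ^+ k).
    elim: k => [|k IHk]; first by under eq_fun do rewrite expr0; exact: supralg_cst.
    by under eq_fun do rewrite exprS; exact: supralg_mul.
  by under eq_fun do rewrite big_ord_recr /=; exact: supralg_add.
have Ah : supralg_set A h.
  apply: supralg_closed => // e e0.
  have : (fun n => q ^+ n) @ \oo --> (0 : R).
    by apply: cvg_expr; rewrite ger0_norm.
  move=> /cvgrPdist_le /(_ (e * (1 - q))).
  rewrite mulr_gt0// => /(_ isT)[n _ /(_ n (leqnn n))].
  rewrite sub0r normrN ger0_norm ?exprn_ge0// => qn.
  exists (fun y => \sum_(k < n) v y ^+ k) => // y.
  (* The remainder of the geometric series, of modulus at most [q ^+ n / (1 - q)] uniformly in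
     [y]. *)
  have -> : h y - \sum_(k < n) v y ^+ k = v y ^+ n * h y.
    apply: (mulfI (v_neq1 y)); rewrite mulrBr mulfV// mulrCA mulfV// mulr1.
    by rewrite -[1 - v y]opprB mulNr -subrX1 opprK addrC subrK.
  rewrite cabsM; apply: (@le_trans _ _ (q ^+ n * (1 - q)^-1)); last by rewrite ler_pdivrMr.
  have -> : cabs (v y ^+ n) = cabs (v y) ^+ n.
    by elim: n {qn} => [|n IH]; [rewrite !expr0 cabs1|rewrite !exprS cabsM IH].
  rewrite ler_pM ?exprn_ge0 ?cabs_ge0// lerXn2r ?nnegrE ?cabs_ge0//.
have AN : supralg_set A (fun y => - v y).
  have := supralg_mul (supralg_cst A (-1)) Av.
  by under eq_fun do rewrite mulN1r.
pose w := supralg_mk (supralg_add (supralg_cst A 1) AN).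
have chiw : chi w = 0.
  rewrite (@character_add _ _ _ _ chiP supralg_one (supralg_mk AN) w)//.
  rewrite (@character_scale _ _ _ _ chiP (- (chi u)^-1) u (supralg_mk AN)).
    by rewrite character_one mulNr mulVf// subrr.
  by apply/funext => y; rewrite supralg_mkE mulNr.
have : chi supralg_one = chi w * chi (supralg_mk Ah).
  apply: (character_mul chiP); apply/funext => y.
  by rewrite !supralg_mkE mulfV// v_neq1.
by rewrite chiw mul0r character_one => /eqP; rewrite oner_eq0.
Qed.

(* Arens' trick: if [chi g = a + b i], the bound at [g + i t] forces
   [a^2 + (b + t)^2 <= B^2 + t^2] for all real [t]. *)
Lemma character_real (g : supralg_elt A) :
  (forall y, cim (supralg_fun g y) = 0) -> cim (chi g) = 0.
Proof.
move=> gr; have [B B0 gB] := supralg_fun_bounded g.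
have arens (t : R) : cre (chi g) ^+ 2 + (cim (chi g) + t) ^+ 2 <= B ^+ 2 + t ^+ 2.
  pose it : cplx R := Complex 0 t.
  pose gt := supralg_mk (supralg_add (supralg_funP g) (supralg_cst A it)).
  have chigt : chi gt = chi g + it.
    rewrite (@character_add _ _ _ _ chiP g (supralg_mk (supralg_cst A it)) gt)//.
    rewrite (@character_scale _ _ _ _ chiP it supralg_one (supralg_mk (supralg_cst A it))).
      by rewrite character_one mulr1.
    by apply/funext => y; rewrite !supralg_mkE mulr1.
  have Bt0 : 0 <= B ^+ 2 + t ^+ 2 by rewrite addr_ge0 ?sqr_ge0.
  have : cabs (chi gt) <= Num.sqrt (B ^+ 2 + t ^+ 2).
    apply: character_bound => y; rewrite -[leLHS]ger0_norm ?cabs_ge0// -sqrtr_sqr.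
    rewrite ler_wsqrtr// cabs_sqr supralg_mkE creD cimD gr /= addr0 add0r lerD2r.
    rewrite -real_normK ?num_real// lerXn2r ?nnegrE//.
    exact: le_trans (cre_le_cabs _) (gB y).
  rewrite -(ler_pXn2r (ltn0Sn 1)) ?nnegrE ?cabs_ge0 ?sqrtr_ge0// sqr_sqrtr//.
  by rewrite cabs_sqr chigt creD cimD /= addr0.
apply/eqP; apply: contraT => b0.
(* This [t] makes the cross term [2 * b * t] equal to [B ^+ 2 + 1], where [b] is the nonzero
   imaginary part; that already exceeds the allowed [B ^+ 2]. *)
have := arens ((B ^+ 2 + 1) / (2 * cim (chi g))).
have : (cim (chi g) + (B ^+ 2 + 1) / (2 * cim (chi g))) ^+ 2 =
   cim (chi g) ^+ 2 + (B ^+ 2 + 1) + ((B ^+ 2 + 1) / (2 * cim (chi g))) ^+ 2.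
  by field.
move=> ->; have := sqr_ge0 (cre (chi g)); have := sqr_ge0 (cim (chi g)).
move: (_ / _) => s; move: (cre _ ^+ 2) (cim _ ^+ 2) (s ^+ 2) (B ^+ 2) => ? ? ? ?; lra.
Qed.

End one_character.

Lemma gelfand_character (x : spectrum A) : character (\val x).
Proof. by case: x => f /= /set_mem. Qed.

Lemma gelfand_prod (u v : supralg_elt A) x :
  gelfand (supralg_prod u v) x = gelfand u x * gelfand v x.
Proof. exact: (character_mul (gelfand_character x)). Qed.

Lemma gelfand_one x : gelfand supralg_one x = 1.
Proof. exact: (character_one (gelfand_character x)). Qed.

Lemma gelfand_bound (u : supralg_elt A) B x :
  (forall y, cabs (supralg_fun u y) <= B) -> cabs (gelfand u x) <= B.
Proof. exact: (character_bound (gelfand_character x)). Qed.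

Lemma gelfand_real (g : supralg_elt A) x :
  (forall y, cim (supralg_fun g y) = 0) -> cim (gelfand g x) = 0.
Proof. exact: (character_real (gelfand_character x)). Qed.

Lemma continuous_gelfand (u : supralg_elt A) :
  continuous (fun x : spectrum A => gelfand u x).
Proof.
move=> x; apply: (@continuous_comp _ _ _ (set_val : spectrum A -> {ptws supralg_elt A -> cplx R})
  (fun f : {ptws supralg_elt A -> cplx R} => f u)).
  exact: initial_continuous.
exact: proj_continuous.
Qed.

Lemma continuous_measurable_spectrum (f : spectrum A -> R) : continuous f ->
  measurable_fun [set: spectrum_borel A] (f : spectrum_borel A -> R).
Proof.
move=> cf; apply: (measurability _ (RGenOpens.measurableE R)).
move=> _ [_ [a [b ->]] <-]; rewrite setTI; apply: sub_sigma_algebra.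
by apply: open_comp => // x _; exact: cf.
Qed.

Lemma measurable_cre_gelfand (u : supralg_elt A) :
  measurable_fun [set: spectrum_borel A] (fun x : spectrum_borel A => cre (gelfand u x)).
Proof.
apply: continuous_measurable_spectrum; apply: continuous_cre.
exact: continuous_gelfand.
Qed.

End gelfand_theory.

(** * Oscillating test functions *)

(* An alias which can carry the sigma-finite structure: [lebesgue_Rd] already
   unfolds to an outer measure. *)
Definition lebesgue_fun (d : nat) (R : realType) :
  set (lebesgueType d R) -> \bar R := lebesgue_Rd d R.

HB.instance Definition _ (d : nat) (R : realType) :=
  Measure.copy (@lebesgue_fun d R) (lebesgue_Rd d R).

HB.instance Definition _ (d : nat) (R : realType) :=
  Measure_isSigmaFinite.Build _ _ _ (@lebesgue_fun d R) (@lebesgue_Rd_sigma_finite d R).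

Definition lebesgue_sf (d : nat) (R : realType) :
  {sigma_finite_measure set (lebesgueType d R) -> \bar R} := @lebesgue_fun d R.

Lemma bounded_onT {R : realType} {dX : measure_display} {X : measurableType dX}
  (f : X -> R) B : measurable_fun setT f -> (forall x, `|f x| <= B) -> bounded_on setT f.
Proof. by move=> mf fB; split => //; [exists B|move=> x /(_ I)]. Qed.

Section product_with_probability.
Context {R : realType} {d1 d2 : measure_display}.
Context {X : measurableType d1} {Y : measurableType d2}.
Variables (m : {sigma_finite_measure set X -> \bar R}) (P : probability Y R).

Lemma Rintegral_prod_probability (f : X * Y -> R) (k : X -> R) :
  (m \x P)%E.-integrable setT (EFin \o f) ->
  (forall x, P.-integrable setT (EFin \o (fun y => f (x, y)))) ->
  (forall x, \int[P]_y f (x, y) = k x) ->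
  \int[(m \x P)%E]_z f z = \int[m]_x k x.
Proof.
move=> intf intfx fk; rewrite /Rintegral -(integral12_prod_meas1 intf); congr fine.
apply: eq_integral => x _; rewrite /fubini_F -fk /Rintegral fineK//.
by apply: integrable_fin_num => //; exact: intfx.
Qed.

Lemma product_probability_fin (D : set X) : measurable D -> (m D < +oo)%E ->
  ((m \x P)%E (D `*` setT) < +oo)%E.
Proof.
move=> mD Dfin; rewrite product_measure1E//.
by rewrite [X in (_ * X)%E](_ : _ = 1%E) ?mule1//; exact: probability_setT.
Qed.

Lemma bounded_on_integrable_probability (f : Y -> R) : bounded_on setT f ->
  P.-integrable setT (EFin \o f).
Proof.
move=> bf; apply: bounded_on_integrable bf => //.
exact: le_lt_trans (probability_le1 P measurableT) (ltry 1).
Qed.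

End product_with_probability.

Lemma cvg_sumr {R : realType} {T I : Type} (F : set_system T) {FF : Filter F}
    (r : seq I) (f : I -> T -> R) (a : I -> R) :
  (forall i, f i @ F --> a i) ->
  (fun n => \sum_(i <- r) f i n) @ F --> \sum_(i <- r) a i.
Proof.
move=> fa; elim: r => [|i r IH].
  rewrite big_nil (_ : (fun n => _) = fun=> 0); first exact: cvg_cst.
  by apply/funext => n; rewrite big_nil.
rewrite big_cons (_ : (fun n => _) = fun n => f i n + \sum_(i <- r) f i n).
  by apply: cvgD; [exact: fa|exact: IH].
by apply/funext => n; rewrite big_cons.
Qed.

Section dynamics.
Context {R : realType} {d : nat} {dO : measure_display}.
Context {Omega : measurableType dO} (mu : probability Omega R).
Variable T : 'rV[R]_d -> Omega -> Omega.
Hypothesis dsT : dynamical_system mu T.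

Lemma ds_measurable x : measurable_fun setT (T x).
Proof. by move=> _ F mF; rewrite setTI; exact: (ds_measurable_preimage dsT). Qed.

Lemma ds_joint_measurable :
  measurable_fun [set: lebesgueType d R * Omega] (fun p => T p.1 p.2).
Proof. by move=> _ F mF; rewrite setTI; exact: (ds_joint dsT mF). Qed.

Lemma ds_scaled_measurable (c : R) : 0 < c ->
  measurable_fun [set: lebesgueType d R * Omega] (fun z : lebesgueType d R * Omega => T (c *: (z.1 : 'rV[R]_d)) z.2).
Proof.
move=> c0; have -> : (fun z : lebesgueType d R * Omega => T (c *: (z.1 : 'rV[R]_d)) z.2) =
  (fun p : lebesgueType d R * Omega => T p.1 p.2) \o (fun z : lebesgueType d R * Omega => ((c *: (z.1 : 'rV[R]_d)) : lebesgueType d R, z.2)) by [].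
apply: measurableT_comp; first exact: ds_joint_measurable.
apply: measurable_fun_pair; last exact: measurable_snd.
exact: measurableT_comp (measurable_scale c0) measurable_fst.
Qed.

Lemma ds_invariant_preimage x F : measurable F -> mu (T x @^-1` F) = mu F.
Proof.
move=> mF; rewrite -(ds_invariant dsT x) ?image_preimage//.
  by apply/seteqP; split => // w _; have [g _ Tg] := ds_bijective dsT x; exists (g w).
exact: (ds_measurable_preimage dsT).
Qed.

Lemma ds_integral x (f : Omega -> R) : bounded_on setT f ->
  \int[mu]_w f (T x w) = \int[mu]_w f w.
Proof.
move=> bf; have [mf [B fB] _] := bf.
have fB' w : `|f (T x w)| <= B by exact: fB.
have bfT : bounded_on setT (fun w => f (T x w)).
  by apply: bounded_onT fB'; apply: measurableT_comp => //; exact: ds_measurable.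
rewrite /Rintegral; congr fine.
have := @integral_pushforward _ _ _ _ R (T x) (ds_measurable x) mu setT (EFin \o f).
rewrite preimage_setT => <- //.
- apply: eq_measure_integral => [|mT F mF _]; first exact: ds_measurable.
  exact: ds_invariant_preimage.
- exact/measurable_EFinP.
- exact: (bounded_on_integrable_probability mu bfT).
Qed.

End dynamics.

Section QOmega_sigma_finite.
Context {R : realType} (d : nat) {dO : measure_display}.
Context {Omega : measurableType dO} (mu : probability Omega R).

Lemma measure_QOmega_sigma_finite : sigma_finite setT (measure_QOmega d mu).
Proof.
have [F FT FP] := lebesgue_Rd_sigma_finite d R.
exists (fun k => F k `*` setT) => [|k].
  apply/esym/seteqP; split => // -[x w] _.
  by have [k _ Fx] : (\bigcup_k F k) x by [rewrite -FT|]; exists k.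
have [mF Ff] := FP k; split; first exact: measurableX.
exact: (product_probability_fin (m := lebesgue_sf d R)).
Qed.

Definition QOmega_fun : set (lebesgueType d R * Omega)%type -> \bar R :=
  measure_QOmega d mu.

HB.instance Definition _ := Measure.copy QOmega_fun (measure_QOmega d mu).

HB.instance Definition _ :=
  Measure_isSigmaFinite.Build _ _ _ QOmega_fun measure_QOmega_sigma_finite.

Definition QOmega_sf :
  {sigma_finite_measure set (lebesgueType d R * Omega)%type -> \bar R} := QOmega_fun.

End QOmega_sigma_finite.

Section triples.
Context {R : realType} {d : nat} {dO : measure_display}.
Context {Omega : measurableType dO} (mu : probability Omega R).
Variable T : 'rV[R]_d -> Omega -> Omega.
Hypothesis dsT : dynamical_system mu T.
Variable A : H_supralgebra R d.
Variable beta : probability (spectrum_borel A) R.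
Hypothesis meanA : represents_mean beta.
Variables e1 e2 : nat -> R.
Hypotheses (e1_gt0 : forall n, 0 < e1 n) (e2_gt0 : forall n, 0 < e2 n).
Hypothesis e2_cvg0 : e2 @ \oo --> (0 : R).

Local Notation Rd := (lebesgueType d R).
Local Notation lam := (lebesgue_Rd d R).
Local Notation lam' := (lebesgue_sf d R).
Local Notation X := (Rd * Omega)%type.
Local Notation Y := (X * spectrum_borel A)%type.
Local Notation m := (measure_QOmega d mu).
Local Notation m' := (measure_QOmegaDelta mu beta).

(* Real-valued products phi(x) psi(w) g(y), with phi bounded measurable instead
   of smooth, so that they may be cut off by indicators of rings. *)
Record triple := Triple {
  triple_x : Rd -> R ;
  triple_w : Omega -> R ;
  triple_y : supralg_elt A }.

(** Realness of [triple_y] makes [cre] multiplicative on these functions, and by [gelfand_real] on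
    their Gelfand transforms as well; this is what gives closure under products. *)
Record triple_on (B : set Rd) (t : triple) : Prop := {
  triple_on_x : bounded_on B (triple_x t) ;
  triple_on_w : bounded_on setT (triple_w t) ;
  triple_on_y : forall y, cim (supralg_fun (triple_y t) y) = 0 }.

Definition triple_osc (t : triple) (n : nat) (z : X) : R :=
  triple_x t z.1 * triple_w t (T ((e1 n)^-1 *: (z.1 : 'rV[R]_d)) z.2) *
  cre (supralg_fun (triple_y t) ((e2 n)^-1 *: (z.1 : 'rV[R]_d))).

Definition triple_lim (t : triple) (z : Y) : R :=
  triple_x t z.1.1 * triple_w t z.1.2 * cre (gelfand (triple_y t) z.2).

(** An arbitrary finite index type lets sums be indexed by [I + I'] and products by [I * I']. *)
Definition triple_span (B : set Rd) (F : nat -> X -> R) (G : Y -> R) : Prop :=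
  exists (I : finType) (t : I -> triple), [/\ forall i, triple_on B (t i),
    forall n z, F n z = \sum_i triple_osc (t i) n z &
    forall z, G z = \sum_i triple_lim (t i) z].

Lemma triple_spanD B F G F' G' : triple_span B F G -> triple_span B F' G' ->
  triple_span B (fun n z => F n z + F' n z) (fun z => G z + G' z).
Proof.
move=> [I [t [tB FE GE]]] [I' [t' [tB' FE' GE']]].
exists (I + I')%type, (fun s => match s with inl i => t i | inr i => t' i end); split.
- by case.
- by move=> n z; rewrite FE FE' big_sumType.
- by move=> z; rewrite GE GE' big_sumType.
Qed.

Lemma triple_spanZ B c F G : triple_span B F G ->
  triple_span B (fun n z => c * F n z) (fun z => c * G z).
Proof.
move=> [I [t [tB FE GE]]].
exists I, (fun i => Triple (fun x => c * triple_x (t i) x) (triple_w (t i)) (triple_y (t i))).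
split.
- by move=> i; have [bx bw yr] := tB i; split; [exact: bounded_onZ|exact: bw|exact: yr].
- move=> n z; rewrite FE mulr_sumr; apply: eq_bigr => i _.
  by rewrite /triple_osc/= !mulrA.
- move=> z; rewrite GE mulr_sumr; apply: eq_bigr => i _.
  by rewrite /triple_lim/= !mulrA.
Qed.

Lemma triple_spanM B F G F' G' : triple_span B F G -> triple_span B F' G' ->
  triple_span B (fun n z => F n z * F' n z) (fun z => G z * G' z).
Proof.
move=> [I [t [tB FE GE]]] [I' [t' [tB' FE' GE']]].
exists (I * I')%type, (fun p => Triple
  (fun x => triple_x (t p.1) x * triple_x (t' p.2) x)
  (fun w => triple_w (t p.1) w * triple_w (t' p.2) w)
  (supralg_prod (triple_y (t p.1)) (triple_y (t' p.2)))).
split.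
- move=> [i i']; have [bx bw yr] := tB i; have [bx' bw' yr'] := tB' i'.
  split => /=; [exact: bounded_onM|exact: bounded_onM|].
  by move=> y; rewrite cimM yr yr' mulr0 mul0r addr0.
- move=> n z; rewrite FE FE' big_distrlr pair_big; apply: eq_bigr => -[i i'] _.
  have [_ _ yr] := tB i; have [_ _ yr'] := tB' i'.
  by rewrite /triple_osc/= creM yr yr' mulr0 subr0; ring.
- move=> z; rewrite GE GE' big_distrlr pair_big; apply: eq_bigr => -[i i'] _.
  have [_ _ yr] := tB i; have [_ _ yr'] := tB' i'.
  rewrite /triple_lim/= gelfand_prod creM (gelfand_real _ yr) (gelfand_real _ yr').
  by rewrite mulr0 subr0; ring.
Qed.

Lemma triple_spanW (B : set Rd) F G : measurable B -> triple_span setT F G ->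
  triple_span B (fun n z => F n z * \1_B z.1) (fun z => G z * \1_B z.1.1).
Proof.
move=> mB [I [t [tT FE GE]]].
exists I, (fun i => Triple (fun x => triple_x (t i) x * \1_B x) (triple_w (t i)) (triple_y (t i))).
split.
- move=> i; have [[mx xB _] bw yr] := tT i; split; [|exact: bw|exact: yr].
  have [mi [C iC] i0] : bounded_on B (\1_B : Rd -> R) by exact: bounded_on_indic.
  split.
  + exact: measurable_funM.
  + by have [K xK] := xB; exists (K * C) => x; rewrite normrM ler_pM.
  + by move=> x Bx /=; rewrite i0// mulr0.
- move=> n z; rewrite FE mulr_suml; apply: eq_bigr => i _.
  by rewrite /triple_osc/=; ring.
- move=> z; rewrite GE mulr_suml; apply: eq_bigr => i _.
  by rewrite /triple_lim/=; ring.
Qed.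

Lemma triple_span_x (f : Rd -> R) K : measurable_fun setT f -> (forall x, `|f x| <= K) ->
  triple_span setT (fun _ z => f z.1) (fun z => f z.1.1).
Proof.
move=> mf fK; exists unit, (fun=> Triple f (fun=> 1) (supralg_one A)); split.
- move=> _; split => /=; [exact: bounded_onT fK| |by []].
  by apply: (bounded_onT (B := 1)) => [|w]; [exact: measurable_cst|rewrite normr1].
- by move=> n z; rewrite big_const card_unit /= addr0 /triple_osc/= !mulr1.
- by move=> z; rewrite big_const card_unit /= addr0 /triple_lim/= gelfand_one !mulr1.
Qed.

Lemma triple_span_w (f : Omega -> R) K : measurable_fun setT f -> (forall w, `|f w| <= K) ->
  triple_span setT (fun n z => f (T ((e1 n)^-1 *: (z.1 : 'rV[R]_d)) z.2)) (fun z => f z.1.2).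
Proof.
move=> mf fK; exists unit, (fun=> Triple (fun=> 1) f (supralg_one A)); split.
- move=> _; split => /=; [|exact: bounded_onT fK|by []].
  by apply: (bounded_onT (B := 1)) => [|w]; [exact: measurable_cst|rewrite normr1].
- by move=> n z; rewrite big_const card_unit /= addr0 /triple_osc/= mulr1 mul1r.
- by move=> z; rewrite big_const card_unit /= addr0 /triple_lim/= gelfand_one mulr1 mul1r.
Qed.

Lemma triple_span_y (g : supralg_elt A) : (forall y, cim (supralg_fun g y) = 0) ->
  triple_span setT (fun n z => cre (supralg_fun g ((e2 n)^-1 *: (z.1 : 'rV[R]_d))))
    (fun z => cre (gelfand g z.2)).
Proof.
move=> gr; exists unit, (fun=> Triple (fun=> 1) (fun=> 1) g); split.
- move=> _; split => //=.
    by apply: (bounded_onT (B := 1)) => [|w]; [exact: measurable_cst|rewrite normr1].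
  by apply: (bounded_onT (B := 1)) => [|w]; [exact: measurable_cst|rewrite normr1].
- by move=> n z; rewrite big_const card_unit /= addr0 /triple_osc/= !mul1r.
- by move=> z; rewrite big_const card_unit /= addr0 /triple_lim/= !mul1r.
Qed.

Section on_set.
Variable B : set Rd.
Hypotheses (mB : measurable B) (Bfin : (lam B < +oo)%E).

Let D : set X := B `*` setT.
Let D' : set Y := D `*` setT.

Let mD : measurable D. Proof. exact: measurableX. Qed.
Let mD' : measurable D'. Proof. exact: measurableX. Qed.
Let Dfin : (m D < +oo)%E. Proof. exact: (product_probability_fin (m := lam')). Qed.
Let Dfin' : (m' D' < +oo)%E.
Proof.
exact: (product_probability_fin (m := QOmega_sf d mu) beta mD Dfin).
Qed.

Lemma supralg_fun_measurable (u : supralg_elt A) (c : R) :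
  measurable_fun [set: Rd] (fun x : Rd => cre (supralg_fun u (c *: (x : 'rV[R]_d)))).
Proof.
apply: continuous_measurable_Rd; apply: continuous_cre => x.
apply: continuous_comp; first exact: scaler_continuous.
exact: supralg_fun_continuous.
Qed.

Lemma triple_osc_measurable C t n : triple_on C t ->
  measurable_fun setT (triple_osc t n).
Proof.
move=> [[mx _ _] [mw _ _] _]; apply: measurable_funM.
  apply: measurable_funM; first exact: measurableT_comp measurable_fst.
  apply: measurableT_comp => //; apply: (ds_scaled_measurable dsT).
  by rewrite invr_gt0.
exact: measurableT_comp (supralg_fun_measurable _ _) measurable_fst.
Qed.

Lemma triple_lim_measurable C t : triple_on C t -> measurable_fun setT (triple_lim t).
Proof.
move=> [[mx _ _] [mw _ _] _]; apply: measurable_funM.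
  apply: measurable_funM.
    apply: measurableT_comp => //; exact: measurableT_comp measurable_fst measurable_fst.
  apply: measurableT_comp => //; exact: measurableT_comp measurable_snd measurable_fst.
exact: measurableT_comp (measurable_cre_gelfand _) measurable_snd.
Qed.

Lemma triple_bound C t : triple_on C t -> exists2 K : R, 0 < K &
  (forall n z, `|triple_osc t n z| <= K) /\ (forall z, `|triple_lim t z| <= K).
Proof.
move=> [[_ [Bx xB] _] [_ [Bw wB] _] _].
have [By By0 yB] := supralg_fun_bounded (triple_y t).
exists (`|Bx| * `|Bw| * By + 1).
  by rewrite ltr_wpDl// mulr_ge0// mulr_ge0.
have Bx' x : `|triple_x t x| <= `|Bx| by rewrite (le_trans (xB x))// ler_norm.
have Bw' x : `|triple_w t x| <= `|Bw| by rewrite (le_trans (wB x))// ler_norm.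
split => [n z|z]; rewrite /triple_osc /triple_lim !normrM ler_wpDr// ler_pM ?mulr_ge0// ?ler_pM//.
  exact: le_trans (cre_le_cabs _) (yB _).
exact: le_trans (cre_le_cabs _) (gelfand_bound _ yB).
Qed.

Lemma triple_osc_bounded_on t n : triple_on B t -> bounded_on D (triple_osc t n).
Proof.
move=> tB; split; first exact: triple_osc_measurable tB.
  by have [K _ [oK _]] := triple_bound tB; exists K.
move=> z Dz; rewrite /triple_osc; have [[_ _ ->]] := tB; rewrite ?mul0r// => Bz.
by apply: Dz; split.
Qed.

Lemma triple_lim_bounded_on t : triple_on B t -> bounded_on D' (triple_lim t).
Proof.
move=> tB; split; first exact: triple_lim_measurable tB.
  by have [K _ [_ lK]] := triple_bound tB; exists K.
move=> z Dz; rewrite /triple_lim; have [[_ _ ->]] := tB; rewrite ?mul0r// => Bz.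
by apply: Dz; split => //; split.
Qed.

Let triple_osc_int t n : triple_on B t -> \int[m]_z triple_osc t n z =
  (\int[lam]_x (triple_x t x * cre (supralg_fun (triple_y t) ((e2 n)^-1 *: (x : 'rV[R]_d))))) *
  \int[mu]_w triple_w t w.
Proof.
move=> tB; have [bx bw _] := tB; have [_ [Bw wB] _] := bw.
have [K K0 [oK _]] := triple_bound tB.
have [By By0 yB] := supralg_fun_bounded (triple_y t).
have bxy : bounded_on B (fun x : Rd => triple_x t x *
    cre (supralg_fun (triple_y t) ((e2 n)^-1 *: (x : 'rV[R]_d)))).
  have [mx [Bx xB] x0] := bx; split.
  - apply: measurable_funM; first exact: mx.
    exact: supralg_fun_measurable.
  - exists (Bx * By) => x; rewrite normrM ler_pM//.
    exact: le_trans (cre_le_cabs _) (yB _).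
  - by move=> x Bx'; rewrite x0// mul0r.
rewrite -RintegralZr//; last exact: (bounded_on_integrable mB Bfin bxy).
apply: (Rintegral_prod_probability (m := lam')).
- exact: (bounded_on_integrable mD Dfin (triple_osc_bounded_on n tB)).
- move=> x; apply/bounded_on_integrable_probability/(bounded_onT (B := K)) => [|w].
    exact: measurable_fun_pair2 (triple_osc_measurable n tB).
  exact: oK.
move=> x; rewrite /triple_osc /=.
under eq_Rintegral do rewrite mulrAC.
rewrite RintegralZl//; first by rewrite (ds_integral dsT).
apply/bounded_on_integrable_probability/(bounded_onT (B := Bw)) => [|w]; last exact: wB.
by apply: measurableT_comp; [have [] := bw|exact: (ds_measurable dsT)].
Qed.

Let triple_lim_int t : triple_on B t -> \int[m']_z triple_lim t z =
  (\int[lam]_x triple_x t x) * (\int[mu]_w triple_w t w) *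
  \int[beta]_y cre (gelfand (triple_y t) y).
Proof.
move=> tB; have [bx bw _] := tB; have [_ [Bw wB] _] := bw.
have [K K0 [_ lK]] := triple_bound tB.
have [By By0 yB] := supralg_fun_bounded (triple_y t).
have bxw : bounded_on D (fun z : X => triple_x t z.1 * triple_w t z.2).
  have [mx [Bx xB] x0] := bx; split.
  - apply: measurable_funM; first exact: measurableT_comp measurable_fst.
    by apply: measurableT_comp measurable_snd; have [] := bw.
  - by exists (Bx * Bw) => z; rewrite normrM ler_pM.
  - by move=> z Dz; rewrite x0 ?mul0r// => Bz; apply: Dz; split.
have bg : bounded_on setT (fun y : spectrum_borel A => cre (gelfand (triple_y t) y)).
  apply: (bounded_onT (B := By)) => [|y]; first exact: measurable_cre_gelfand.
  exact: le_trans (cre_le_cabs _) (gelfand_bound _ yB).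
transitivity (\int[m]_z (triple_x t z.1 * triple_w t z.2 *
    \int[beta]_y cre (gelfand (triple_y t) y))).
  apply: (Rintegral_prod_probability (m := QOmega_sf d mu)).
  - exact: (bounded_on_integrable mD' Dfin' (triple_lim_bounded_on tB)).
  - move=> x; apply/bounded_on_integrable_probability/(bounded_onT (B := K)) => [|w].
      exact: measurable_fun_pair2 (triple_lim_measurable tB).
    exact: lK.
  move=> z; rewrite /triple_lim/= RintegralZl//.
  exact: bounded_on_integrable_probability.
rewrite RintegralZr//; last exact: (bounded_on_integrable mD Dfin bxw).
congr (_ * _); rewrite -RintegralZr//; last exact: (bounded_on_integrable mB Bfin bx).
apply: (Rintegral_prod_probability (m := lam')).
- exact: (bounded_on_integrable mD Dfin bxw).
- move=> x; have [mxw [C xwC] _] := bxw.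
  apply/bounded_on_integrable_probability/(bounded_onT (B := C)) => [|w].
    exact: measurable_fun_pair2 mxw.
  exact: (xwC (x, w)).
by move=> x /=; rewrite RintegralZl//; exact: bounded_on_integrable_probability.
Qed.

Let triple_mean t : triple_on B t ->
  (fun n => \int[m]_z triple_osc t n z) @ \oo --> \int[m']_z triple_lim t z.
Proof.
move=> tB; have [bx bw yr] := tB.
rewrite triple_lim_int// (_ : (fun n => _) = fun n =>
  (\int[lam]_x (triple_x t x * cre (supralg_fun (triple_y t) ((e2 n)^-1 *: (x : 'rV[R]_d))))) *
  \int[mu]_w triple_w t w); last by apply/funext => n; rewrite triple_osc_int.
rewrite mulrAC; apply: cvgMr_tmp.
have ix := bounded_on_integrable mB Bfin bx.
(* The factor [triple_x t] is the [L^1] weight in the weak-* convergence that defines the mean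
   value, taken at the parameter [e2 n]. *)
have cix : cintegrable lam setT (fun x => cofr (triple_x t x)).
  split; first exact: ix.
  exact: (bounded_on_integrable mB Bfin (bounded_on0 mB)).
have /cvg_cre := @meanA (triple_y t) _ cix.
have e2r : e2 @ \oo --> (0 : R)^'+.
  move=> U [r r0 rU]; have /cvgrPdist_lt/(_ _ r0) := e2_cvg0.
  by apply: filterS => n e2n; apply: rU => //=.
move=> /(cvg_comp _ _ e2r); apply: cvg_ext.
  move=> n /=; rewrite /cintegral /=; apply: eq_Rintegral => x _.
  by rewrite creM /= mulr0 subr0 mulrC.
rewrite creM /cintegral/= mulrC.
have -> : \int[lam]_x (0 : R) = 0 by rewrite Rintegral_cst// mul0r.
by rewrite mulr0 subr0.
Qed.

Lemma triple_span_mean_algebra : mean_algebra m m' D D' (triple_span B).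
Proof.
split.
- move=> F G [I [t [tB FE GE]]] n.
  rewrite (_ : F n = fun z => \sum_i triple_osc (t i) n z); last by apply/funext.
  by apply: bounded_on_sum => // i; exact: triple_osc_bounded_on.
- move=> F G [I [t [tB FE GE]]].
  have /choice[K KP] : forall i, exists K : R, 0 < K /\
      (forall n z, `|triple_osc (t i) n z| <= K).
    by move=> i; have [K K0 [oK _]] := triple_bound (tB i); exists K.
  exists (\sum_i K i + 1).
    by rewrite ltr_wpDl// sumr_ge0// => i _; have [/ltW] := KP i.
  move=> n z; rewrite FE (le_trans (ler_norm_sum _ _ _))// ler_wpDr//.
  by apply: ler_sum => i _; have [_] := KP i.
- move=> F G [I [t [tB FE GE]]].
  rewrite (_ : G = fun z => \sum_i triple_lim (t i) z); last by apply/funext.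
  by apply: bounded_on_sum => // i; exact: triple_lim_bounded_on.
- move=> F G [I [t [tB FE GE]]].
  rewrite (_ : G = fun z => \sum_i triple_lim (t i) z); last by apply/funext.
  rewrite (bounded_on_int_sum mD' Dfin'); last by move=> i; exact: triple_lim_bounded_on.
  rewrite (_ : (fun n => _) = fun n => \sum_i \int[m]_z triple_osc (t i) n z).
    by apply: cvg_sumr => i; exact: triple_mean.
  apply/funext => n; rewrite -(bounded_on_int_sum mD Dfin).
    by apply: eq_Rintegral => z _; rewrite FE.
  by move=> i; exact: triple_osc_bounded_on.
- exists unit, (fun=> Triple (\1_B : Rd -> R) (fun=> 1) (supralg_one A)); split.
  + move=> _; split => /=; [exact: bounded_on_indic| |by []].
    by apply: (bounded_onT (B := 1)) => [|w]; [exact: measurable_cst|rewrite normr1].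
  + move=> n z; rewrite big_const card_unit /= addr0 /triple_osc/= mulr1.
    rewrite mulr1 !indicE; congr (_%:R); congr nat_of_bool.
    by apply/idP/idP => /set_mem h; apply/mem_set; [case: h|split].
  + move=> z; rewrite big_const card_unit /= addr0 /triple_lim/= mulr1.
    rewrite gelfand_one mulr1 !indicE; congr (_%:R); congr nat_of_bool.
    by apply/idP/idP => /set_mem h; apply/mem_set; [case: h => -[]|split => //; split].
- exact: triple_spanD.
- exact: triple_spanZ.
- exact: triple_spanM.
Qed.

End on_set.
End triples.

Lemma sum_indic_trivIset {R : realType} {T : Type} (D : nat -> set T) (N : nat) (x : T) :
  trivIset setT D -> (\bigcup_(i < N) D i) x -> \sum_(i < N) \1_(D i) x = 1 :> R.
Proof.
move=> tD [i iN Dx]; rewrite (bigD1 (Ordinal iN))//= big1 => [|j ji].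
  by rewrite indicE mem_set// addr0.
rewrite indicE memNset// => Dj; move/eqP: ji; apply; apply: val_inj => /=.
by apply: (tD j i I I); exists x.
Qed.

Lemma sum_indic_le1 {R : realType} {T : Type} (D : nat -> set T) (N : nat) (x : T) :
  trivIset setT D -> \sum_(i < N) \1_(D i) x <= 1 :> R.
Proof.
move=> tD; have [Dx|nDx] := pselect ((\bigcup_(i < N) D i) x).
  by rewrite sum_indic_trivIset.
rewrite big1// => i _; rewrite indicE memNset// => Dx; apply: nDx; exists i => //=.
Qed.

Lemma integrable_sum_Rintegral {R : realType} {dX : measure_display} {X : measurableType dX}
    (m : {measure set X -> \bar R}) (I : Type) (r : seq I) (f : I -> X -> R) :
  (forall i, m.-integrable setT (EFin \o f i)) ->
  m.-integrable setT (EFin \o (fun x => \sum_(i <- r) f i x)) /\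
  \int[m]_x (\sum_(i <- r) f i x) = \sum_(i <- r) \int[m]_x f i x.
Proof.
move=> fi; elim: r => [|i r [IHi IHe]].
  have -> : (fun x => \sum_(i <- [::]) f i x) = fun=> 0 by apply/funext => x; rewrite big_nil.
  by split; [exact: integrable0|rewrite big_nil /Rintegral integral0].
have -> : (fun x => \sum_(j <- i :: r) f j x) = (fun x => f i x + \sum_(j <- r) f j x).
  by apply/funext => x; rewrite big_cons.
split; first by have := integrableD measurableT (fi i) IHi; apply: eq_integrable.
by rewrite RintegralD// IHe big_cons.
Qed.

(** * Weak limits *)

Section gluing.
Context {R : realType} {dX dY : measure_display}.
Context {X : measurableType dX} {Y : measurableType dY}.
Variables (m : {measure set X -> \bar R}) (m' : {measure set Y -> \bar R}).
Variables (D : nat -> set X) (D' : nat -> set Y).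
Hypotheses (mD : forall i, measurable (D i)) (mD' : forall i, measurable (D' i)).
Hypotheses (Dfin : forall i, (m (D i) < +oo)%E) (Dfin' : forall i, (m' (D' i) < +oo)%E).
Hypotheses (tD : trivIset setT D) (tD' : trivIset setT D').
Hypothesis D'T : forall y, exists i, D' i y.
Variable V : nat -> (nat -> X -> R) -> (Y -> R) -> Prop.
Hypothesis mV : forall i, mean_algebra m m' (D i) (D' i) (V i).
Variable Phi : R -> R.
Hypothesis NPhi : N_function Phi.

Let Phi0 := N_function0 NPhi.

(** A test pair lives on finitely many pieces, so its pairing with the glued function is a finite
    sum of limits already known. Only the modular involves all pieces at once, and it is controlled
    through disjointness of the [D i]. *)
Lemma superposition_glue (a : nat -> X -> R) (S : set nat) :
  (forall n, measurable_fun setT (a n)) -> (forall n x, 0 <= a n x) ->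
  (forall n, (\int[m]_x (Phi (2 * a n x))%:E <= 1)%E) -> unbounded S ->
  exists S', [/\ S' `<=` S, unbounded S' & exists w : Y -> R,
    [/\ measurable_fun setT w, forall y, 0 <= w y,
        (\int[m']_y (Phi (w y))%:E < +oo)%E &
        forall (N : nat) F G,
          (forall i, V i (fun n x => F n x * \1_(D i) x) (fun y => G y * \1_(D' i) y)) ->
          (forall n x, ~ (\bigcup_(i < N) D i) x -> F n x = 0) ->
          (forall y, ~ (\bigcup_(i < N) D' i) y -> G y = 0) ->
          [/\ forall n, m.-integrable setT (EFin \o (fun x => a n x * F n x)),
              m'.-integrable setT (EFin \o (fun y => w y * G y)) &
              (fun n => \int[m]_x (a n x * F n x)) @ within S' \oo -->
                \int[m']_y (w y * G y)]]].
Proof.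
move=> ma a0 aPhi unbS.
pose b i n x := a n x * \1_(D i) x.
have mb i n : measurable_fun setT (b i n).
  by apply: measurable_funM => //; exact: measurable_indic.
have b0 i n x : 0 <= b i n x by rewrite mulr_ge0.
have bD i n x : ~ D i x -> b i n x = 0 by move=> Dx; rewrite /b indicE memNset// mulr0.
have PhibE i n x : Phi (2 * b i n x) = Phi (2 * a n x) * \1_(D i) x.
  by rewrite /b indicE; case: (x \in D i); rewrite ?mulr1// !mulr0 Phi0.
have Phia0 n x : 0 <= Phi (2 * a n x) by apply: (N_function_ge0 NPhi); rewrite mulr_ge0.
have mPhib i n : measurable_fun setT (fun x => Phi (2 * b i n x)).
  by apply: measurable_N_function => // [|x]; [exact: measurable_funM|rewrite mulr_ge0].
have mPhia n : measurable_fun setT (fun x => Phi (2 * a n x)).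
  by apply: measurable_N_function => // [|x]; [exact: measurable_funM|rewrite mulr_ge0].
have Phib0 i n x : 0 <= Phi (2 * b i n x) by apply: (N_function_ge0 NPhi); rewrite mulr_ge0.
have bsum n N : (\sum_(i < N) \int[m]_x (Phi (2 * b i n x))%:E <= 1)%E.
  apply: le_trans (aPhi n); rewrite -ge0_integral_sum//; last first.
  - by move=> i x _; rewrite lee_fin.
  - by move=> i; exact/measurable_EFinP.
  apply: ge0_le_integral => //.
  - by move=> x _; apply: sume_ge0 => i _; rewrite lee_fin.
  - by apply: emeasurable_sum => i; exact/measurable_EFinP.
  - exact/measurable_EFinP.
  - move=> x _; rewrite sumEFin lee_fin.
    under eq_bigr do rewrite PhibE.
    by rewrite -mulr_sumr ler_piMr// sum_indic_le1.
have bPhi i n : (\int[m]_x (Phi (2 * b i n x))%:E <= 1)%E.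
  apply: le_trans (bsum n i.+1); rewrite big_ord_recr/=.
  by apply: leeDr; apply: sume_ge0 => j _; apply: integral_ge0 => x _; rewrite lee_fin.
(* The first layer of piece [i] costs [Phi (tau i) * m' (D' i)] in the modular; as [Phi] is small
   near [0], [tau i] can be chosen to make these costs sum to at most [1]. *)
have /choice[tau tauP] : forall i, exists t, 0 < t /\
    ((Phi t)%:E * m' (D' i) <= ((2 ^+ i.+1)^-1)%:E)%E.
  move=> i; set c := (2 ^+ i.+1)^-1.
  have c0 : 0 < c by rewrite invr_gt0 exprn_gt0.
  have mfin : m' (D' i) \is a fin_num by rewrite ge0_fin_numE.
  have f0 : 0 <= fine (m' (D' i)) by exact: fine_ge0.
  have K0 : 0 < fine (m' (D' i)) + 1 by rewrite ltr_wpDl.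
  have [t t0 tc] := N_function_small NPhi (divr_gt0 c0 K0).
  exists t; split => //; rewrite -(fineK mfin) -EFinM lee_fin.
  rewrite (le_trans (ler_wpM2r f0 tc))// mulrAC ler_pdivrMr//.
  by rewrite ler_pM2l// lerDl ler01.
pose P i S' := exists kappa : R,
  (fun n => \int[m]_x Phi (2 * b i n x)) @ within S' \oo --> kappa /\
  exists w : Y -> R,
    [/\ measurable_fun setT w, forall y, 0 <= w y & forall y, ~ D' i y -> w y = 0] /\
    [/\ m'.-integrable setT (EFin \o w),
        (\int[m']_y (Phi (w y))%:E <= (Phi (tau i))%:E * m' (D' i) + kappa%:E)%E &
        forall F G, V i F G ->
          (fun n => \int[m]_x (b i n x * F n x)) @ within S' \oo --> \int[m']_y (w y * G y)].
have [S' [SS' unbS' PS']] : exists S', [/\ S' `<=` S, unbounded S' & forall i, P i S'].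
  apply: diagonal_extraction unbS.
  - move=> i S2 S1 S21 [kappa [kc [w [w1 [w2 w3 w4]]]]].
    exists kappa; split; first exact: cvg_almost_sub S21 kc.
    exists w; split => //; split => // F G FG.
    by apply: cvg_almost_sub S21 _; exact: w4.
  - move=> i S1 unbS1.
    by apply: (superposition_limit (mD i) (mD' i) (Dfin i) (Dfin' i) (mV i) NPhi
      (mb i) (b0 i) (bD i) (bPhi i) (tauP i).1 unbS1).
have PF := unbounded_proper unbS'.
exists S'; split => //.
have /choice[kappa kP] := PS'.
have /choice[W WP] := fun i => (kP i).2.
have /choice[idx idxP] := D'T.
pose w y := W (idx y) y.
have wE i y : D' i y -> w y = W i y.
  by move=> Dy; rewrite /w (_ : idx y = i)//; apply: (tD' I I); exists y; split.
have D'TE : \bigcup_i D' i = setT by apply/seteqP; split => // y _; exists (idx y).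
have mw : measurable_fun setT w.
  rewrite -D'TE; apply/(measurable_fun_bigcup _ mD') => i.
  apply: (eq_measurable_fun (W i)); first by move=> y /set_mem Dy; rewrite (wE i).
  by have [[mW _ _] _] := WP i; exact: measurable_funTS.
have w0 y : 0 <= w y by have [[_ ->]] := WP (idx y).
exists w; split => //.
- rewrite -D'TE ge0_integral_bigcup//; last 2 first.
  + rewrite D'TE; apply/measurable_EFinP; exact: measurable_N_function.
  + by move=> y _; rewrite lee_fin (N_function_ge0 NPhi).
  (* One unit for the costs of the [tau i]; the other bounds the sum of the [kappa i], since by
     disjointness finite sums of the modulars of the pieces never exceed the modular of the
     whole. *)
  apply: (@le_lt_trans _ _ 2%:E); last exact: ltry.
  apply: nneseries_le_bound => [i|N].
    by apply: integral_ge0 => y _; rewrite lee_fin (N_function_ge0 NPhi).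
  apply: (@le_trans _ _ (\sum_(i < N) ((2 ^+ i.+1)^-1 + kappa i)%:E)%E).
    rewrite big_mkord; apply: lee_sum => i _; have [[mW W0 _] [_ Wk _]] := WP i.
    apply: le_trans; last first.
      by rewrite EFinD; apply: leeD (tauP i).2 (lexx _).
    apply: le_trans Wk.
    rewrite (eq_integral (fun y => (Phi (W i y))%:E)); last first.
      by move=> y /set_mem Dy; rewrite (wE i).
    apply: ge0_subset_integral => //.
      by apply/measurable_EFinP; exact: measurable_N_function.
    by move=> y _; rewrite lee_fin (N_function_ge0 NPhi).
  rewrite sumEFin lee_fin big_split/=.
  have -> : (2 : R) = 1 + 1 by [].
  apply: lerD.
    suff -> : \sum_(i < N) ((2 : R) ^+ i.+1)^-1 = 1 - (2 ^+ N)^-1.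
      by rewrite gerBl invr_ge0 exprn_ge0.
    elim: N => [|N IH]; first by rewrite big_ord0 expr0 invr1 subrr.
    rewrite big_ord_recr/= IH exprS invfM; set c := (2 ^+ N)^-1; lra.
  have ck : (fun n => \sum_(i < N) \int[m]_x Phi (2 * b i n x)) @ within S' \oo -->
      \sum_(i < N) kappa i.
    by apply: cvg_sumr => i; have [] := kP i.
  apply: (cvgr_to_le ck).
  apply: filterE => n; rewrite -lee_fin -sumEFin.
  apply: le_trans (bsum n N); apply: lee_sum => i _.
  rewrite /Rintegral fineK// ge0_fin_numE; last first.
    by apply: integral_ge0 => x _; rewrite lee_fin.
  exact: le_lt_trans (bPhi i n) (ltry _).
- move=> N F G FG F0 G0.
  have aE n x : a n x * F n x = \sum_(i < N) b i n x * (F n x * \1_(D i) x).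
    have [Dx|nDx] := pselect ((\bigcup_(i < N) D i) x).
      rewrite -[LHS]mulr1 -(sum_indic_trivIset tD Dx) mulr_sumr; apply: eq_bigr => i _.
      by rewrite /b indicE; case: (x \in D i); rewrite ?mulr1// !mulr0.
    by rewrite F0// mulr0 big1// => i _; rewrite mul0r mulr0.
  have wGE y : w y * G y = \sum_(i < N) W i y * (G y * \1_(D' i) y).
    have [Dx|nDx] := pselect ((\bigcup_(i < N) D' i) y).
      rewrite -[LHS]mulr1 -(sum_indic_trivIset tD' Dx) mulr_sumr; apply: eq_bigr => i _.
      rewrite indicE; case: (boolP (y \in D' i)) => [/set_mem/wE ->|]; rewrite ?mulr1//.
      by rewrite !mulr0.
    by rewrite G0// mulr0 big1// => i _; rewrite mul0r mulr0.
  have ib i n : m.-integrable setT (EFin \o b i n).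
    apply: (integrable_of_N_function NPhi (mD i) (Dfin i)) => //; first exact: bD.
    apply: le_lt_trans (ltry 1); apply: le_trans (bPhi i n).
    apply: ge0_le_integral => //.
    + by move=> x _; rewrite lee_fin (N_function_ge0 NPhi).
    + by apply/measurable_EFinP; exact: measurable_N_function.
    + exact/measurable_EFinP.
    + by move=> x _; rewrite lee_fin (N_function_le NPhi)// mulr_natl mulr2n lerDl.
  have iab i n : m.-integrable setT (EFin \o (fun x => b i n x * (F n x * \1_(D i) x))).
    exact: integrable_mul_bounded (ib i n) (mean_algebra_src (mV i) (FG i) n).
  have iwG i : m'.-integrable setT (EFin \o (fun y => W i y * (G y * \1_(D' i) y))).
    have [_ [iW _ _]] := WP i.
    exact: integrable_mul_bounded iW (mean_algebra_tgt (mV i) (FG i)).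
  have isa n := integrable_sum_Rintegral (index_enum 'I_N) (fun i : 'I_N => iab i n).
  have isw := integrable_sum_Rintegral (index_enum 'I_N) (fun i : 'I_N => iwG i).
  have aEf n : (fun x => a n x * F n x) =
      fun x => \sum_(i < N) b i n x * (F n x * \1_(D i) x) by apply/funext.
  have wGEf : (fun y => w y * G y) =
      fun y => \sum_(i < N) W i y * (G y * \1_(D' i) y) by apply/funext.
  split.
  + by move=> n; rewrite aEf; exact: (isa n).1.
  + by rewrite wGEf; exact: isw.1.
  + rewrite wGEf isw.2.
    rewrite (_ : (fun n => _) = fun n =>
        \sum_(i < N) \int[m]_x (b i n x * (F n x * \1_(D i) x))); last first.
      by apply/funext => n; rewrite -(isa n).2 aEf.
    by apply: cvg_sumr => i; have [_ [_ _]] := WP i; apply.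
Qed.

End gluing.

Section weak_limits.
Context {R : realType} {d : nat} {dO : measure_display}.
Context {Omega : measurableType dO} (mu : probability Omega R).
Variable T : 'rV[R]_d -> Omega -> Omega.
Hypothesis dsT : dynamical_system mu T.
Variable A : H_supralgebra R d.
Variable beta : probability (spectrum_borel A) R.
Hypothesis meanA : represents_mean beta.
Variables e1 e2 : nat -> R.
Hypotheses (e1_gt0 : forall n, 0 < e1 n) (e2_gt0 : forall n, 0 < e2 n).
Hypothesis e2_cvg0 : e2 @ \oo --> (0 : R).
Variable Phi : R -> R.
Hypothesis NPhi : N_function Phi.

Local Notation Rd := (lebesgueType d R).
Local Notation X := (Rd * Omega)%type.
Local Notation Y := (X * spectrum_borel A)%type.
Local Notation m := (measure_QOmega d mu).
Local Notation m' := (measure_QOmegaDelta mu beta).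

(** Tests vanish outside a ball, as functions in [C0oo] do, and so meet finitely many rings.
    Integrability is recorded because the real pairings are later recombined linearly into complex
    ones. *)
Record weak_limit (S : set nat) (a : nat -> X -> R) (w : Y -> R) : Prop := {
  weak_limit_measurable : measurable_fun setT w ;
  weak_limit_ge0 : forall y, 0 <= w y ;
  weak_limit_modular : (\int[m']_y (Phi (w y))%:E < +oo)%E ;
  weak_limit_pairing : forall (r : R) F G, triple_span T e1 e2 setT F G ->
    (forall n z, r <= `|z.1 : 'rV[R]_d| -> F n z = 0) ->
    (forall y : Y, r <= `|y.1.1 : 'rV[R]_d| -> G y = 0) ->
    [/\ forall n, m.-integrable setT (EFin \o (fun z => a n z * F n z)),
        m'.-integrable setT (EFin \o (fun y => w y * G y)) &
        (fun n => \int[m]_z (a n z * F n z)) @ within S \oo -->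
          \int[m']_y (w y * G y)] }.

Lemma weak_limit_sub S S' a w : almost_sub S' S ->
  weak_limit S a w -> weak_limit S' a w.
Proof.
move=> S'S [mw w0 wPhi wp]; split => // r F G FG F0 G0.
have [iF iG FGcv] := wp r F G FG F0 G0; split => //.
exact: cvg_almost_sub FGcv.
Qed.

Let ring (i : nat) : set Rd := [set x | i%:R <= `|x : 'rV[R]_d| < i.+1%:R].

Let ring_measurable i : measurable (ring i).
Proof.
have -> : ring i = setT `&` (fun x : Rd => `|x : 'rV[R]_d|) @^-1` `[i%:R, i.+1%:R[%classic.
  by apply/seteqP; split=> [x|x [_]]; rewrite /= in_itv.
have mn := @measurable_normRd d R.
exact: (mn measurableT `[i%:R, i.+1%:R[%classic (measurable_itv _)).
Qed.

Let ring_fin i : (lebesgue_Rd d R (ring i) < +oo)%E.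
Proof. by apply: (lebesgue_Rd_bounded (r := i.+1%:R)) => x /andP[]. Qed.

Let ring_inj i j x : ring i x -> ring j x -> i = j.
Proof.
move=> /andP[ix xi] /andP[jx xj]; apply/eqP; rewrite eqn_leq.
have ij : (i < j.+1)%N by rewrite -(ltr_nat R) (le_lt_trans ix xj).
have ji : (j < i.+1)%N by rewrite -(ltr_nat R) (le_lt_trans jx xi).
by apply/andP.
Qed.

Let ring_cover (x : Rd) : ring (Num.truncn `|x : 'rV[R]_d|) x.
Proof. by rewrite /ring/=; apply: truncn_itv. Qed.

Let outside (r : R) (x : Rd) : (forall i, (i < (Num.truncn r).+1)%N -> ~ ring i x) ->
  r <= `|x : 'rV[R]_d|.
Proof.
move=> nx; rewrite leNgt; apply/negP => xr.
apply: (nx (Num.truncn `|x : 'rV[R]_d|)); last exact: ring_cover.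
by rewrite ltnS; apply: le_truncn; exact: ltW.
Qed.

Lemma weak_limit_exists (a : nat -> X -> R) (S : set nat) :
  (forall n, measurable_fun setT (a n)) -> (forall n z, 0 <= a n z) ->
  (forall n, (\int[m]_z (Phi (2 * a n z))%:E <= 1)%E) -> unbounded S ->
  exists S', [/\ S' `<=` S, unbounded S' & exists w, weak_limit S' a w].
Proof.
move=> ma a0 aPhi unbS.
pose D i : set X := ring i `*` setT.
pose D' i : set Y := D i `*` setT.
have mD i : measurable (D i) by apply: measurableX => //; exact: ring_measurable.
have mD' i : measurable (D' i) by exact: measurableX.
have Dfin i : (m (D i) < +oo)%E.
  exact: (product_probability_fin (m := lebesgue_sf d R) mu (ring_measurable i) (ring_fin i)).
have Dfin' i : (m' (D' i) < +oo)%E.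
  exact: (product_probability_fin (m := QOmega_sf d mu) beta (mD i) (Dfin i)).
have tD : trivIset setT D by move=> i j _ _ [z [[zi _] [zj _]]]; exact: ring_inj zi zj.
have tD' : trivIset setT D'.
  by move=> i j _ _ [z [[[zi _] _] [[zj _] _]]]; exact: ring_inj zi zj.
have D'T y : exists i, D' i y by exists (Num.truncn `|y.1.1 : 'rV[R]_d|); split => //; split.
have mV i := triple_span_mean_algebra dsT meanA e1_gt0 e2_gt0 e2_cvg0 (ring_measurable i) (ring_fin i).
have [S' [S'S unbS' [w [mw w0 wPhi wp]]]] :=
  superposition_glue mD mD' Dfin Dfin' tD tD' D'T mV NPhi ma a0 aPhi unbS.
exists S'; split => //; exists w; split => // r F G FG F0 G0.
(* The rings of index up to the integer part of [r] cover the ball of radius [r], hence the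
   successor in the strict bound. *)
apply: (wp (Num.truncn r).+1).
- move=> i; have := triple_spanW (ring_measurable i) FG.
  congr (triple_span _ _ _ _ _ _).
    apply/funext => n; apply/funext => z; congr (_ * _); rewrite !indicE; congr (_%:R); congr nat_of_bool.
    by apply/idP/idP => /set_mem h; apply/mem_set; [split|case: h].
  apply/funext => z; congr (_ * _); rewrite !indicE; congr (_%:R); congr nat_of_bool.
  by apply/idP/idP => /set_mem h; apply/mem_set; [split => //; split|case: h => -[]].
- move=> n z nz; apply: F0; apply: outside => i ir zi; apply: nz; exists i => //.
- move=> y ny; apply: G0; apply: outside => i ir yi; apply: ny; exists i => //; split => //.
Qed.

Lemma weak_limits_exist (a : nat -> nat -> X -> R) (S : set nat) :
  (forall k n, measurable_fun setT (a k n)) -> (forall k n z, 0 <= a k n z) ->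
  (forall k n, (\int[m]_z (Phi (2 * a k n z))%:E <= 1)%E) -> unbounded S ->
  exists S', [/\ S' `<=` S, unbounded S' &
    exists w : nat -> Y -> R, forall k, weak_limit S' (a k) (w k)].
Proof.
move=> ma a0 aPhi unbS.
have [S' [S'S unbS' wP]] : exists S', [/\ S' `<=` S, unbounded S' &
    forall k, exists w, weak_limit S' (a k) w].
  apply: diagonal_extraction unbS => [k S2 S1 S21 [w wl]|k S1 unbS1].
    by exists w; exact: weak_limit_sub wl.
  exact: weak_limit_exists.
by have /choice[w wl] := wP; exists S'; split => //; exists w.
Qed.

End weak_limits.

(** * Complex-valued sequences in Orlicz spaces *)

(* The parts (re)^+, (re)^-, (im)^+, (im)^- for k = 0, 1, 2, 3. *)
Definition cplx_part {R : realType} (k : 'I_4) (z : cplx R) : R :=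
  Num.max 0 ((-1) ^+ k * (if (k < 2)%N then cre z else cim z)).

Lemma cplx_part_ge0 {R : realType} k (z : cplx R) : 0 <= cplx_part k z.
Proof. by rewrite /cplx_part le_max lexx. Qed.

Lemma cplx_part_le_cabs {R : realType} k (z : cplx R) : cplx_part k z <= cabs z.
Proof.
rewrite /cplx_part ge_max cabs_ge0/= (le_trans (ler_norm _))// normrM.
rewrite normrX normrN1 expr1n mul1r; case: ifP => _; [exact: cre_le_cabs|exact: cim_le_cabs].
Qed.

Lemma measurable_cplx_part {R : realType} {dX : measure_display} {X : measurableType dX}
  (D : set X) k (u : X -> cplx R) :
  cmeasurable_fun D u -> measurable_fun D (fun z => cplx_part k (u z)).
Proof.
move=> [mr mi]; apply: measurable_maxr; first exact: measurable_cst.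
by apply: measurable_funM; [exact: measurable_cst|case: (k < 2)%N].
Qed.

Definition cplx_of_parts {R : realType} (w : 'I_4 -> R) : cplx R :=
  Complex (w (inord 0) - w (inord 1)) (w (inord 2) - w (inord 3)).

Lemma cplx_partK {R : realType} (z : cplx R) : cplx_of_parts (fun k => cplx_part k z) = z.
Proof.
have maxB (t : R) : Num.max 0 t - Num.max 0 (- t) = t.
  have [t0|t0] := leP 0 t; first by rewrite max_l ?oppr_le0// subr0.
  by rewrite max_r ?oppr_ge0 ?ltW// sub0r opprK.
apply: cplxP; rewrite /cplx_part /=.
  rewrite !inordK//= expr0 expr1 mul1r mulN1r; exact: maxB.
rewrite !inordK//= -signr_odd/= expr0 mul1r -(signr_odd _ 3)/= expr1 mulN1r; exact: maxB.
Qed.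

Lemma measurable_cabs {R : realType} {dX : measure_display} {X : measurableType dX}
  (D : set X) (u : X -> cplx R) :
  cmeasurable_fun D u -> measurable_fun D (fun z => cabs (u z)).
Proof.
move=> [mr mi]; rewrite (_ : (fun z => _) = fun z => Num.sqrt (cre (u z) ^+ 2 + cim (u z) ^+ 2)).
  apply: measurableT_comp; first exact: continuous_measurable_fun (@sqrt_continuous R).
  by apply: measurable_funD; exact: measurable_funX.
by apply/funext => z; case: (u z).
Qed.

Section orlicz_parts.
Context {R : realType} {dX : measure_display} {X : measurableType dX}.
Variables (m : {measure set X -> \bar R}) (D : set X) (Phi : R -> R).
Hypotheses (mD : measurable D) (NPhi : N_function Phi).

(** Adding [1] makes the norm bound strict, so the infimum supplies an admissible [e] below [1 + C]
    in absolute value of [C]; the other factor [2] in the normalisation is consumed by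
    [Phi (2 * a x)]. *)
Lemma luxemburg_parts (u : X -> cplx R) (C : R) (k : 'I_4) : cmeasurable_fun D u ->
  (luxemburg m D Phi u <= C%:E)%E ->
  let a := (fun x => cplx_part k (u x) / (2 * (`|C| + 1))) \_ D in
  [/\ measurable_fun setT a, forall x, 0 <= a x &
      (\int[m]_x (Phi (2 * a x))%:E <= 1)%E].
Proof.
move=> mu uC a; have C1 : 0 < `|C| + 1 by rewrite ltr_wpDl.
have ma : measurable_fun setT a.
  apply/(measurable_restrictT _ mD)/measurable_funM; last exact: measurable_cst.
  exact: measurable_cplx_part.
have a0 x : 0 <= a x.
  by rewrite /a patchE; case: ifP => // _; rewrite divr_ge0 ?cplx_part_ge0// mulr_ge0// ltW.
have CC : (luxemburg m D Phi u < (`|C| + 1)%:E)%E.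
  by rewrite (le_lt_trans uC)// lte_fin (le_lt_trans (ler_norm _))// ltrDl.
have [_ [e [e0 e1] <-]] := ereal_inf_lt CC; rewrite lte_fin => eC.
split => //; apply: le_trans e1; rewrite /modular [leRHS]integral_mkcond.
pose b := (fun x => cabs (u x) / e) \_ D.
have mb : measurable_fun setT b.
  apply/(measurable_restrictT _ mD)/measurable_funM; last exact: measurable_cst.
  exact: measurable_cabs.
have b0 x : 0 <= b x.
  by rewrite /b patchE; case: ifP => // _; rewrite divr_ge0 ?cabs_ge0// ltW.
have -> : (fun x => (Phi (cabs (u x) / e))%:E) \_ D = fun x => (Phi (b x))%:E.
  by apply/funext => x; rewrite /b !patchE; case: ifP => // _; rewrite (N_function0 NPhi).
apply: ge0_le_integral => //.
- by move=> x _; rewrite lee_fin (N_function_ge0 NPhi)// mulr_ge0.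
- apply/measurable_EFinP/measurable_N_function => // [|x]; first exact: measurable_funM.
  by rewrite mulr_ge0.
- by apply/measurable_EFinP/measurable_N_function.
- move=> x _; rewrite lee_fin (N_function_le NPhi) ?mulr_ge0// /a /b !patchE.
  case: ifP => [_|_]; last by rewrite mulr0.
  rewrite invfM mulrCA mulVKf// ?pnatr_eq0// ler_pM ?cplx_part_ge0 ?cplx_part_le_cabs//.
  by rewrite lef_pV2 ?posrE// ltW.
Qed.

Lemma orlicz_of_parts (w : 'I_4 -> X -> R) (c : R) : 0 < c ->
  (forall k, measurable_fun setT (w k)) -> (forall k x, 0 <= w k x) ->
  (forall k, (\int[m]_x (Phi (w k x))%:E < +oo)%E) ->
  orlicz m D Phi (fun x => cplx_of_parts (fun k => c * w k x)).
Proof.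
move=> c0 mw w0 wPhi.
pose f x := cplx_of_parts (fun k => c * w k x).
have mf : cmeasurable_fun setT f.
  by split; apply: measurable_funB; exact: measurable_funM.
split; first by have [mr mi] := mf; split; exact: measurable_funTS.
(* Real and imaginary part are each at most [2 * c] times the largest [w k x], so the modulus over
   [4 * c] is at most that maximum, whose [Phi] is one term of the sum over [k]. *)
exists (4 * c); first by rewrite mulr_gt0.
have c40 : 0 < 4 * c by rewrite mulr_gt0.
have d0 x : 0 <= cabs (f x) / (4 * c) by rewrite divr_ge0 ?cabs_ge0// ltW.
have mPhi : measurable_fun setT (fun x => (Phi (cabs (f x) / (4 * c)))%:E).
  apply/measurable_EFinP/measurable_N_function => //.
  by apply: measurable_funM; [exact: measurable_cabs|exact: measurable_cst].
have mPhiw k : measurable_fun setT (fun x => (Phi (w k x))%:E).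
  by apply/measurable_EFinP/measurable_N_function.
rewrite /modular; apply: (@le_lt_trans _ _ (\sum_(k < 4) \int[m]_x (Phi (w k x))%:E)%E); last first.
  by apply: lte_sum_pinfty => k _; exact: wPhi.
rewrite -ge0_integral_sum//; last first.
  by move=> k x _; rewrite lee_fin (N_function_ge0 NPhi).
apply: (@le_trans _ _ (\int[m]_x (Phi (cabs (f x) / (4 * c)))%:E)%E).
  apply: (@ge0_subset_integral _ _ _ m D setT mD measurableT _ mPhi) => // x _.
  by rewrite lee_fin (N_function_ge0 NPhi).
apply: ge0_le_integral => //.
- by move=> x _; rewrite lee_fin (N_function_ge0 NPhi).
- exact: emeasurable_sum.
- move=> x _; rewrite sumEFin lee_fin.
  have [k kmax] : exists k : 'I_4, forall j, w j x <= w k x.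
    by exists [arg max_(k > ord0) w k x]%O; case: Order.TotalTheory.arg_maxP => // k _ kP j; exact: kP.
  rewrite (bigD1 k)// ler_wpDr//; first by apply: sumr_ge0 => j _; exact: (N_function_ge0 NPhi).
  rewrite (N_function_le NPhi)// ler_pdivrMr//.
  rewrite (le_trans (cabs_le_reim _))//.
  rewrite /f /cplx_of_parts /=.
  have B i j : `|c * w i x - c * w j x| <= 2 * (w k x * c).
    rewrite (le_trans (ler_normB _ _))// !normrM !(ger0_norm (w0 _ _)) (gtr0_norm c0).
    by rewrite mulr_natl mulr2n lerD// [c * _]mulrC ler_pM2r.
  rewrite mulrCA (_ : 4 = 2 + 2 :> R); last by rewrite -natrD.
  by rewrite mulrDl lerD.
Qed.

End orlicz_parts.

Lemma Rintegral_combination4 {R : realType} {dX : measure_display} {X : measurableType dX}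
    (m : {measure set X -> \bar R}) (c s : R) (f0 f1 f2 f3 : X -> R) :
  m.-integrable setT (EFin \o f0) -> m.-integrable setT (EFin \o f1) ->
  m.-integrable setT (EFin \o f2) -> m.-integrable setT (EFin \o f3) ->
  \int[m]_x (c * (f0 x - f1 x) + s * (f2 x - f3 x)) =
  c * (\int[m]_x f0 x - \int[m]_x f1 x) + s * (\int[m]_x f2 x - \int[m]_x f3 x).
Proof.
move=> i0 i1 i2 i3.
have iB f g : m.-integrable setT (EFin \o f) -> m.-integrable setT (EFin \o g) ->
    m.-integrable setT (EFin \o (fun x => f x - g x)).
  by move=> fi gi; have := integrableB measurableT fi gi; apply: eq_integrable.
have iZ k f : m.-integrable setT (EFin \o f) ->
    m.-integrable setT (EFin \o (fun x => k * f x)).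
  by move=> fi; have := integrableZl measurableT k fi; apply: eq_integrable.
rewrite RintegralD//; [|exact: iZ (iB _ _ i0 i1)|exact: iZ (iB _ _ i2 i3)].
rewrite RintegralZl//; last exact: iB.
rewrite RintegralZl//; last exact: iB.
by rewrite !RintegralB.
Qed.

Section complex_pairing.
Context {R : realType} {d : nat} {dO : measure_display}.
Context {Omega : measurableType dO} (mu : probability Omega R).
Variable T : 'rV[R]_d -> Omega -> Omega.
Variable A : H_supralgebra R d.
Variable beta : probability (spectrum_borel A) R.
Variables e1 e2 : nat -> R.
Variable Phi : R -> R.

Local Notation Rd := (lebesgueType d R).
Local Notation X := (Rd * Omega)%type.
Local Notation Y := (X * spectrum_borel A)%type.
Local Notation m := (measure_QOmega d mu).
Local Notation m' := (measure_QOmegaDelta mu beta).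
Local Notation tspan := (@triple_span R d dO Omega T A e1 e2 setT).

Definition cplx_span (F : nat -> X -> cplx R) (G : Y -> cplx R) : Prop :=
  tspan (fun n z => cre (F n z)) (fun y => cre (G y)) /\
  tspan (fun n z => cim (F n z)) (fun y => cim (G y)).

Lemma triple_span_eq F G F' G' : (forall n z, F n z = F' n z) ->
  (forall y, G y = G' y) -> tspan F G -> tspan F' G'.
Proof. by move=> FF GG [I [t [tT FE GE]]]; exists I, t; split => // *; rewrite -?FF -?GG. Qed.

Lemma cplx_spanD F G F' G' : cplx_span F G -> cplx_span F' G' ->
  cplx_span (fun n z => F n z + F' n z) (fun y => G y + G' y).
Proof.
move=> [Fr Fi] [Fr' Fi']; split.
  by apply: triple_span_eq (triple_spanD Fr Fr') => *; rewrite creD.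
by apply: triple_span_eq (triple_spanD Fi Fi') => *; rewrite cimD.
Qed.

Lemma cplx_spanM F G F' G' : cplx_span F G -> cplx_span F' G' ->
  cplx_span (fun n z => F n z * F' n z) (fun y => G y * G' y).
Proof.
move=> [Fr Fi] [Fr' Fi']; split.
  by apply: triple_span_eq (triple_spanD (triple_spanM Fr Fr')
    (triple_spanZ (-1) (triple_spanM Fi Fi'))) => *; rewrite creM mulN1r.
by apply: triple_span_eq (triple_spanD (triple_spanM Fr Fi') (triple_spanM Fi Fr')) => *;
  rewrite cimM.
Qed.

Lemma cplx_span_sum (I : Type) (r : seq I) (F : I -> nat -> X -> cplx R)
    (G : I -> Y -> cplx R) :
  (forall i, cplx_span (F i) (G i)) ->
  cplx_span (fun n z => \sum_(i <- r) F i n z) (fun y => \sum_(i <- r) G i y).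
Proof.
move=> FG; elim: r => [|i r IH].
  have T0 : tspan (fun _ _ => 0) (fun=> 0).
    apply: (@triple_span_x _ _ _ _ T A e1 e2 (fun=> 0) 0) => [|x]; first exact: measurable_cst.
    by rewrite normr0.
  by split; apply: triple_span_eq T0 => *; rewrite big_nil.
have [sr si] := cplx_spanD (FG i) IH.
by split; [apply: triple_span_eq sr|apply: triple_span_eq si] => *; rewrite big_cons.
Qed.

(** Stability under conjugation puts the real and imaginary parts [gr] and [gi] of [g] in [A]. Their
    Gelfand transforms are real, hence are the real and imaginary parts of the transform of [g]. *)
Lemma cplx_span_supralg (g : supralg_elt A) :
  cplx_span (fun n z => supralg_fun g ((e2 n)^-1 *: (z.1 : 'rV[R]_d)))
    (fun y => gelfand g y.2).
Proof.
have Ag := supralg_funP g; have Agc := supralg_conj Ag.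
pose c1 := supralg_cst A.
pose gr := supralg_mk (supralg_mul (c1 (cofr 2^-1)) (supralg_add Ag Agc)).
pose gi := supralg_mk (supralg_mul (c1 (Complex 0 (2^-1)))
  (supralg_add Agc (supralg_mul (c1 (-1)) Ag))).
have grE y : supralg_fun gr y = cofr (cre (supralg_fun g y)).
  rewrite supralg_mkE; case: (supralg_fun g y) => a b.
  by apply: cplxP; rewrite ?creM ?cimM ?creD ?cimD /=; lra.
have giE y : supralg_fun gi y = cofr (cim (supralg_fun g y)).
  rewrite supralg_mkE; case: (supralg_fun g y) => a b.
  by apply: cplxP; rewrite mulN1r ?creM ?cimM ?creD ?cimD ?creN ?cimN /=; lra.
have gr0 y : cim (supralg_fun gr y) = 0 by rewrite grE.
have gi0 y : cim (supralg_fun gi y) = 0 by rewrite giE.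
pose igi := supralg_mk (supralg_mul (c1 (Complex 0 1)) (supralg_funP gi)).
have gE x : gelfand g x = gelfand gr x + Complex 0 1 * gelfand gi x.
  rewrite /gelfand (@character_add _ _ _ _ (gelfand_character x) gr igi g); last first.
    apply/funext => y; rewrite /igi supralg_mkE grE giE; case: (supralg_fun g y) => a b.
    by apply: cplxP; rewrite ?creD ?cimD ?creM ?cimM /=; lra.
  by rewrite (@character_scale _ _ _ _ (gelfand_character x) (Complex 0 1) gi igi).
split.
  apply: triple_span_eq (triple_span_y T e1 e2 gr0) => [n z|y]; first by rewrite grE.
  by rewrite gE creD creM (gelfand_real _ gi0) /=; lra.
apply: triple_span_eq (triple_span_y T e1 e2 gi0) => [n z|y]; first by rewrite giE.
by rewrite gE cimD cimM (gelfand_real _ gr0) /=; lra.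
Qed.

Lemma weak_limit_cplx_pairing (S : set nat) (a : 'I_4 -> nat -> X -> R) (w : 'I_4 -> Y -> R)
    (c r : R) F G :
  unbounded S ->
  (forall k, weak_limit mu T beta e1 e2 Phi S (a k) (w k)) ->
  cplx_span F G ->
  (forall n z, r <= `|z.1 : 'rV[R]_d| -> F n z = 0) ->
  (forall y : Y, r <= `|y.1.1 : 'rV[R]_d| -> G y = 0) ->
  (fun n => cintegral m setT
    (fun z => cplx_of_parts (fun k => c * a k n z) * F n z)) @ within S \oo -->
  cintegral m' setT (fun y => cplx_of_parts (fun k => c * w k y) * G y).
Proof.
move=> unbS awl [Fr Fi] F0 G0.
have PF := unbounded_proper unbS.
have pr k := weak_limit_pairing (awl k) Fr
  (fun n z rz => congr1 (@cre R) (F0 n z rz)) (fun y ry => congr1 (@cre R) (G0 y ry)).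
have pim k := weak_limit_pairing (awl k) Fi
  (fun n z rz => congr1 (@cim R) (F0 n z rz)) (fun y ry => congr1 (@cim R) (G0 y ry)).
apply: cvg_cplx; rewrite /cintegral /=.
- have -> : \int[m']_y cre (cplx_of_parts (fun k => c * w k y) * G y) =
    c * (\int[m']_y (w (inord 0) y * cre (G y)) - \int[m']_y (w (inord 1) y * cre (G y))) +
    - c * (\int[m']_y (w (inord 2) y * cim (G y)) - \int[m']_y (w (inord 3) y * cim (G y))).
    rewrite -Rintegral_combination4; last 4 first.
    + by have [] := pr (inord 0).
    + by have [] := pr (inord 1).
    + by have [] := pim (inord 2).
    + by have [] := pim (inord 3).
    by apply: eq_Rintegral => y _; rewrite creM /=; ring.
  rewrite (_ : (fun n => _) = fun n =>
    c * (\int[m]_z (a (inord 0) n z * cre (F n z)) - \int[m]_z (a (inord 1) n z * cre (F n z))) +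
    - c * (\int[m]_z (a (inord 2) n z * cim (F n z)) - \int[m]_z (a (inord 3) n z * cim (F n z))));
    last first.
    apply/funext => n; rewrite -Rintegral_combination4; last 4 first.
    + by have [] := pr (inord 0).
    + by have [] := pr (inord 1).
    + by have [] := pim (inord 2).
    + by have [] := pim (inord 3).
    by apply: eq_Rintegral => y _; rewrite creM /=; ring.
  by apply: cvgD; apply: cvgMl_tmp; apply: cvgB;
    [have [] := pr (inord 0)|have [] := pr (inord 1)|have [] := pim (inord 2)|
     have [] := pim (inord 3)].
- have -> : \int[m']_y cim (cplx_of_parts (fun k => c * w k y) * G y) =
    c * (\int[m']_y (w (inord 0) y * cim (G y)) - \int[m']_y (w (inord 1) y * cim (G y))) +
    c * (\int[m']_y (w (inord 2) y * cre (G y)) - \int[m']_y (w (inord 3) y * cre (G y))).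
    rewrite -Rintegral_combination4; last 4 first.
    + by have [] := pim (inord 0).
    + by have [] := pim (inord 1).
    + by have [] := pr (inord 2).
    + by have [] := pr (inord 3).
    by apply: eq_Rintegral => y _; rewrite cimM /=; ring.
  rewrite (_ : (fun n => _) = fun n =>
    c * (\int[m]_z (a (inord 0) n z * cim (F n z)) - \int[m]_z (a (inord 1) n z * cim (F n z))) +
    c * (\int[m]_z (a (inord 2) n z * cre (F n z)) - \int[m]_z (a (inord 3) n z * cre (F n z))));
    last first.
    apply/funext => n; rewrite -Rintegral_combination4; last 4 first.
    + by have [] := pim (inord 0).
    + by have [] := pim (inord 1).
    + by have [] := pr (inord 2).
    + by have [] := pr (inord 3).
    by apply: eq_Rintegral => y _; rewrite cimM /=; ring.
  by apply: cvgD; apply: cvgMl_tmp; apply: cvgB;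
    [have [] := pim (inord 0)|have [] := pim (inord 1)|have [] := pr (inord 2)|
     have [] := pr (inord 3)].
Qed.

End complex_pairing.

Lemma unbounded_enum (S : set nat) : unbounded S ->
  exists s : nat -> nat, {homo s : i j / (i < j)%N} /\ forall k, S (s k).
Proof.
move=> unbS; have /choice[nx nxP] : forall N, exists n, (N <= n)%N /\ S n.
  by move=> N; have [n Nn Sn] := unbS N; exists n.
exists (fix s k := if k is k'.+1 then nx (s k').+1 else nx 0%N); split.
  apply: homo_ltn => [y x z xy yz|k]; first exact: ltn_trans xy yz.
  exact: (nxP _).1.
by case=> [|k]; exact: (nxP _).2.
Qed.

Lemma cvg_enum {T : topologicalType} (f : nat -> T) (l : T) (S : set nat) (s : nat -> nat) :
  {homo s : i j / (i < j)%N} -> (forall k, S (s k)) ->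
  f @ within S \oo --> l -> (f \o s) @ \oo --> l.
Proof.
move=> sh Ss fl; apply: cvg_comp fl => U [N _ NU]; exists N => // k Nk.
apply: NU (Ss k) => /=; apply: leq_trans Nk _.
by elim: k => // k IH; apply: leq_ltn_trans IH (sh _ _ (ltnSn k)).
Qed.

Section complex_measurability.
Context {R : realType} {dX : measure_display} {X : measurableType dX}.

Lemma cmeasurable_funM (D : set X) (f g : X -> cplx R) :
  cmeasurable_fun D f -> cmeasurable_fun D g -> cmeasurable_fun D (fun x => f x * g x).
Proof.
move=> [fr fi] [gr gi]; split.
  under eq_fun do rewrite creM; by apply: measurable_funB; exact: measurable_funM.
by under eq_fun do rewrite cimM; apply: measurable_funD; exact: measurable_funM.
Qed.

Lemma cmeasurable_sum (D : set X) (I : Type) (r : seq I) (f : I -> X -> cplx R) :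
  (forall i, cmeasurable_fun D (f i)) -> cmeasurable_fun D (fun x => \sum_(i <- r) f i x).
Proof.
move=> mf; elim: r => [|i r [IHr IHi]].
  by split; under eq_fun do rewrite big_nil; exact: measurable_cst.
have [fr fi] := mf i.
split; under eq_fun do rewrite big_cons.
  under eq_fun do rewrite creD; exact: measurable_funD.
under eq_fun do rewrite cimD; exact: measurable_funD.
Qed.

Lemma cmeasurable_comp {dZ : measure_display} {Z : measurableType dZ}
    (f : X -> cplx R) (h : Z -> X) : cmeasurable_fun setT f ->
  measurable_fun setT h -> cmeasurable_fun setT (fun z => f (h z)).
Proof.
by move=> [fr fi] mh; split;
  [exact: measurableT_comp fr mh|exact: measurableT_comp fi mh].
Qed.

Variable m : {measure set X -> \bar R}.

Lemma eq_cintegral (D : set X) (f g : X -> cplx R) :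
  {in D, f =1 g} -> cintegral m D f = cintegral m D g.
Proof. by move=> fg; congr Complex; apply: eq_Rintegral => x Dx; rewrite fg. Qed.

Lemma cintegral_setT (D : set X) (f : X -> cplx R) : (forall x, ~ D x -> f x = 0) ->
  cintegral m D f = cintegral m setT f.
Proof.
move=> f0; rewrite /cintegral; congr Complex; rewrite Rintegral_mkcond; apply: eq_Rintegral => x _;
  by rewrite patchE; case: ifPn => // /negP xD; rewrite f0// => Dx; apply: xD; exact/mem_set.
Qed.

Lemma ae_eq_cintegral (N : set X) (f g : X -> cplx R) :
  measurable N -> m N = 0%E -> cmeasurable_fun setT f -> cmeasurable_fun setT g ->
  (forall x, ~ N x -> f x = g x) -> cintegral m setT f = cintegral m setT g.
Proof.
move=> mN N0 [fr fi] [gr gi] fg; rewrite /cintegral /Rintegral; congr Complex; congr fine.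
  apply: ae_eq_integral => //; [exact/measurable_EFinP|exact/measurable_EFinP|].
  exists N; split => // x /= fgx; apply: contrapT => Nx; apply: fgx => _; by rewrite fg.
apply: ae_eq_integral => //; [exact/measurable_EFinP|exact/measurable_EFinP|].
exists N; split => // x /= fgx; apply: contrapT => Nx; apply: fgx => _; by rewrite fg.
Qed.

End complex_measurability.

(** * From test functions to bounded real products *)

Lemma continuous_bounded_compact {R : realType} (d : nat) (f : 'rV[R]_d -> R) (K : set 'rV[R]_d) :
  continuous f -> compact K -> exists C : R, forall x, K x -> `|f x| <= C.
Proof.
move=> cf cK.
have /(@compact_bounded R R^o)[M [_ MP]] : compact (f @` K).
  by apply: continuous_compact cK; exact: continuous_subspaceT.
exists (M + 1) => x Kx; apply: (MP (M + 1)); first by rewrite ltrDl.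
by exists x.
Qed.

Lemma C0oo_bounded {R : realType} (d : nat) (Q : set 'rV[R]_d) (phi : 'rV[R]_d -> cplx R) :
  C0oo Q phi -> [/\ cmeasurable_fun [set: lebesgueType d R] phi,
    exists C : R, forall x, cabs (phi x) <= C,
    exists r : R, forall x, r <= `|x| -> phi x = 0 &
    forall x, ~ Q x -> phi x = 0].
Proof.
move=> [/(_ [::])[/= cr _] /(_ [::])[/= ci _] [K [cK KQ K0]]].
have [Cr CrP] := continuous_bounded_compact cr cK.
have [Ci CiP] := continuous_bounded_compact ci cK.
split.
- by split; exact: continuous_measurable_Rd.
- exists (`|Cr| + `|Ci|) => x; have [Kx|nKx] := pselect (K x).
    apply: le_trans (cabs_le_reim _) _; apply: lerD.
      exact: le_trans (CrP x Kx) (ler_norm _).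
    exact: le_trans (CiP x Kx) (ler_norm _).
  by rewrite K0// cabs0 addr_ge0.
- have [M [_ MP]] := compact_bounded cK.
  (* Points of [K] have norm at most [M + 1], so the radius [M + 2] excludes them strictly. *)
  exists (M + 2) => x Mx; apply: K0 => Kx.
  have := MP (M + 1); rewrite ltrDl => /(_ ltr01 x Kx) /=.
  rewrite leNgt => /negP; apply; apply: lt_le_trans Mx.
  by rewrite ltrD2l ltr1n.
- by move=> x Qx; apply: K0 => /KQ.
Qed.

(** Elements of [Loo] are genuine functions bounded only almost everywhere; one null set is made to
    serve the whole finite family. *)
Lemma Loo_family {R : realType} {dO : measure_display} {Omega : measurableType dO}
    (mu : probability Omega R) (n : nat) (psi : 'I_n -> Omega -> cplx R) :
  (forall i, Loo mu (psi i)) ->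
  exists (B : set Omega) (K : 'I_n -> R), [/\ measurable B, mu B = 0%E &
    forall i w, ~ B w -> cabs (psi i w) <= K i].
Proof.
move=> psiL.
have /choice[K KP] i : exists K : R, \forall w \ae mu, cabs (psi i w) <= K.
  by have [_ /ess_supr_bounded] := psiL i.
have [B [mB B0 BP]] : \forall w \ae mu, forall i, cabs (psi i w) <= K i.
  exact: filter_forall.
exists B, K; split => // i w nB; apply: contrapT => psiK; apply: nB.
by apply: BP => /(_ i).
Qed.

(** A test function is prescribed only through its values, not as a combination inside [A]; peeling
    off one term at a time exhibits the partial remainders as elements of [A], where characters are
    additive. *)
Lemma gelfand_sum {R : realType} (d : nat) (A : H_supralgebra R d) (I : Type) (r : seq I)
    (c : I -> cplx R) (g : I -> supralg_elt A) (u : supralg_elt A) (x : spectrum A) :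
  (forall y, supralg_fun u y = \sum_(i <- r) c i * supralg_fun (g i) y) ->
  gelfand u x = \sum_(i <- r) c i * gelfand (g i) x.
Proof.
have chi := gelfand_character x.
elim: r u => [|i r IH] u uE.
  rewrite big_nil /gelfand (@character_scale _ _ _ _ chi 0 (supralg_one A) u) ?mul0r//.
  by apply/funext => y; rewrite uE big_nil mul0r.
have Av : supralg_set A (fun y => supralg_fun u y + - c i * supralg_fun (g i) y).
  apply: supralg_add (supralg_funP u) _.
  exact: supralg_mul (supralg_cst A _) (supralg_funP (g i)).
have Aw : supralg_set A (fun y => c i * supralg_fun (g i) y).
  exact: supralg_mul (supralg_cst A _) (supralg_funP (g i)).
rewrite big_cons -(IH (supralg_mk Av)); last first.
  by move=> y; rewrite supralg_mkE uE big_cons mulNr addrAC subrr add0r.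
rewrite /gelfand (@character_add _ _ _ _ chi (supralg_mk Aw) (supralg_mk Av) u); last first.
  by apply/funext => y; rewrite !supralg_mkE mulNr addrC subrK.
by rewrite (@character_scale _ _ _ _ chi (c i) (g i) (supralg_mk Aw)).
Qed.

Section null_sets.
Context {R : realType} {d : nat} {dO : measure_display}.
Context {Omega : measurableType dO} (mu : probability Omega R).
Variable T : 'rV[R]_d -> Omega -> Omega.
Hypothesis dsT : dynamical_system mu T.

Local Notation Rd := (lebesgueType d R).
Local Notation X := (Rd * Omega)%type.
Local Notation m := (measure_QOmega d mu).

Variable B : set Omega.
Hypotheses (mB : measurable B) (B0 : mu B = 0%E).

Lemma ds_null_orbit (c : R) : 0 < c ->
  measurable [set z : X | B (T (c *: (z.1 : 'rV[R]_d)) z.2)] /\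
  m [set z : X | B (T (c *: (z.1 : 'rV[R]_d)) z.2)] = 0%E.
Proof.
move=> c0; split.
  have := ds_scaled_measurable dsT c0 measurableT mB; rewrite setTI; exact.
set N := [set z | _].
have -> : m N = (\int[lebesgue_Rd d R]_x mu (xsection N x))%E by [].
apply: integral0_eq => x _; rewrite -B0 -(ds_invariant_preimage dsT (c *: (x : 'rV[R]_d)) mB); congr (mu _).
by apply/seteqP; split => w; rewrite /xsection /=; [move/set_mem|move=> Bw; exact/mem_set].
Qed.

Lemma null_cylinder (A : H_supralgebra R d) (beta : probability (spectrum_borel A) R) :
  measurable [set y : X * spectrum_borel A | B y.1.2] /\
  measure_QOmegaDelta mu beta [set y : X * spectrum_borel A | B y.1.2] = 0%E.
Proof.
have -> : [set y : X * spectrum_borel A | B y.1.2] = ([set: Rd] `*` B) `*` setT.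
  by apply/seteqP; split => y //= [[]].
have mTB : measurable ([set: Rd] `*` B) by exact: measurableX.
split; first exact: measurableX.
apply: (eq_trans (product_measure1E (QOmega_sf d mu) beta mTB measurableT)).
rewrite [X in (X * _)%E](_ : _ = 0%E) ?mul0e//.
apply: (eq_trans (product_measure1E (lebesgue_sf d R) mu measurableT mB)).
by rewrite [X in (_ * X)%E](_ : _ = 0%E) ?mule0.
Qed.

End null_sets.

Section test_functions.
Context {R : realType} {d : nat} {dO : measure_display}.
Context {Omega : measurableType dO} (mu : probability Omega R).
Variable T : 'rV[R]_d -> Omega -> Omega.
Hypothesis dsT : dynamical_system mu T.
Variables (A : H_supralgebra R d) (beta : probability (spectrum_borel A) R).
Variables (Q : set 'rV[R]_d) (eps1 eps2 : R -> R) (E : nat -> R).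
Let e1 n := eps1 (E n).
Let e2 n := eps2 (E n).
Hypotheses (e1_gt0 : forall n, 0 < e1 n) (e2_gt0 : forall n, 0 < e2 n).

Local Notation Rd := (lebesgueType d R).
Local Notation X := (Rd * Omega)%type.
Local Notation Y := (X * spectrum_borel A)%type.
Local Notation m := (measure_QOmega d mu).
Local Notation m' := (measure_QOmegaDelta mu beta).

Variable f : 'rV[R]_d -> Omega -> supralg_elt A.
Hypothesis ft : test_function Q mu T f.

Let gel (y : Y) : cplx R := gelfand (f y.1.1 y.1.2) y.2.

(** The pair [F], [G] consists of everywhere bounded representatives, as the algebra of real
    products requires; they differ from the oscillating test function and its Gelfand transform on
    null sets only. Vanishing off [Q] is stated for the originals, to extend integrals over [Q] to
    the whole space. *)
Lemma test_function_span : exists (F : nat -> X -> cplx R) (G : Y -> cplx R) (r : R),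
  [/\ cplx_span T e1 e2 F G,
      forall n z, r <= `|z.1 : 'rV[R]_d| -> F n z = 0,
      forall y : Y, r <= `|y.1.1 : 'rV[R]_d| -> G y = 0,
      (forall n z, ~ Q z.1 -> oscillate T eps1 eps2 f (E n) z = 0) /\
      (forall y, ~ Q y.1.1 -> gel y = 0) &
      (forall n (p : X -> cplx R), cmeasurable_fun setT p ->
        cintegral m setT (fun z => p z * oscillate T eps1 eps2 f (E n) z) =
        cintegral m setT (fun z => p z * F n z)) /\
      (forall p : Y -> cplx R, cmeasurable_fun setT p ->
        cintegral m' setT (fun y => p y * gel y) =
        cintegral m' setT (fun y => p y * G y))].
Proof.
have [k [phi [psi [g [phiC psiC fE]]]]] := ft.
have psiL i : Loo mu (psi i).
  by have [D [D0 DL _]] := psiC i; rewrite -D0.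
have [B [K [mB B0 BK]]] := Loo_family psiL.
have mpsi i : cmeasurable_fun setT (psi i) by have [] := psiL i.
(* [psi] is bounded only off the null set B, but the orbit maps enter B only
   on a null set because mu is invariant. *)
pose psi' i w : cplx R := cofr (\1_(~` B) w) * psi i w.
have mpsi' i : cmeasurable_fun setT (psi' i).
  apply: cmeasurable_funM (mpsi i); split => /=; last exact: measurable_cst.
  by apply: measurable_indic; exact: measurableC.
have psi'K i w : cabs (psi' i w) <= `|K i|.
  rewrite /psi' indicE; case: (boolP (w \in ~` B)) => [/set_mem nB|_].
    by rewrite (_ : cofr _ = 1)// mul1r (le_trans (BK i w nB))// ler_norm.
  by rewrite (_ : cofr _ = 0)// mul0r cabs0.
have psi'E i w : ~ B w -> psi' i w = psi i w.
  by move=> nB; rewrite /psi' indicE mem_set// (_ : cofr _ = 1)// mul1r.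
pose H (q : 'I_k -> Omega -> cplx R) n (z : X) : cplx R := \sum_(i < k)
  phi i z.1 * q i (T ((e1 n)^-1 *: (z.1 : 'rV[R]_d)) z.2) *
  supralg_fun (g i) ((e2 n)^-1 *: (z.1 : 'rV[R]_d)).
pose L (q : 'I_k -> Omega -> cplx R) (y : Y) : cplx R := \sum_(i < k)
  phi i y.1.1 * q i y.1.2 * gelfand (g i) y.2.
have oscE n z : oscillate T eps1 eps2 f (E n) z = H psi n z.
  by rewrite /oscillate fE.
have gelE y : gel y = L psi y by rewrite /gel (gelfand_sum _ (fE _ _)).
have phi0 i x : ~ Q x -> phi i x = 0 by have [_ _ _] := C0oo_bounded (phiC i); apply.
have [r rP] : exists r : R, forall i x, r <= `|x| -> phi i x = 0.
  have /choice[r rP] i : exists r : R, forall x, r <= `|x| -> phi i x = 0.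
    by have [_ _ ? _] := C0oo_bounded (phiC i).
  exists (\sum_i `|r i|) => i x rx; apply: rP; apply: le_trans rx.
  rewrite (bigD1 i)//= (le_trans (ler_norm _))// lerDl; apply: sumr_ge0 => *.
  exact: normr_ge0.
have mphi i : cmeasurable_fun [set: Rd] (phi i) by have [] := C0oo_bounded (phiC i).
have ms c : 0 < c -> forall i, cmeasurable_fun setT (fun z : X => supralg_fun (g i) (c *: (z.1 : 'rV[R]_d))).
  move=> c0 i; have cs : continuous (fun x : 'rV[R]_d => supralg_fun (g i) (c *: x)).
    move=> x; apply: continuous_comp; first exact: scaler_continuous.
    exact: supralg_fun_continuous.
  apply: (cmeasurable_comp (f := fun x : Rd => supralg_fun (g i) (c *: (x : 'rV[R]_d)))) measurable_fst.
  by split; apply: continuous_measurable_Rd; [exact: continuous_cre|exact: continuous_cim].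
have mH q n : (forall i, cmeasurable_fun setT (q i)) -> cmeasurable_fun setT (H q n).
  move=> mq; apply: cmeasurable_sum => i; apply: cmeasurable_funM; last first.
    by apply: ms; rewrite invr_gt0.
  apply: cmeasurable_funM; first exact: cmeasurable_comp (mphi i) measurable_fst.
  apply: (cmeasurable_comp (h := fun z : X => T ((e1 n)^-1 *: (z.1 : 'rV[R]_d)) z.2) (mq i)).
  by apply: (ds_scaled_measurable dsT); rewrite invr_gt0.
have spanL i : cplx_span T e1 e2
    (fun n (z : X) => supralg_fun (g i) ((e2 n)^-1 *: (z.1 : 'rV[R]_d)))
    (fun y : Y => gelfand (g i) y.2) by exact: cplx_span_supralg.
have mg i : cmeasurable_fun setT (fun y : Y => gelfand (g i) y.2).
  apply: cmeasurable_comp measurable_snd; split; first exact: measurable_cre_gelfand.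
  by apply: continuous_measurable_spectrum; apply: continuous_cim; exact: continuous_gelfand.
have mL q : (forall i, cmeasurable_fun setT (q i)) -> cmeasurable_fun setT (L q).
  move=> mq; apply: cmeasurable_sum => i; apply: cmeasurable_funM (mg i).
  apply: cmeasurable_funM.
    by apply: cmeasurable_comp (mphi i) _; exact: measurableT_comp measurable_fst measurable_fst.
  by apply: cmeasurable_comp (mq i) _; exact: measurableT_comp measurable_snd measurable_fst.
exists (H psi'), (L psi'), r; split.
- apply: cplx_span_sum => i; apply: cplx_spanM (spanL i); apply: cplx_spanM.
    have [[mr mi] [C CP] _ _] := C0oo_bounded (phiC i).
    split.
      apply: (triple_span_x T A e1 e2 mr (K := C)) => x.
      exact: le_trans (cre_le_cabs _) (CP x).
    apply: (triple_span_x T A e1 e2 mi (K := C)) => x.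
    exact: le_trans (cim_le_cabs _) (CP x).
  have [mr mi] := mpsi' i; split.
    apply: (triple_span_w T A e1 e2 mr (K := `|K i|)) => w.
    exact: le_trans (cre_le_cabs _) (psi'K i w).
  apply: (triple_span_w T A e1 e2 mi (K := `|K i|)) => w.
  exact: le_trans (cim_le_cabs _) (psi'K i w).
- by move=> n z rz; apply: big1 => i _; rewrite rP// !mul0r.
- by move=> y ry; apply: big1 => i _; rewrite rP// !mul0r.
- split=> [n z Qz|y Qy]; first by rewrite oscE; apply: big1 => i _; rewrite phi0// !mul0r.
  by rewrite gelE; apply: big1 => i _; rewrite phi0// !mul0r.
- split=> [n p mp|p mp].
    have e1i : 0 < (e1 n)^-1 by rewrite invr_gt0.
    have [mN N0] := ds_null_orbit dsT mB B0 e1i.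
    have -> : oscillate T eps1 eps2 f (E n) = H psi n by apply/funext.
    apply: (ae_eq_cintegral mN N0).
    - by apply: cmeasurable_funM mp _; exact: mH.
    - by apply: cmeasurable_funM mp _; exact: mH.
    - move=> z nB; congr (_ * _); apply: eq_bigr => i _.
      by rewrite psi'E.
  have [mN N0] := null_cylinder mB B0 beta.
  have -> : gel = L psi by apply/funext.
  apply: (ae_eq_cintegral mN N0).
  - by apply: cmeasurable_funM mp _; exact: mL.
  - by apply: cmeasurable_funM mp _; exact: mL.
  - move=> y nB; congr (_ * _); apply: eq_bigr => i _.
    by rewrite psi'E.
Qed.

End test_functions.

Theorem theorem1p1 (R : realType) (d : nat) (Q : set 'rV[R]_d)
  (dO : measure_display) (Omega : measurableType dO)
  (mu : probability Omega R) (T : 'rV[R]_d -> Omega -> Omega)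
  (Phi : R -> R) (A : H_supralgebra R d)
  (beta : probability (spectrum_borel A) R)
  (eps1 eps2 : R -> R) (E : nat -> R)
  (u : nat -> lebesgueType d R * Omega -> cplx R) :
  open Q ->
  dynamical_system mu T ->
  N_function Phi -> Delta2 Phi -> Nabla2 Phi ->
  radon beta -> represents_mean beta ->
  scales d eps1 eps2 ->
  fundamental_sequence E ->
  orlicz_bounded (measure_QOmega d mu) (QOmega Q Omega) Phi u ->
  exists s : nat -> nat, {homo s : m n / (m < n)%N} /\
    exists u0 : lebesgueType d R * Omega * spectrum_borel A -> cplx R,
      weakly_sigma_cvg Q mu T Phi beta eps1 eps2 (E \o s) (u \o s) u0.
Proof.
move=> openQ dsT NPhi _ _ _ meanA sc [E01 E0] [uO [C uC]].
pose e1 n := eps1 (E n); pose e2 n := eps2 (E n).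
have En0 n : 0 < E n by have /andP[] := E01 n.
have e1_gt0 n : 0 < e1 n by have [] := scales_gt0 sc (En0 n).
have e2_gt0 n : 0 < e2 n by have [] := scales_gt0 sc (En0 n).
have e2_cvg0 : e2 @ \oo --> (0 : R).
  have Er : E @ \oo --> (0 : R)^'+.
    move=> U [r r0 rU]; have /cvgrPdist_lt/(_ _ r0) := E0.
    by apply: filterS => n En; apply: rU.
  exact: cvg_comp Er (scales_cvg2 sc).
have mQ : measurable (Q : set (lebesgueType d R)) by exact: open_measurable_Rd.
have mD : measurable (QOmega Q Omega) by exact: measurableX.
have mD' : measurable (QOmegaDelta Q (Omega := Omega) (A := A)) by exact: measurableX.
(* The normalisation of [luxemburg_parts]; it is multiplied back in [u0] and [p]. *)
pose c := 2 * (`|C| + 1).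
have c0 : 0 < c by rewrite mulr_gt0// ltr_wpDl.
pose a k n := (fun z => cplx_part k (u n z) / c) \_ (QOmega Q Omega).
have aP k n := luxemburg_parts mD NPhi k (uO n).1 (uC n).
(* The diagonal extraction is indexed by natural numbers, so the four parts are extended to all [k]
   through [inord]. *)
have [S [_ unbS [w wP]]] := @weak_limits_exist R d dO Omega mu T dsT A beta meanA e1 e2
  e1_gt0 e2_gt0 e2_cvg0 Phi NPhi (fun k => a (inord k)) setT
  (fun k n => let: And3 x _ _ := aP (inord k) n in x)
  (fun k n => let: And3 _ x _ := aP (inord k) n in x)
  (fun k n => let: And3 _ _ x := aP (inord k) n in x)
  (fun N => ex_intro2 _ _ N (leqnn N) I).
have [s [s_homo Ss]] := unbounded_enum unbS.
have wl (k : 'I_4) : weak_limit mu T beta e1 e2 Phi S (a k) (w k).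
  by have := wP k; rewrite inord_val.
pose u0 y := cplx_of_parts (fun k : 'I_4 => c * w k y).
pose p n z := cplx_of_parts (fun k => c * a k n z).
have mp n : cmeasurable_fun setT (p n).
  have ma k : measurable_fun setT (a k n) by have [] := aP k n.
  by split; apply: measurable_funB; exact: measurable_funM.
have mu0 : cmeasurable_fun setT u0.
  have mw (k : 'I_4) : measurable_fun setT (w k) by exact: weak_limit_measurable (wl k).
  by split; apply: measurable_funB; exact: measurable_funM.
(* Each [u n] is known to be measurable only on [Q]; [p n] is its extension by zero, measurable
   everywhere. *)
have pE n z : Q z.1 -> p n z = u n z.
  move=> Qz; rewrite /p -[RHS]cplx_partK; congr cplx_of_parts; apply/funext => k.
  by rewrite /a patchE mem_set// mulrC divfK// gt_eqF.
exists s; split => //; exists u0; split.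
- by split; [move=> n; exact: uO|exists C => n; exact: uC].
- apply: orlicz_of_parts => // k.
  + exact: weak_limit_measurable (wl k).
  + exact: weak_limit_ge0 (wl k).
  + exact: weak_limit_modular (wl k).
(* Pairings over [Q] become pairings over the whole space, with [u n] replaced by [p n] and the test
   function by [F] and [G], where the convergence is known along [S]. *)
move=> f /(test_function_span dsT beta e1_gt0 e2_gt0)
  [F [G [r [FG F0 G0 [oscQ gelQ] [oscF gelG]]]]].
have := cvg_enum s_homo Ss (weak_limit_cplx_pairing (c := c) unbS wl FG F0 G0).
apply: cvg_ext => [n|] /=.
  rewrite -(oscF _ _ (mp _)) -(@cintegral_setT _ _ _ _ (QOmega Q Omega)).
    by apply: eq_cintegral => z /set_mem[Qz _]; rewrite pE.
  by move=> z nQ; rewrite oscQ ?mulr0// => Qz; apply: nQ.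
rewrite -(gelG _ mu0) cintegral_setT// => y nQ.
by rewrite gelQ ?mulr0// => Qy; apply: nQ; split.
Qed.
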